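(* Let $X=\mathbb{R}\times\mathbb{Z}(2)$ and let $\xi_1,\dots,\xi_n$ be independent random variables with values in $X$ and distributions $\mu_{\xi_1},\dots,\mu_{\xi_n}$. Let $a_j,b_j,c_j,d_j$ $(j=1,\dots,n)$ be continuous endomorphisms of $X$, and consider the linear forms $$L_1=a_1\xi_1+\cdots+a_n\xi_n,\quad L_2=b_1\xi_1+\cdots+b_n\xi_n,\quad L_3=c_1\xi_1+\cdots+c_n\xi_n,\quad L_4=d_1\xi_1+\cdots+d_n\xi_n.$$ Suppose that the random vectors $(L_1,L_2)$ and $(L_3,L_4)$ (with values in $X\times X$) are identically distributed. Then for every $i\in\{1,\dots,n\}$ such that $a_i'd_j'-b_i'c_j'\neq0$ for all $j=1,\dots,n$, one has $\mu_{\xi_i}\in\Lambda(X)$.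
   Context: $\mathbb{Z}(2)=\{0,1\}$ is the cyclic group of order 2 (discrete), and $X=\mathbb{R}\times\mathbb{Z}(2)$ is a locally compact Abelian group with elements written $(t,k)$, $t\in\mathbb{R}$, $k\in\mathbb{Z}(2)$. Its character group $Y$ is identified with $\mathbb{R}\times\mathbb{Z}(2)$, with elements written $(s,l)$, and pairing $((t,k),(s,l))=e^{its}(-1)^{kl}$. For a Borel probability measure $\mu$ on $X$ (the set of these is denoted $M^1(X)$) the characteristic function is $\widehat\mu(s,l)=\int_X (x,(s,l))\,d\mu(x)$. Every continuous endomorphism $a$ of $X$ has the form $a(t,k)=(a't,a''k)$ with $a'\in\mathbb{R}$ and $a''\in\{0,1\}$; the notation $a_j',b_j',c_j',d_j'$ refers to this representation. $\Lambda(X)$ is the class of all $\mu\in M^1(X)$ such that $s\mapsto\widehat\mu(s,0)$ is the characteristic function of a Gaussian distribution on the real line, possibly degenerate. *)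

(* Defs.v *)
From HB Require Import structures.
From mathcomp Require Import all_boot all_order all_algebra.
From mathcomp Require Import all_classical all_reals all_analysis.
From mathcomp Require Import complex.

Set Implicit Arguments.
Unset Strict Implicit.
Unset Printing Implicit Defensive.

Import Order.TTheory GRing.Theory Num.Theory.
Import numFieldNormedType.Exports.

Local Open Scope classical_set_scope.
Local Open Scope ring_scope.
Local Open Scope complex_scope.

(* The group R x Z(2).  [bool] carries in the libraries the group structure of
   Z(2) (addition is [addb]), the discrete topology and the discrete
   sigma-algebra; the product structures of [R * bool] are then those of
   R x Z(2), and its product sigma-algebra is the Borel one. *)
Notation RxZ2 R := (R * bool)%type.

(* The coefficient a' in a (t, k) = (a' t, a'' k), see [endoE] below. *)
Definition real_coef (R : realType) (a : {additive RxZ2 R -> RxZ2 R}) : R :=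
  (a (1, false)).1.

Definition Z2_coef (R : realType) (a : {additive RxZ2 R -> RxZ2 R}) : bool :=
  (a (0, true)).2.

Lemma endoE (R : realType) (a : {additive RxZ2 R -> RxZ2 R}) :
  continuous a -> forall x : RxZ2 R,
  a x = (real_coef a * x.1, Z2_coef a * x.2).
Proof.
move=> ca [t k].
pose f (u : R) : R := (a (u, false)).1.
have aD (u v : R) (p q : bool) : a (u + v, p + q) = a (u, p) + a (v, q).
  exact: (raddfD a (u, p) (v, q)).
have fD u v : f (u + v) = f u + f v by rewrite /f (aD u v false false).
have f0 : f 0 = 0 by apply: (@addIr _ (f 0)); rewrite -fD !add0r.
have fN u : f (- u) = - f u by apply: (@addIr _ (f u)); rewrite -fD !addNr.
have fMn u m : f (u *+ m) = f u *+ m.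
  by elim: m => [|m IHm]; rewrite ?mulr0n// !mulrS fD IHm.
have fMz u m : f (u *~ m) = f u *~ m.
  by case: m => m; rewrite ?NegzE ?mulrNz ?fN -!pmulrn fMn.
have fq q : f (ratr q) = f 1 * ratr q.
  have d0 : (denq q)%:~R != 0 :> R by rewrite intr_eq0 denq_neq0.
  apply: (mulIf d0); rewrite -mulrA mulrzr -fMz -mulrzr.
  by rewrite /ratr divfK// fMz mulrzr.
have cf : continuous f.
  move=> u; apply: (@continuous_comp _ _ _ (fun u : R => a (u, false)) fst).
    apply: (@continuous_comp _ _ _ (fun u : R => (u, false)) a).
      exact: (@cvg_pair _ _ _ (nbhs u) (nbhs u) (nbhs false) _ _ _ id
        (fun=> false) cvg_id (cvg_cst _)).
    exact: ca.
  exact: cvg_fst.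
have fE u : f u = f 1 * u.
  have [//|/eqP fu] := pselect (f u = f 1 * u).
  have cg : continuous (fun v : R => f v - f 1 * v).
    move=> v; apply: cvgB; first exact: cf.
    by apply: cvgM; [exact: cvg_cst|exact: cvg_id].
  have oU : open [set v : R | f v - f 1 * v != 0].
    apply: (@open_comp _ _ (fun v : R => f v - f 1 * v) [set x | x != 0]).
      by move=> v _; exact: cg.
    exact: open_neq.
  have [|v [/= + [q _ qv]]] := @dense_rat R _ _ oU.
    by exists u => /=; rewrite subr_eq0.
  by rewrite -qv fq subrr eqxx.
have a2 u : (a (u, false)).2 = false.
  rewrite {1}(splitr u) (aD _ _ false false); exact: addbb.
have a1 : (a (0, true)).1 = 0.
  have : (a (0, true)).1 *+ 2 = 0.
    rewrite mulr2n -[LHS]/((a (0, true) + a (0, true)).1) -aD addr0.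
    exact: f0.
  by move/eqP; rewrite mulrn_eq0 /= => /eqP.
have -> : a (t, k) = a (t, false) + a (0, k).
  by rewrite -aD addr0 add0r.
rewrite /real_coef /Z2_coef; case: k => /=.
  rewrite (surjective_pairing (a (t, false))) (surjective_pairing (a (0, true))).
  rewrite a2 a1 -[(a (t, false)).1]/(f t) fE mulr1.
  by congr pair; rewrite ?addr0 ?add0r.
rewrite (surjective_pairing (a (t, false))) (surjective_pairing (a (0, false))).
rewrite !a2 -![(a (_, false)).1]/(f _) f0 fE mulr0.
by congr pair; rewrite ?addr0.
Qed.

Definition independent_RVs d d' (T : measurableType d) (T' : measurableType d')
    (R : realType) (P : probability T R) (n : nat)
    (xi : 'I_n -> {RV P >-> T'}) : Prop :=
  forall (J : {set 'I_n}) (A : 'I_n -> set T'),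
    (forall j, measurable (A j)) ->
    P (\bigcap_(j in [set` J]) (xi j @^-1` A j)) =
    (\prod_(j in J) P (xi j @^-1` A j))%E.

Definition identically_distributed d d' (T : measurableType d)
    (T' : measurableType d') (R : realType) (P : probability T R)
    (U V : T -> T') : Prop :=
  forall A : set T', measurable A -> pushforward P U A = pushforward P V A.

Definition integralC d (T : measurableType d) (R : realType)
    (mu : probability T R) (f : T -> R[i]) : R[i] :=
  (\int[mu]_x complex.Re (f x))%R +i* (\int[mu]_x complex.Im (f x))%R.

Definition expi (R : realType) (t : R) : R[i] := cos t +i* sin t.

Definition pairing (R : realType) (x y : RxZ2 R) : R[i] :=
  expi (x.1 * y.1) * (-1) ^+ (x.2 && y.2).

Definition char_fun (R : realType) (mu : probability (RxZ2 R) R)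
    (y : RxZ2 R) : R[i] :=
  integralC mu (fun x => pairing x y).

Definition char_funR (R : realType) (mu : probability R R) (s : R) : R[i] :=
  integralC mu (fun t => expi (t * s)).

(* The degenerate case is stated separately because [normal_prob m 0] is
   the uniform distribution on [0, 1], not the Dirac measure at m. *)
Definition gaussian (R : realType) (mu : probability R R) : Prop :=
  (exists m : R, forall A, measurable A -> mu A = dirac m A) \/
  (exists m sigma : R, 0 < sigma /\
     forall A, measurable A -> mu A = normal_prob m sigma A).

Definition Lambda (R : realType) (mu : probability (RxZ2 R) R) : Prop :=
  exists gamma : probability R R, gaussian gamma /\
    forall s : R, char_fun mu (s, false) = char_funR gamma s.

(* Main.v *)
(* Only the real components X_j of the xi_j matter. With g_j(s) = |E e^{isX_j}|^2
   and linear forms l_j = (a_j', b_j'), m_j = (c_j', d_j') on the plane, equality of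
   the laws of (L_1, L_2) and (L_3, L_4) gives prod_j g_j(l_j(p)) = prod_j g_j(m_j(p)).
   Near 0 take logarithms and apply, for every form that is not proportional to l_i, a
   difference operator along its kernel; by hypothesis no m_j is proportional to l_i.
   What survives is a Frechet equation for psi = sum_{l_j ~ l_i} ln g_j(r_j s), where
   l_j = r_j l_i, so psi(s) = Q(s^2) near 0 for a polynomial Q.

   Let Z be the sum of the r_j X_j over the l_j ~ l_i. Fatou's lemma turns
   E cos(s(Z - Z')) = e^{Q(s^2)} into the even moments of the symmetrization Z - Z',
   whence Z has a moment generating function, and log|E e^{zZ}| is bounded above and
   below by a polynomial in |z|. These bounds pass to the independent summand X_i.
   Then u(z) = log|E e^{zX_i}| is the real part of a polynomial (Hadamard), and
   u(z) <= u(Re z) forces its degree to be at most 2 (Marcinkiewicz), so X_i has the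
   moment generating function of a Gaussian law, hence its characteristic function. *)

Require Import Defs.
From mathcomp Require Import all_boot all_order all_algebra.
From mathcomp Require Import all_classical all_reals all_analysis.
From mathcomp Require Import complex measurable_realfun ring lra.
From mathcomp Require polyrcf.
Import Order.TTheory GRing.Theory Num.Theory.
Import numFieldNormedType.Exports.
Local Open Scope classical_set_scope.
Local Open Scope ring_scope.

Set Implicit Arguments.
Unset Strict Implicit.
Unset Printing Implicit Defensive.
Local Open Scope complex_scope.

(* The modulus on [R[i]] with values in [R]; [`|z|] lives in [R[i]] itself. *)
Notation nc := Normc.normc.

(** Logarithms are available only near 0, since characteristic functions may vanish elsewhere; the
    local identity has to be turned into moments before anything global can be said. Symmetrization
    makes the transforms real and even, and the constant sign of the Taylor remainders of the cosine
    lets Fatou's lemma produce finite moments that are not assumed. The bound from below on log|E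
    e^{zZ}| matters as much as the one from above: it excludes zeros. Both bounds reach a single
    summand by division by the other factors, which is possible because every law satisfies E e^{tX}
    >= e^{-c(1+|t|)} on the real axis. The complex analysis is kept discrete. An entire function
    enters through its Taylor polynomials, which are eventually zero-free on a given disc and are
    products of linear factors; Cauchy integrals are replaced by finite averages over roots of
    unity, exact for polynomials of small degree. *)

Lemma ler_cvg_seq (R : realType) (u v : nat -> R) a b N :
  u @ \oo --> a -> v @ \oo --> b ->
  (forall n, (N <= n)%N -> u n <= v n) -> a <= b.
Proof. by move=> ua vb uv; apply: (ler_cvg_to ua vb); exists N. Qed.

(** * The modulus on [R[i]], with real values *)

Section ComplexModulus.
Variable R : realType.
Implicit Types (z w : R[i]) (x r t s : R).

Lemma ncE z : nc z = Num.sqrt (complex.Re z ^+ 2 + complex.Im z ^+ 2).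
Proof. by case: z. Qed.

Lemma nc_ge0 z : 0 <= nc z.
Proof. by rewrite ncE sqrtr_ge0. Qed.

Lemma sqr_nc z : nc z ^+ 2 = complex.Re z ^+ 2 + complex.Im z ^+ 2.
Proof. by rewrite ncE sqr_sqrtr// addr_ge0// sqr_ge0. Qed.

Lemma nc_real x : nc x%:C = `|x|.
Proof. by rewrite ncE /= expr0n addr0 sqrtr_sqr. Qed.

Lemma ncM z w : nc (z * w) = nc z * nc w.
Proof. exact: Normc.normcM. Qed.

Lemma nc0 : nc (0 : R[i]) = 0.
Proof. exact: Normc.normc0. Qed.

Lemma nc1 : nc (1 : R[i]) = 1.
Proof. exact: Normc.normc1. Qed.

Lemma ncN z : nc (- z) = nc z.
Proof. by rewrite !ncE; case: z => a b /=; rewrite !sqrrN. Qed.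

Lemma ncD z w : nc (z + w) <= nc z + nc w.
Proof. exact: le_normcD. Qed.

Lemma ncB z w : nc (z - w) <= nc z + nc w.
Proof. by rewrite -[nc w]ncN ncD. Qed.

Lemma nc_distC z w : nc (z - w) = nc (w - z).
Proof. by rewrite -ncN opprB. Qed.

Lemma ncX z n : nc (z ^+ n) = nc z ^+ n.
Proof.
by elim: n => [|n IH]; rewrite ?expr0 ?nc1// !exprS ncM IH.
Qed.

Lemma ncV z : nc z^-1 = (nc z)^-1.
Proof. exact: Normc.normcV. Qed.

Lemma nc_eq0 z : (nc z == 0) = (z == 0).
Proof.
apply/eqP/eqP => [|->]; last exact: nc0.
exact: Normc.eq0_normc.
Qed.

Lemma nc_gt0 z : (0 < nc z) = (z != 0).
Proof. by rewrite lt_def nc_ge0 andbT nc_eq0. Qed.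

Lemma nc_sum (I : Type) (s : seq I) (p : pred I) (F : I -> R[i]) :
  nc (\sum_(i <- s | p i) F i) <= \sum_(i <- s | p i) nc (F i).
Proof.
elim/big_rec2: _ => [|i y1 y2 _ le12]; first by rewrite nc0.
by rewrite (le_trans (ncD _ _))// lerD2l.
Qed.

Lemma nc_prod (I : Type) (s : seq I) (p : pred I) (F : I -> R[i]) :
  nc (\prod_(i <- s | p i) F i) = \prod_(i <- s | p i) nc (F i).
Proof.
elim/big_rec2: _ => [|i y1 y2 _ <-]; first by rewrite nc1.
by rewrite ncM.
Qed.

Lemma normr_Re_le z : `|complex.Re z| <= nc z.
Proof.
rewrite -[leLHS]sqrtr_sqr ncE ler_sqrt ?addr_ge0 ?sqr_ge0//.
by rewrite lerDl sqr_ge0.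
Qed.

Lemma normr_Im_le z : `|complex.Im z| <= nc z.
Proof.
rewrite -[leLHS]sqrtr_sqr ncE ler_sqrt ?addr_ge0 ?sqr_ge0//.
by rewrite lerDr sqr_ge0.
Qed.

Lemma nc_le_ReIm z : nc z <= `|complex.Re z| + `|complex.Im z|.
Proof.
rewrite -(@ler_pXn2r _ 2) ?nnegrE ?nc_ge0 ?addr_ge0//.
rewrite sqr_nc sqrrD !real_normK ?num_real//.
by rewrite -addrA lerD2l lerDr mulrn_wge0// mulr_ge0.
Qed.

Lemma cReD z w : complex.Re (z + w) = complex.Re z + complex.Re w.
Proof. by case: z w => ? ? []. Qed.
Lemma cImD z w : complex.Im (z + w) = complex.Im z + complex.Im w.
Proof. by case: z w => ? ? []. Qed.
Lemma cReN z : complex.Re (- z) = - complex.Re z. Proof. by case: z. Qed.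
Lemma cImN z : complex.Im (- z) = - complex.Im z. Proof. by case: z. Qed.
Lemma cReM z w : complex.Re (z * w) =
  complex.Re z * complex.Re w - complex.Im z * complex.Im w.
Proof. by case: z w => ? ? []. Qed.
Lemma cImM z w : complex.Im (z * w) =
  complex.Re z * complex.Im w + complex.Im z * complex.Re w.
Proof. by case: z w => ? ? [? ?]; rewrite /= [X in _ + X]mulrC addrC [X in X + _]mulrC addrC mulrC. Qed.

Lemma cRe_sum (I : Type) (s : seq I) (p : pred I) (F : I -> R[i]) :
  complex.Re (\sum_(i <- s | p i) F i) = \sum_(i <- s | p i) complex.Re (F i).
Proof. by elim/big_rec2: _ => // i y1 y2 _ <-; rewrite cReD. Qed.

Lemma cIm_sum (I : Type) (s : seq I) (p : pred I) (F : I -> R[i]) :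
  complex.Im (\sum_(i <- s | p i) F i) = \sum_(i <- s | p i) complex.Im (F i).
Proof. by elim/big_rec2: _ => // i y1 y2 _ <-; rewrite cImD. Qed.

Lemma cRe_mull x z : complex.Re (x%:C * z) = x * complex.Re z.
Proof. by rewrite cReM /= mul0r subr0. Qed.

Lemma cIm_mull x z : complex.Im (x%:C * z) = x * complex.Im z.
Proof. by rewrite cImM /= mul0r addr0. Qed.

Lemma nc_lim_le (u : nat -> R[i]) l v B N :
  (nc (u M - l) @[M --> \oo] --> 0) ->
  (forall M, (N <= M)%N -> nc (u M - v) <= B) -> nc (l - v) <= B.
Proof.
move=> ul uB; rewrite -[B]addr0.
have cB : (B + nc (u M - l)) @[M --> \oo] --> B + 0.
  by apply: cvgD => //; exact: cvg_cst.
apply: (ler_cvg_seq (N := N) (cvg_cst (nc (l - v))) cB) => M NM.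
have -> : l - v = (u M - v) - (u M - l) by ring.
by rewrite (le_trans (ncB _ _))// lerD2r uB.
Qed.

Lemma nc_lim_uniq (u : nat -> R[i]) k l :
  (nc (u M - l) @[M --> \oo] --> 0) ->
  (nc (u M - k) @[M --> \oo] --> 0) -> k = l.
Proof.
move=> ul uk; apply/eqP; rewrite -subr_eq0 -nc_eq0 eq_le nc_ge0 andbT.
have c0 : (nc (u M - k) + nc (u M - l)) @[M --> \oo] --> (0 + 0 : R).
  exact: cvgD.
rewrite -[leRHS](addr0 0).
apply: (ler_cvg_seq (N := 0%N) (cvg_cst (nc (k - l))) c0) => M _.
have -> : k - l = (u M - l) - (u M - k) by ring.
by rewrite (le_trans (ncB _ _))// addrC.
Qed.

End ComplexModulus.

(** Stated over any field, so that one definition covers the real and the complex exponential. *)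
Definition etrunc (F : fieldType) (N : nat) (w : F) : F :=
  \sum_(k < N) w ^+ k / k`!%:R.

(** Its value at |w| majorizes the remainder of the complex exponential series at w. *)
Definition etail (R : realType) (N : nat) (r : R) : R := expR r - etrunc N r.

Definition cexp (R : realType) (w : R[i]) : R[i] :=
  (expR (complex.Re w))%:C * expi (complex.Im w).

Lemma addrKl (V : zmodType) (a b : V) : a + b - a = b.
Proof. by rewrite addrC addKr. Qed.

(** * The complex exponential *)

Section ExponentialSeries.
Variable R : realType.
Implicit Types (z w : R[i]) (x r t s : R).

Lemma etrunc_series x N : etrunc N x = series (exp_coeff x) N.
Proof. by rewrite /etrunc /series /= big_mkord. Qed.

Lemma cvg_etrunc x : etrunc N x @[N --> \oo] --> expR x.
Proof.
under eq_fun do rewrite etrunc_series.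
exact: is_cvg_series_exp_coeff.
Qed.

Lemma etrunc_le N M r : 0 <= r -> (N <= M)%N -> etrunc N r <= etrunc M r.
Proof.
move=> r0 /subnKC <-; rewrite /etrunc big_split_ord /= lerDl sumr_ge0// => i _.
by rewrite divr_ge0 ?exprn_ge0.
Qed.

Lemma etrunc_le_expR N r : 0 <= r -> etrunc N r <= expR r.
Proof.
move=> r0; apply: (ler_cvg_seq (N := N) (cvg_cst (etrunc N r)) (@cvg_etrunc r)) => M.
exact: etrunc_le.
Qed.

Lemma etail_ge0 N r : 0 <= r -> 0 <= etail N r.
Proof. by move=> r0; rewrite subr_ge0 etrunc_le_expR. Qed.

Lemma cvg_etail r : etail N r @[N --> \oo] --> 0.
Proof.
rewrite -(subrr (expR r)); apply: cvgB; first exact: cvg_cst.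
exact: cvg_etrunc.
Qed.

Lemma etrunc_real N x : etrunc N x%:C = (etrunc N x)%:C :> R[i].
Proof.
rewrite /etrunc rmorph_sum; apply: eq_bigr => k _.
by rewrite rmorphM rmorphXn fmorphV rmorph_nat.
Qed.

Lemma nc_nat n : nc (n%:R : R[i]) = n%:R.
Proof. by rewrite -(rmorph_nat (real_complex R)) nc_real normr_nat. Qed.

Lemma nc_etrunc_sub N M w : (N <= M)%N ->
  nc (etrunc M w - etrunc N w) <= etrunc M (nc w) - etrunc N (nc w).
Proof.
move=> /subnKC <-; rewrite /etrunc !big_split_ord /= !addrKl.
rewrite (le_trans (nc_sum _ _ _))// ler_sum// => i _.
by rewrite ncM ncV ncX nc_nat.
Qed.

Lemma big_triangle (V : zmodType) N (G : nat -> nat -> V) :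
  \sum_(0 <= k < N) \sum_(0 <= i < k.+1) G i (k - i)%N =
  \sum_(0 <= i < N) \sum_(0 <= j < N - i) G i j.
Proof.
elim: N => [|N IH]; first by rewrite !big_nil.
rewrite big_nat_recr//= IH [RHS]big_nat_recr//= subSnn big_nat1.
rewrite [in LHS]big_nat_recr//= subnn addrA; congr (_ + _).
rewrite -big_split/=; apply: eq_big_nat => i /andP[_ iN].
by rewrite subSn ?(ltnW iN)// big_nat_recr.
Qed.

Lemma etruncD (F : numFieldType) N (a b : F) :
  etrunc N (a + b) = \sum_(0 <= i < N) \sum_(0 <= j < N - i)
    a ^+ i / i`!%:R * (b ^+ j / j`!%:R).
Proof.
rewrite -(big_triangle N (fun i j => a ^+ i / i`!%:R * (b ^+ j / j`!%:R))).
rewrite /etrunc -(big_mkord xpredT (fun k => (a + b) ^+ k / k`!%:R)).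
apply: eq_bigr => k _; rewrite addrC exprDn mulr_suml.
rewrite -(big_mkord xpredT (fun i => b ^+ (k - i) * a ^+ i *+ 'C(k, i) / k`!%:R)).
apply: eq_big_nat => i /andP[_ ik]; rewrite -mulr_natr.
have f0 n : (n`!%:R : F) != 0 by rewrite pnatr_eq0 -lt0n fact_gt0.
by rewrite -(@bin_fact k i)// !natrM; field; rewrite !f0 pnatr_eq0 -lt0n bin_gt0.
Qed.

(** The product of the truncations contains all terms with i, j < N; by the binomial theorem the
    truncation at a + b contains those with i + j < N. What remains is the corner i + j >= N. *)
Lemma etruncM (F : numFieldType) N (a b : F) :
  etrunc N a * etrunc N b - etrunc N (a + b) =
  \sum_(0 <= i < N) \sum_(N - i <= j < N)
    a ^+ i / i`!%:R * (b ^+ j / j`!%:R).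
Proof.
rewrite etruncD /etrunc mulr_suml -(big_mkord xpredT
  (fun i => a ^+ i / i`!%:R * \sum_(j < N) b ^+ j / j`!%:R)) -sumrB.
apply: eq_bigr => i _.
rewrite mulr_sumr -(big_mkord xpredT
  (fun j => a ^+ i / i`!%:R * (b ^+ j / j`!%:R))).
by rewrite (@big_cat_nat _ _ _ (N - i))//= ?leq_subr// addrAC subrr add0r.
Qed.

(** The corner terms are dominated by those of the moduli, for which the same identity holds over
    the reals, where the full series multiply. *)
Lemma nc_etruncM N (a b : R[i]) :
  nc (etrunc N a * etrunc N b - etrunc N (a + b)) <= etail N (nc a + nc b).
Proof.
apply: (@le_trans _ _
    (etrunc N (nc a) * etrunc N (nc b) - etrunc N (nc a + nc b))).
  rewrite !etruncM (le_trans (nc_sum _ _ _))// ler_sum// => i _.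
  rewrite (le_trans (nc_sum _ _ _))// ler_sum// => j _.
  by rewrite !ncM !ncV !ncX !nc_nat.
rewrite lerD2r expRD ler_pM ?etrunc_le_expR ?nc_ge0// sumr_ge0// => i _;
  by rewrite divr_ge0 ?exprn_ge0 ?nc_ge0.
Qed.

Lemma exprc_i n : 'i ^+ n = ((-1) ^+ n./2)%:C * 'i ^+ odd n :> R[i].
Proof.
rewrite -{1}(odd_double_half n) exprD -mul2n exprM sqr_i mulrC.
by rewrite rmorphXn rmorphN rmorph1.
Qed.

Lemma cReX_i n : complex.Re ('i ^+ n : R[i]) = if odd n then 0 else (-1) ^+ n./2.
Proof. by rewrite exprc_i cRe_mull; case: odd; rewrite /= ?mulr0 ?mulr1. Qed.

Lemma cImX_i n : complex.Im ('i ^+ n : R[i]) = if odd n then (-1) ^+ n./2 else 0.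
Proof. by rewrite exprc_i cIm_mull; case: odd; rewrite /= ?mulr0 ?mulr1. Qed.

Lemma cvg_etrunc_imag s :
  nc (etrunc N ('i * s%:C) - expi s) @[N --> \oo] --> 0.
Proof.
have termE (k : nat) : ('i * s%:C) ^+ k / k`!%:R =
    (s ^+ k / k`!%:R)%:C * 'i ^+ k :> R[i].
  rewrite exprMn -rmorphXn rmorphM fmorphV rmorph_nat; ring.
have ReE N : complex.Re (etrunc N ('i * s%:C)) = series (cos_coeff s) N.
  rewrite /etrunc cRe_sum /series /= big_mkord; apply: eq_bigr => k _.
  rewrite termE cRe_mull cReX_i /cos_coeff /=; case: (odd k) => /=.
    by rewrite mulr0 mul0r !mul0r.
  by rewrite mul1r mulrC mulrA.
have ImE N : complex.Im (etrunc N ('i * s%:C)) = series (sin_coeff s) N.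
  rewrite /etrunc cIm_sum /series /= big_mkord; apply: eq_bigr => k _.
  rewrite termE cIm_mull cImX_i /sin_coeff /=; case: (boolP (odd k)) => ok /=; last first.
    by rewrite mulr0 mul0r !mul0r.
  rewrite mul1r mulrC mulrA.
  have -> : (k.-1./2 = k./2)%N.
    by case: (k : nat) ok => //= n; rewrite uphalf_half => /negbTE ->.
  by [].
have c0 : (`|series (cos_coeff s) N - cos s| + `|series (sin_coeff s) N - sin s|)
    @[N --> \oo] --> (0 + 0 : R).
  apply: cvgD; apply/norm_cvg0P.
    rewrite -[X in _ --> X](subrr (cos s)); apply: cvgB; last exact: cvg_cst.
    by rewrite unlock; exact: is_cvg_series_cos_coeff.
  rewrite -[X in _ --> X](subrr (sin s)); apply: cvgB; last exact: cvg_cst.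
  by rewrite unlock; exact: is_cvg_series_sin_coeff.
rewrite addr0 in c0.
apply: (squeeze_cvgr _ (cvg_cst 0) c0); apply: nearW => N.
rewrite nc_ge0/= (le_trans (nc_le_ReIm _))//.
by rewrite !cReD !cReN !cImD !cImN ReE ImE.
Qed.

Lemma nc_expi s : nc (expi s) = 1.
Proof. by rewrite ncE /= cos2Dsin2 sqrtr1. Qed.

Lemma nc_cexp w : nc (cexp w) = expR (complex.Re w).
Proof. by rewrite ncM nc_expi mulr1 nc_real ger0_norm ?expR_ge0. Qed.

Lemma cvg_etrunc_cexp w : nc (etrunc N w - cexp w) @[N --> \oo] --> 0.
Proof.
case: w => t s; have -> : cexp (t +i* s) = (expR t)%:C * expi s by [].
have -> : t +i* s = t%:C + 'i * s%:C by rewrite [LHS]complexE.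
pose f N := etail N (`|t| + `|s|) +
  (expR `|t| * nc (etrunc N ('i * s%:C) - expi s) + `|etrunc N t - expR t|).
have f0 : f N @[N --> \oo] --> 0.
  rewrite -[X in _ --> X](addr0 0); apply: cvgD; first exact: cvg_etail.
  rewrite -[X in _ --> X](addr0 0); apply: cvgD.
    rewrite -[X in _ --> X](mulr0 (expR `|t|)); apply: cvgM; first exact: cvg_cst.
    exact: cvg_etrunc_imag.
  apply/norm_cvg0P; rewrite -[X in _ --> X](subrr (expR t)).
  by apply: cvgB; [exact: cvg_etrunc|exact: cvg_cst].
apply: (squeeze_cvgr _ (cvg_cst 0) f0); apply: nearW => N.
rewrite nc_ge0/=; set e := expi s; set E := etrunc N.
(* With b and q the truncations at t and is, the truncation at t + is is compared with b q, and then
   b q with the product x y of the limits. *)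
have split_prod (a b q x y : R[i]) : a - x * y = - (b * q - a) + (b * (q - y) + (b - x) * y).
  by ring.
rewrite (split_prod _ (E t%:C) (E ('i * s%:C))).
rewrite (le_trans (ncD _ _))// ncN lerD//.
  by rewrite (le_trans (nc_etruncM _ _ _))// ncM !nc_real ncE /= expr0n add0r expr1n sqrtr1 mul1r.
rewrite (le_trans (ncD _ _))// !ncM /E etrunc_real nc_real -rmorphB nc_real.
rewrite nc_expi mulr1 lerD2r ler_wpM2r ?nc_ge0//.
rewrite (le_trans _ (etrunc_le_expR N (normr_ge0 t)))//.
rewrite (le_trans (ler_norm_sum _ _ _))// ler_sum// => i _.
by rewrite normrM normfV normrX normr_nat.
Qed.

Lemma nc_etrunc_cexp N w : nc (cexp w - etrunc N w) <= etail N (nc w).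
Proof.
apply: (nc_lim_le (@cvg_etrunc_cexp w) (N := N)) => M NM.
by rewrite (le_trans (nc_etrunc_sub _ NM))// lerD2r etrunc_le_expR ?nc_ge0.
Qed.

Lemma etail_le N r s : 0 <= r -> r <= s -> etail N r <= etail N s.
Proof.
move=> r0 rs; apply: (ler_cvg_seq (N := N)
  (u := fun M => etrunc M r - etrunc N r) (v := fun M => etrunc M s - etrunc N s)).
- by apply: cvgB; [exact: cvg_etrunc|exact: cvg_cst].
- by apply: cvgB; [exact: cvg_etrunc|exact: cvg_cst].
move=> M /subnKC <-; rewrite /etrunc !big_split_ord /= !addrKl.
apply: ler_sum => i _; rewrite ler_wpM2r ?invr_ge0// lerXn2r// nnegrE//.
exact: le_trans rs.
Qed.

Lemma cexp_real x : cexp x%:C = (expR x)%:C.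
Proof. by rewrite /cexp /expi /= cos0 sin0 mulr1. Qed.

Lemma cexp_imag x : cexp ('i * x%:C) = expi x.
Proof. by rewrite /cexp cReM cImM /= !mul0r mulr0 mul1r subr0 add0r expR0 mul1r. Qed.

Lemma expiD x y : expi (x + y) = expi x * expi y.
Proof.
by rewrite /expi cosD sinD; apply/eqP; rewrite eq_complex /= eqxx addrC/= [_ * sin y]mulrC eqxx.
Qed.

Lemma expiX x n : expi x ^+ n = expi (x * n%:R).
Proof.
elim: n => [|n IH]; first by rewrite expr0 mulr0 /expi cos0 sin0.
by rewrite exprS IH -expiD -natr1 mulrDr mulr1 addrC.
Qed.

Lemma cexpD z w : cexp (z + w) = cexp z * cexp w.
Proof. by rewrite /cexp cReD cImD expRD expiD rmorphM; ring. Qed.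

End ExponentialSeries.

Notation "p ^:C" := (map_poly (real_complex _) p) (at level 2, format "p ^:C").

(** * The power series of the exponential of a polynomial *)

Section ExpPoly.
Variable R : realType.
Implicit Types (p q Q : {poly R}) (w : R[i]) (x : R).

(** The majorant of [p]: at |w| it bounds |p(w)|, and its powers bound the coefficients of the
    powers of [p]. *)
Definition abs_poly p : {poly R} := \poly_(i < size p) `|p`_i|.

Definition exp_poly Q N : {poly R} := \sum_(i < N) (i`!%:R)^-1 *: Q ^+ i.

(* The Taylor coefficients of [exp Q], for [Q] with zero constant term. *)
Definition exp_poly_coef Q k : R := (exp_poly Q k.+1)`_k.

Lemma coef_abs_poly p i : (abs_poly p)`_i = `|p`_i|.
Proof.
by rewrite coef_poly; case: ltnP => // pi; rewrite nth_default// normr0.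
Qed.

Lemma abs_poly_ge0 p x : 0 <= x -> 0 <= (abs_poly p).[x].
Proof.
move=> x0; rewrite horner_coef sumr_ge0// => i _.
by rewrite coef_abs_poly mulr_ge0// exprn_ge0.
Qed.

Lemma horner_complex p w n : (size p <= n)%N ->
  p^:C.[w] = \sum_(i < n) (p`_i)%:C * w ^+ i.
Proof.
move=> pn; rewrite (@horner_coef_wide _ n).
  by apply: eq_bigr => i _; rewrite coef_map.
by rewrite (leq_trans _ pn)// size_map_poly.
Qed.

Lemma horner_complex_real p x : p^:C.[x%:C] = (p.[x])%:C.
Proof. by rewrite horner_map. Qed.

Lemma nc_horner_le p w : nc (p^:C.[w]) <= (abs_poly p).[nc w].
Proof.
rewrite (@horner_complex _ _ (size p))// (@horner_coef_wide _ (size p)) ?size_poly//.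
rewrite (le_trans (nc_sum _ _ _))// ler_sum// => i _.
by rewrite ncM nc_real ncX coef_abs_poly.
Qed.

Lemma coefX_gt Q i k : Q`_0 = 0 -> (k < i)%N -> (Q ^+ i)`_k = 0.
Proof.
move=> Q0; elim: i k => // i IH k ki.
rewrite exprS coefM big1// => j _.
case: (posnP j) => [->|j0]; first by rewrite Q0 mul0r.
by rewrite IH ?mulr0// (leq_trans _ (_ : k <= i)%N)// ltn_subrL j0 (leq_trans j0)// -ltnS.
Qed.

(** Without constant term, Q^i has no monomial of degree below i, so the coefficient of degree k is
    stable once the truncation exceeds k. *)
Lemma exp_poly_coefE Q N k : Q`_0 = 0 -> (k < N)%N ->
  (exp_poly Q N)`_k = exp_poly_coef Q k.
Proof.
move=> Q0 /subnKC <-; rewrite /exp_poly_coef /exp_poly big_split_ord /=.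
rewrite coefD [X in _ + X]coef_sum [X in _ + X]big1 ?addr0// => i _.
by rewrite coefZ coefX_gt ?mulr0// ltnS leq_addr.
Qed.

Lemma abs_coefX Q i k : `|(Q ^+ i)`_k| <= (abs_poly Q ^+ i)`_k.
Proof.
elim: i k => [|i IH] k; first by rewrite !expr0 coef1 normr_nat.
rewrite !exprS !coefM (le_trans (ler_norm_sum _ _ _))// ler_sum// => j _.
by rewrite normrM coef_abs_poly ler_wpM2l.
Qed.

Lemma abs_coef_exp_poly Q N k :
  `|(exp_poly Q N)`_k| <= (exp_poly (abs_poly Q) N)`_k.
Proof.
rewrite !coef_sum (le_trans (ler_norm_sum _ _ _))// ler_sum// => j _.
by rewrite !coefZ normrM ger0_norm ?invr_ge0// ler_wpM2l ?invr_ge0// abs_coefX.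
Qed.

Lemma horner_exp_poly Q N x : (exp_poly Q N).[x] = etrunc N Q.[x].
Proof.
rewrite horner_sum; apply: eq_bigr => i _.
by rewrite hornerZ horner_exp mulrC.
Qed.

Lemma horner_exp_poly_complex Q N w :
  (exp_poly Q N)^:C.[w] = etrunc N (Q^:C.[w]).
Proof.
rewrite rmorph_sum horner_sum; apply: eq_bigr => i _.
rewrite /= map_polyZ rmorphXn hornerZ horner_exp mulrC.
by rewrite /= fmorphV rmorph_nat.
Qed.

Lemma sum_abs_exp_poly_coef Q x N : Q`_0 = 0 -> 0 <= x ->
  \sum_(k < N) `|exp_poly_coef Q k| * x ^+ k <= expR (abs_poly Q).[x].
Proof.
move=> Q0 x0; apply: le_trans (etrunc_le_expR N (abs_poly_ge0 Q x0)).
rewrite -horner_exp_poly.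
set P := exp_poly _ N.
rewrite (@horner_coef_wide _ (size P + N))%N ?leq_addr// addnC.
rewrite big_split_ord /= -[leLHS]addr0 lerD//.
  apply: ler_sum => i _; rewrite ler_wpM2r ?exprn_ge0//.
  by rewrite -(@exp_poly_coefE _ N)// abs_coef_exp_poly.
rewrite sumr_ge0// => i _; rewrite mulr_ge0 ?exprn_ge0//.
exact: le_trans (abs_coef_exp_poly _ _ _).
Qed.

(** The polynomial [exp_poly Q N] has the right coefficients below degree N. Its coefficients from
    degree N on are estimated by the majorant at 2|w| instead of |w|, which gains the factor 2^{-N};
    the last summand is the truncation error of the exponential. *)
Lemma exp_poly_series_dist Q w N : Q`_0 = 0 ->
  nc (\sum_(k < N) (exp_poly_coef Q k)%:C * w ^+ k - cexp (Q^:C.[w])) <=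
  2^-1 ^+ N * expR (abs_poly Q).[2 * nc w] + etail N (abs_poly Q).[nc w].
Proof.
move=> Q0; set T := exp_poly Q N; set M := (N + size T)%N.
have TE : T^:C.[w] = \sum_(k < N) (exp_poly_coef Q k)%:C * w ^+ k +
    \sum_(k < size T) (T`_(N + k))%:C * w ^+ (N + k).
  rewrite (@horner_complex _ _ M) ?leq_addl// big_split_ord /=; congr (_ + _).
  by apply: eq_bigr => i _; rewrite exp_poly_coefE.
have -> : \sum_(k < N) (exp_poly_coef Q k)%:C * w ^+ k - cexp Q^:C.[w] =
   (etrunc N (Q^:C.[w]) - cexp Q^:C.[w]) -
    \sum_(k < size T) (T`_(N + k))%:C * w ^+ (N + k).
  by rewrite -horner_exp_poly_complex -/T TE; ring.
rewrite [leRHS]addrC (le_trans (ncB _ _))// lerD//.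
  rewrite nc_distC (le_trans (nc_etrunc_cexp _ _))//.
  by rewrite etail_le ?nc_ge0// nc_horner_le.
rewrite (le_trans (nc_sum _ _ _))//.
set P := exp_poly (abs_poly Q) N.
have P0 k : 0 <= P`_k by exact: le_trans (abs_coef_exp_poly _ _ _).
apply: (@le_trans _ _ (2^-1 ^+ N * \sum_(k < size T) P`_(N + k) * (2 * nc w) ^+ (N + k))).
  rewrite mulr_sumr ler_sum// => i _; rewrite ncM nc_real ncX mulrCA.
  rewrite ler_pM ?exprn_ge0 ?nc_ge0 ?abs_coef_exp_poly//.
  have -> : 2^-1 ^+ N * (2 * nc w) ^+ (N + i) = 2 ^+ i * nc w ^+ (N + i).
    rewrite exprMn [2 ^+ (N + i)]exprD mulrA mulrA -exprMn mulVf ?pnatr_eq0//.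
    by rewrite expr1n mul1r.
  by rewrite ler_peMl ?exprn_ge0 ?nc_ge0// exprn_ege1// ler1n.
rewrite ler_wpM2l ?exprn_ge0 ?invr_ge0//.
have w0 : 0 <= 2 * nc w by rewrite mulr_ge0 ?nc_ge0.
apply: le_trans (etrunc_le_expR N (abs_poly_ge0 Q w0)).
rewrite -horner_exp_poly -/P.
rewrite (@horner_coef_wide _ (N + (size T + size P)))%N ?addnA ?leq_addl// -addnA.
rewrite big_split_ord /= big_split_ord /= addrCA lerDl addr_ge0// sumr_ge0// => i _;
  by rewrite mulr_ge0 ?exprn_ge0.
Qed.

Lemma cvg_exp_poly_series Q w : Q`_0 = 0 ->
  nc (\sum_(k < N) (exp_poly_coef Q k)%:C * w ^+ k - cexp (Q^:C.[w]))
    @[N --> \oo] --> 0.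
Proof.
move=> Q0.
pose f N := 2^-1 ^+ N * expR (abs_poly Q).[2 * nc w] + etail N (abs_poly Q).[nc w].
have f0 : f N @[N --> \oo] --> 0.
  rewrite -[X in _ --> X](addr0 0); apply: cvgD; last exact: cvg_etail.
  rewrite -[X in _ --> X](mul0r (expR (abs_poly Q).[2 * nc w])).
  apply: cvgM; last exact: cvg_cst.
  by apply: cvg_expr; rewrite ger0_norm ?invr_ge0// invf_lt1// ltr1n.
apply: (squeeze_cvgr _ (cvg_cst 0) f0); apply: nearW => N.
by rewrite nc_ge0 exp_poly_series_dist.
Qed.

Lemma cvg_exp_poly_series_real Q x : Q`_0 = 0 ->
  \sum_(k < N) exp_poly_coef Q k * x ^+ k @[N --> \oo] --> expR Q.[x].
Proof.
move=> Q0; apply/subr_cvg0/norm_cvg0P; move: (cvg_exp_poly_series (x%:C) Q0).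
apply: cvg_trans; apply: near_eq_cvg; apply: nearW => N.
rewrite horner_complex_real cexp_real -nc_real rmorphB rmorph_sum.
congr (nc (_ - _)); apply: eq_bigr => k _.
by rewrite rmorphM rmorphXn.
Qed.

End ExpPoly.

(** * Entire functions whose logarithm grows polynomially *)

Section LogSeries.
Variable R : realType.
Implicit Types (z w v : R[i]) (t x r : R).

Lemma MVT01 (f df : R -> R) :
  (forall x, 0 <= x <= 1 -> is_derive x 1 f (df x)) ->
  exists2 c, 0 <= c <= 1 & f 1 - f 0 = df c.
Proof.
move=> fd; have [|x||c] := @MVT_segment R f df 0 1; rewrite ?ler01//.
- by rewrite in_itv/= => /andP[/ltW x0 /ltW x1]; apply: fd; rewrite x0.
- apply: derivable_within_continuous => x; rewrite in_itv/= => x01.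
  by have [] := fd _ x01.
by rewrite in_itv/= subr0 mulr1 => c01 fE; exists c.
Qed.

Lemma ln_nc z : z != 0 -> ln (nc z) = 2^-1 * ln (nc z ^+ 2).
Proof.
by move=> z0; rewrite lnXn ?nc_gt0// mulr2n; field.
Qed.

Lemma cRe_divc z v : complex.Re (z / v) =
  (complex.Re z * complex.Re v + complex.Im z * complex.Im v) / nc v ^+ 2.
Proof.
by rewrite sqr_nc; case: z v => a b [c d]; rewrite cReM /=; ring.
Qed.

(* The remainder is estimated by the mean value theorem along the segment
   from 0 to [w], on which the derivative is a geometric series. *)
Lemma ln_nc_1B_series w K : nc w < 1 ->
  `|ln (nc (1 - w)) + complex.Re (\sum_(m < K.+1) w ^+ m / m%:R)| <=
  nc w ^+ K.+1 / (1 - nc w).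
Proof.
move=> w1; have w0 := nc_ge0 w.
pose a := complex.Re w; pose b := complex.Im w.
(* [f] is ln|1 - tw| + Re sum_m (tw)^m / m, written with real polynomials in t so that it can be
   differentiated; [q] is |1 - tw|^2. The term m = 0 vanishes because division by 0 returns 0. *)
pose q : {poly R} := (1 - a%:P * 'X) ^+ 2 + (b%:P * 'X) ^+ 2.
pose p : {poly R} := \poly_(m < K.+1) (complex.Re (w ^+ m) / m%:R).
pose f t := 2^-1 * ln q.[t] + p.[t].
have v0 t : 0 <= t <= 1 -> 1 - t%:C * w != 0.
  move=> /andP[t0 t1]; apply/eqP => /eqP; rewrite subr_eq0 => /eqP /(congr1 (@nc R)).
  rewrite nc1 ncM nc_real ger0_norm// => e.
  have : t * nc w <= nc w by rewrite ler_piMl.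
  by rewrite -e leNgt w1.
have qE t : q.[t] = nc (1 - t%:C * w) ^+ 2.
  by rewrite sqr_nc cReD cImD cReN cImN cRe_mull cIm_mull !hornerE /=; ring.
have q0 t : 0 <= t <= 1 -> 0 < q.[t].
  by move=> t01; rewrite qE exprn_gt0// nc_gt0 v0.
pose df t := 2^-1 * (q^`().[t] / q.[t]) + p^`().[t].
have fd t : 0 <= t <= 1 -> is_derive t 1 f (df t).
  move=> t01; apply: is_deriveD.
  have -> : (fun x => 2^-1 * ln q.[x]) = 2^-1 *: (@ln R \o horner q) by [].
  apply: is_deriveZ; rewrite mulrC; apply: is_derive1_comp.
  by apply: is_derive1_ln; exact: q0.
have [c c01 fE] := MVT01 fd.
have fE1 : f 1 = ln (nc (1 - w)) + complex.Re (\sum_(m < K.+1) w ^+ m / m%:R).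
  rewrite /f qE mul1r -ln_nc; last by rewrite -[w]mul1r v0// ler01 lexx.
  congr (_ + _); rewrite cRe_sum (@horner_coef_wide _ K.+1) ?size_poly//.
  apply: eq_bigr => m _; rewrite coef_poly ltn_ord expr1n mulr1.
  rewrite -(rmorph_nat (real_complex R)) -fmorphV.
  by rewrite [X in _ = complex.Re X]mulrC cRe_mull mulrC.
have fE0 : f 0 = 0.
  rewrite /f qE mul0r subr0 nc1 expr1n ln1 mulr0 add0r horner_coef0 coef_poly /=.
  by rewrite invr0 mulr0.
rewrite -fE1 -[f 1]subr0 -fE0 fE.
have cw : nc (c%:C * w) <= nc w.
  by case/andP: c01 => c0 c1; rewrite ncM nc_real ger0_norm// ler_piMl.
have -> : df c = - complex.Re ((w * (c%:C * w) ^+ K) / (1 - c%:C * w)).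
  set v := 1 - c%:C * w.
  have p'E : p^`().[c] = complex.Re (w * (1 - (c%:C * w) ^+ K) / v).
    have -> : w * (1 - (c%:C * w) ^+ K) / v = \sum_(i < K) w * (c%:C * w) ^+ i.
      rewrite -mulr_sumr -{1}(expr1n _ K) subrXX.
      rewrite -/v mulrCA mulrAC divff ?mul1r; last exact: v0.
      by congr (_ * _); apply: eq_bigr => i _; rewrite expr1n mul1r.
    rewrite (@horner_coef_wide _ K); last first.
      apply/leq_sizeP => j Kj; rewrite coef_deriv nth_default ?mul0rn//.
      by rewrite (leq_trans (size_poly _ _)).
    rewrite cRe_sum; apply: eq_bigr => i _.
    rewrite coef_deriv coef_poly ltnS ltn_ord -[X in X * _]mulr_natr divfK ?pnatr_eq0//.
    by rewrite exprMn -rmorphXn mulrCA -exprS cRe_mull mulrC.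
  have q'E : 2^-1 * (q^`().[c] / q.[c]) = - complex.Re (w / v).
    rewrite cRe_divc -qE mulrA -mulNr; congr (_ / _).
    rewrite /v cReD cImD cReN cImN cRe_mull cIm_mull -/a -/b.
    by rewrite /q !poly.derivE !hornerE /=; field.
  by rewrite /df p'E q'E -!cReN -cReD; congr (complex.Re _); ring.
rewrite normrN (le_trans (normr_Re_le _))// !ncM ncV ncX.
rewrite exprS -!mulrA ler_wpM2l// ler_pM ?exprn_ge0 ?invr_ge0 ?nc_ge0//.
  by rewrite lerXn2r ?nnegrE ?nc_ge0.
rewrite lef_pV2 ?posrE ?subr_gt0// ?nc_gt0 ?v0//.
have : nc 1 <= nc (1 - c%:C * w) + nc (c%:C * w).
  by rewrite -{1}[1](subrK (c%:C * w)) ncD.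
rewrite nc1; lra.
Qed.

End LogSeries.

(** * Averages over roots of unity on a circle *)

Section CircleAverages.
Variable R : realType.
Implicit Types (z w v : R[i]) (t x r : R).

Lemma expi_neq1 x : 0 < x < pi *+ 2 -> expi x != 1.
Proof.
move=> /andP[x0 x2]; apply/eqP => /(congr1 (@complex.Re R)) /= cx.
have s0 : 0 < sin (x / 2).
  by rewrite sin_gt0_pi// divr_gt0//= ltr_pdivrMr// mulr_natr.
have := cos_mulr2n (x / 2); rewrite -[x / 2 *+ 2]mulr_natr divfK ?pnatr_eq0// cx cos2sin2.
have s2 : 0 < sin (x / 2) ^+ 2 by rewrite exprn_gt0.
by move=> e; lra.
Qed.

Lemma expi_pi2 : expi (pi *+ 2 : R) = 1.
Proof. by rewrite /expi cos2pi sin2pi. Qed.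

Definition root1 (L : nat) : R[i] := expi (pi *+ 2 / L%:R).

Lemma root1_exp L : (0 < L)%N -> root1 L ^+ L = 1.
Proof.
by move=> L0; rewrite expiX divfK ?expi_pi2// pnatr_eq0 -lt0n.
Qed.

Lemma root1_neq1 L m : (0 < m < L)%N -> root1 L ^+ m != 1.
Proof.
move=> /andP[m0 mL]; have L0 : 0 < L%:R :> R by rewrite ltr0n (ltn_trans m0).
have p0 : 0 < pi *+ 2 :> R by rewrite mulrn_wgt0 ?pi_gt0.
rewrite expiX; apply: expi_neq1; rewrite mulrAC; apply/andP; split.
  by rewrite divr_gt0// mulr_gt0// ltr0n.
by rewrite ltr_pdivrMr// ltr_pM2l ?ltr_nat.
Qed.

Lemma nc_root1X L m : nc (root1 L ^+ m) = 1.
Proof. by rewrite ncX nc_expi expr1n. Qed.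

Lemma root1X_neq0 L m : root1 L ^+ m != 0.
Proof. by rewrite -nc_eq0 nc_root1X oner_eq0. Qed.

Lemma sum_expr_root (F : fieldType) (x : F) L :
  x ^+ L = 1 -> x != 1 -> \sum_(j < L) x ^+ j = 0.
Proof.
move=> xL x1; apply/eqP; rewrite -(mulrI_eq0 _ (mulfI (_ : x - 1 != 0))) ?subr_eq0//.
by rewrite -subrX1 xL subrr.
Qed.

Lemma sum_root1_conj L m : (0 < m < L)%N ->
  \sum_(j < L) ((root1 L ^+ m)^-1) ^+ j = 0.
Proof.
move=> mL; have L0 : (0 < L)%N by case/andP: mL; exact: ltn_trans.
rewrite sum_expr_root ?invr_eq1 ?root1_neq1//.
by rewrite exprVn -exprM mulnC exprM root1_exp// expr1n invr1.
Qed.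

(** Orthogonality of the characters of the cyclic group of order L. *)
Lemma sum_root1_quot L m n : (m < L)%N -> (n < L)%N ->
  \sum_(j < L) (root1 L ^+ m / root1 L ^+ n) ^+ j = if m == n then L%:R else 0.
Proof.
move=> mL nL; have L0 : (0 < L)%N by exact: leq_ltn_trans mL.
case: eqP => [->|/eqP mn].
  rewrite divff ?root1X_neq0//; under eq_bigr do rewrite expr1n.
  by rewrite sumr_const card_ord.
rewrite sum_expr_root//.
  by rewrite exprMn exprVn -!exprM ![(_ * L)%N]mulnC !exprM root1_exp// !expr1n invr1 mulr1.
case: (ltngtP m n) mn => // [mn _|nm _].
  rewrite -(subnKC (ltnW mn)) exprD invfM mulrA divff ?root1X_neq0// mul1r invr_eq1.
  by rewrite root1_neq1// subn_gt0 mn (leq_ltn_trans (leq_subr _ _)).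
rewrite -(subnKC (ltnW nm)) exprD mulrAC divff ?root1X_neq0// mul1r.
by rewrite root1_neq1// subn_gt0 nm (leq_ltn_trans (leq_subr _ _)).
Qed.

Lemma conjc_root1 L m : (root1 L ^+ m)^*%C = (root1 L ^+ m)^-1.
Proof.
apply: (mulfI (root1X_neq0 L m)); rewrite divff ?root1X_neq0//.
have := nc_root1X L m; case: (_ ^+ _) => a b /(congr1 (fun x => x ^+ 2)).
rewrite sqr_nc expr1n /= => ab; apply/eqP; rewrite eq_complex /=.
by apply/andP; split; apply/eqP; [rewrite -ab|]; ring.
Qed.

Lemma two_Re z : (2 * complex.Re z)%:C = z + z^*%C.
Proof.
by case: z => a b; apply/eqP; rewrite eq_complex /= subrr eqxx andbT mulr2n mulrDl !mul1r.
Qed.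

(** A discrete Cauchy formula that uses the real part only. In 2 Re f = f + conj f the first term
    yields the coefficient by orthogonality. The second has the frequencies -(m + n), and 0 < m + n
    < L by n > 0 and L >= 2K, so its sums vanish. *)
Lemma coef_extract K (a : nat -> R[i]) n r L :
  (0 < n < K)%N -> (K.*2 <= L)%N ->
  \sum_(j < L) (root1 L ^+ n) ^- j *
     (2 * complex.Re (\sum_(m < K) a m * (r%:C * root1 L ^+ j) ^+ m))%:C =
  L%:R * (a n * r%:C ^+ n).
Proof.
move=> /andP[n0 nK] KL; have KL' : (K <= L)%N by rewrite (leq_trans _ KL)// -addnn leq_addl.
have nL := leq_trans nK KL'.
transitivity (\sum_(m < K) a m * r%:C ^+ m *
    \sum_(j < L) (root1 L ^+ m / root1 L ^+ n) ^+ j +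
  \sum_(m < K) (a m)^*%C * r%:C ^+ m * \sum_(j < L) ((root1 L ^+ (m + n))^-1) ^+ j).
  under eq_bigr do rewrite two_Re mulrDr.
  rewrite big_split /=; congr (_ + _).
    under eq_bigr do rewrite mulr_sumr.
    rewrite exchange_big /=; apply: eq_bigr => m _; rewrite mulr_sumr.
    apply: eq_bigr => j _.
    by rewrite !exprMn exprVn -!exprM [(m * j)%N]mulnC; ring.
  under eq_bigr do rewrite rmorph_sum mulr_sumr.
  rewrite exchange_big /=; apply: eq_bigr => m _; rewrite mulr_sumr.
  apply: eq_bigr => j _.
  have -> : (a m * (r%:C * root1 L ^+ j) ^+ m)^*%C =
      (a m)^*%C * (r%:C * (root1 L ^+ j)^-1) ^+ m.
    rewrite rmorphM rmorphXn rmorphM; congr (_ * (_ * _) ^+ _).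
      exact: conjc_real.
    exact: conjc_root1.
  rewrite exprD invfM !exprMn !exprVn.
  by rewrite -!exprM [(m * j)%N]mulnC; ring.
rewrite [X in _ + X]big1 ?addr0; last first.
  move=> m _; rewrite sum_root1_conj ?mulr0// addn_gt0 n0 orbT/=.
  by rewrite (leq_trans _ KL)// -addnn -addnS leq_add// ltnW.
rewrite (bigD1 (Ordinal nK))//= [X in _ + X]big1 ?addr0.
  by rewrite sum_root1_quot// eqxx mulrC.
move=> m mn; rewrite sum_root1_quot//; last by rewrite (leq_trans _ KL').
by rewrite ifN ?mulr0//; apply: contra mn => /eqP mn; apply/eqP/val_inj.
Qed.

Lemma coef_bound K (a : nat -> R[i]) n r B : 0 <= r -> (0 < n < K)%N ->
  (forall z, nc z = r -> `|complex.Re (\sum_(m < K) a m * z ^+ m)| <= B) ->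
  nc (a n) * r ^+ n <= 2 * B.
Proof.
move=> r0 nK aB; have := coef_extract a r nK (leqnn K.*2).
set L := K.*2 => /(congr1 (@nc R)) E.
have L0 : 0 < L%:R :> R.
  rewrite ltr0n double_gt0; case/andP: nK => n0 nK; exact: ltn_trans nK.
rewrite -(ler_pM2l L0).
have -> : L%:R * (nc (a n) * r ^+ n) = nc (L%:R * (a n * r%:C ^+ n)).
  by rewrite !ncM ncX nc_real ger0_norm// nc_nat.
rewrite -E (le_trans (nc_sum _ _ _))//.
apply: (@le_trans _ _ (\sum_(j < L) 2 * B)); last first.
  by rewrite sumr_const card_ord -[leLHS]mulr_natl.
apply: ler_sum => j _.
rewrite ncM ncV -exprM nc_root1X invr1 mul1r nc_real normrM ger0_norm// ler_wpM2l//.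
by apply: aB; rewrite ncM nc_real nc_root1X mulr1 ger0_norm.
Qed.

End CircleAverages.

(** * The logarithm of the modulus of a polynomial without zeros in a disc *)

Section LogPoly.
Variable R : realType.
Implicit Types (z w v : R[i]) (t x r : R).

Lemma ln_prod (I : Type) (s : seq I) (p : pred I) (F : I -> R) :
  (forall i, p i -> 0 < F i) ->
  ln (\prod_(i <- s | p i) F i) = \sum_(i <- s | p i) ln (F i).
Proof.
move=> F0; suff [] : 0 < \prod_(i <- s | p i) F i /\
  ln (\prod_(i <- s | p i) F i) = \sum_(i <- s | p i) ln (F i) by [].
elim/big_rec2: _ => [|i y1 y2 pi [y0 IH]]; first by rewrite ltr01 ln1.
by rewrite mulr_gt0 ?F0// lnM ?posrE ?F0// IH.
Qed.

(* The Taylor coefficients of the logarithm are averages of its real part over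
   roots of unity on the circle |z| = r, hence are at most [2 * B / r ^+ m]. *)
Lemma log_poly_approx (s : seq R[i]) r B D : 0 < r ->
  (forall zeta, zeta \in s -> nc zeta * r < 1) ->
  (forall z, nc z = r -> `|ln (nc (\prod_(zeta <- s) (1 - zeta * z)))| <= B) ->
  exists a : nat -> R[i], forall z, nc z <= r / 2 ->
    `|ln (nc (\prod_(zeta <- s) (1 - zeta * z))) -
      complex.Re (\sum_(m < D.+1) a m * z ^+ m)| <= 4 * B * (nc z / r) ^+ D.+1.
Proof.
move=> r0 sr uB.
have r0' : 0 <= r by exact: ltW.
have B0 : 0 <= B.
  have rr : nc r%:C = r by rewrite nc_real ger0_norm.
  exact: le_trans (normr_ge0 _) (uB _ rr).
pose u z := ln (nc (\prod_(zeta <- s) (1 - zeta * z))).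
(* Power sums, the Taylor coefficients of the sum of the log(1 - zeta z). For m = 0 the division by
   0 returns 0, in accordance with log 1 = 0. *)
pose a m : R[i] := \sum_(zeta <- s) - (zeta ^+ m / m%:R).
(* This error depends on the zeros, but it is used only in the limit of large [K]; the final bound
   involves [B] alone. *)
pose err K : R := \sum_(zeta <- s) (nc zeta * r) ^+ K.+1 / (1 - nc zeta * r).
have errP z K : nc z <= r ->
    `|u z - complex.Re (\sum_(m < K.+1) a m * z ^+ m)| <= err K.
  move=> zr; have zs zeta : zeta \in s -> nc (zeta * z) <= nc zeta * r.
    by move=> _; rewrite ncM ler_wpM2l ?nc_ge0.
  have -> : u z = \sum_(zeta <- s) ln (nc (1 - zeta * z)).
    rewrite /u nc_prod big_seq_cond [RHS]big_seq_cond ln_prod// => zeta.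
    rewrite andbT => zetas; rewrite nc_gt0 subr_eq0; apply/eqP => e.
    have := le_lt_trans (zs _ zetas) (sr _ zetas).
    by rewrite -e nc1 ltxx.
  have -> : \sum_(m < K.+1) a m * z ^+ m =
      \sum_(zeta <- s) - \sum_(m < K.+1) (zeta * z) ^+ m / m%:R.
    under eq_bigr do rewrite mulr_suml.
    rewrite exchange_big /=; apply: eq_bigr => zeta _.
    by rewrite -sumrN; apply: eq_bigr => m _; rewrite exprMn; ring.
  rewrite cRe_sum -sumrB (le_trans (ler_norm_sum _ _ _))//.
  rewrite big_seq [leRHS]big_seq; apply: ler_sum => zeta zetas.
  rewrite cReN opprK.
  have z1 := le_lt_trans (zs _ zetas) (sr _ zetas).
  rewrite (le_trans (ln_nc_1B_series _ z1))// ler_pM ?exprn_ge0 ?invr_ge0 ?nc_ge0//.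
  - by rewrite subr_ge0 ltW.
  - by rewrite lerXn2r ?nnegrE ?mulr_ge0 ?nc_ge0// zs.
  by rewrite lef_pV2 ?posrE ?subr_gt0// ?sr// lerD2l lerN2 zs.
have err0 : err K @[K --> \oo] --> 0.
  rewrite /err; elim: s sr {uB u a err errP} => [|y s IH] sr.
    by under eq_fun do rewrite big_nil; exact: cvg_cst.
  under eq_fun do rewrite big_cons.
  have sr' zeta : zeta \in s -> nc zeta * r < 1.
    by move=> zs; apply: sr; rewrite in_cons zs orbT.
  have c1 : ((nc y * r) ^+ K.+1 / (1 - nc y * r)) @[K --> \oo] --> 0 / (1 - nc y * r).
    apply: cvgM; last exact: cvg_cst.
    rewrite (cvg_shiftS (fun K => (nc y * r) ^+ K)).
    by apply: cvg_expr; rewrite ger0_norm ?mulr_ge0 ?nc_ge0// sr// in_cons eqxx.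
  by have := cvgD c1 (IH sr'); rewrite mul0r addr0; apply.
have aB n : nc (a n) * r ^+ n <= 2 * B.
  have [->|n0] := posnP n.
    rewrite /a big1 ?nc0 ?mul0r ?mulr_ge0// => zeta _.
    by rewrite invr0 mulr0 oppr0.
  have c2 : 2 * (B + err K) @[K --> \oo] --> 2 * (B + 0).
    by apply: cvgM; [exact: cvg_cst|apply: cvgD => //; exact: cvg_cst].
  rewrite -[B in leRHS]addr0.
  apply: (ler_cvg_seq (N := n) (cvg_cst _) c2) => K nK.
  apply: (@coef_bound _ K.+1) => //; first by rewrite n0.
  move=> z zr; rewrite -[X in `|X|](subrK (u z)) addrC (le_trans (ler_normD _ _))//.
  by rewrite lerD ?uB// distrC errP// zr.
exists a => z zr.
have zr' : nc z <= r by rewrite (le_trans zr)// ler_pdivrMr// ler_peMr// ler1n.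
set x := nc z / r; have x0 : 0 <= x by rewrite divr_ge0 ?nc_ge0.
have x2 : x <= 2^-1 by rewrite ler_pdivrMr// mulrC.
have c2 : (err K + 4 * B * x ^+ D.+1) @[K --> \oo] --> (0 + 4 * B * x ^+ D.+1).
  by apply: cvgD => //; exact: cvg_cst.
rewrite -[leRHS]add0r.
apply: (ler_cvg_seq (N := D) (cvg_cst _) c2) => K DK.
rewrite -/(u z).
(* The approximation of order K is cut down to order D. The discarded terms are dominated by a
   geometric series of ratio 1/2, hence the factor 4 = 2 * 2 in the bound. *)
have -> : \sum_(m < D.+1) a m * z ^+ m = \sum_(m < K.+1) a m * z ^+ m -
    \sum_(m < K - D) a (D.+1 + m)%N * z ^+ (D.+1 + m).
  have KE : K.+1 = (D.+1 + (K - D))%N by rewrite addSn subnKC.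
  by rewrite KE big_split_ord /= addrK.
rewrite cReD cReN opprD opprK addrA (le_trans (ler_normD _ _))// lerD ?errP//.
rewrite (le_trans (normr_Re_le _))// (le_trans (nc_sum _ _ _))//.
apply: (@le_trans _ _ (\sum_(m < K - D) 2 * B * x ^+ D.+1 * 2^-1 ^+ m)).
  apply: ler_sum => m _; rewrite ncM ncX.
  have -> : nc z = r * x by rewrite mulrC divfK// gt_eqF.
  rewrite exprMn mulrA -[leRHS]mulrA ler_pM ?mulr_ge0 ?exprn_ge0 ?nc_ge0 ?aB//.
  by rewrite exprD ler_wpM2l ?exprn_ge0// lerXn2r// nnegrE.
rewrite -mulr_sumr.
have -> : 4 * B * x ^+ D.+1 = 2 * B * x ^+ D.+1 * 2 by ring.
rewrite ler_wpM2l ?mulr_ge0 ?exprn_ge0//.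
have := @subrX1 R 2^-1 (K - D); set S := \sum_(i < _) _ => E.
have : 0 <= 2^-1 ^+ (K - D) :> R by rewrite exprn_ge0.
by lra.
Qed.

End LogPoly.

(** * Hadamard's theorem for a zero-free entire function of finite order *)

Section EntireLog.
Variable R : realType.
Implicit Types (z w v : R[i]) (t x y r : R).

(** [R[i]] is algebraically closed; zeta runs over the inverses of the roots, all of which lie
    outside the disc, and p(0) = 1 fixes the leading factor. *)
Lemma root_free_factor (p : {poly R[i]}) r : p.[0] = 1 -> 0 <= r ->
  (forall z, nc z <= r -> p.[z] != 0) ->
  exists2 s : seq R[i], (forall zeta, zeta \in s -> nc zeta * r < 1) &
    forall z, p.[z] = \prod_(zeta <- s) (1 - zeta * z).
Proof.
move=> p0 r0 pr; have [rs pE] := closed_field_poly_normal p.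
have hE z : p.[z] = lead_coef p * \prod_(w <- rs) (z - w).
  rewrite {1}pE hornerZ horner_prod; congr (_ * _).
  by apply: eq_bigr => w _; rewrite !hornerE.
have rsP w : w \in rs -> r < nc w.
  move=> wrs; rewrite ltNge; apply/negP => /pr /negP; apply.
  by rewrite hE (big_rem _ wrs) /= subrr mul0r mulr0.
exists [seq w^-1 | w <- rs].
  move=> _ /mapP[w /rsP wr ->]; rewrite ncV ltr_pdivrMl ?mulr1//.
  exact: le_lt_trans wr.
move=> z; rewrite big_map hE.
have -> : \prod_(w <- rs) (z - w) = \prod_(w <- rs) (0 - w) * \prod_(w <- rs) (1 - w^-1 * z).
  rewrite -big_split /= big_seq [RHS]big_seq; apply: eq_bigr => w /rsP wr.
  have w0 : w != 0 by rewrite -nc_gt0 (le_lt_trans _ wr).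
  by field.
by rewrite mulrA -hE p0 mul1r.
Qed.

(** A relative error d becomes an absolute error of the logarithm by ln a - ln b <= (a - b) / b,
    applied in both directions; d <= 1/2 gives x >= y / 2, whence the factor 2. *)
Lemma ln_dist_le x y d : 0 < y -> 0 <= d <= 2^-1 -> `|x - y| <= d * y ->
  `|ln x - ln y| <= 2 * d.
Proof.
move=> y0 /andP[d0 d1]; rewrite ler_norml => /andP[xy1 xy2].
have dy : d * y <= 2^-1 * y by rewrite ler_wpM2r// ltW.
have x0 : 0 < x by lra.
have lnB (a b : R) : 0 < a -> 0 < b -> ln a - ln b <= (a - b) / b.
  move=> a0 b0; rewrite -ln_div ?posrE//.
  have -> : a / b = 1 + (a - b) / b by rewrite mulrBl divff ?gt_eqF// addrC subrK.
  apply: le_ln1Dx; rewrite mulrBl divff ?gt_eqF//.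
  have ab : 0 < a / b by rewrite divr_gt0.
  by lra.
rewrite ler_norml; apply/andP; split.
  rewrite -lerN2 opprK opprB (le_trans (lnB _ _ y0 x0))// ler_pdivrMr//.
  have : 2 * d * (y - d * y) <= 2 * d * x by rewrite ler_wpM2l ?mulr_ge0//; lra.
  have : d * (d * y) <= d * (2^-1 * y) by rewrite ler_wpM2l.
  by lra.
by rewrite (le_trans (lnB _ _ x0 y0))// ler_pdivrMr//; have := mulr_ge0 d0 (ltW y0); lra.
Qed.

(** [M] is an entire function with Taylor coefficients [m], and [tau N r] bounds the N-th remainder
    uniformly on the disc of radius r. No differentiability is used. *)
Variables (M : R[i] -> R[i]) (m : nat -> R[i]) (tau : nat -> R -> R).
Variables (C : R) (D : nat).
Hypotheses (m0 : m 0%N = 1) (C0 : 0 <= C).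
Hypothesis Mm : forall N z r, nc z <= r ->
  nc (M z - \sum_(k < N) m k * z ^+ k) <= tau N r.
Hypothesis tau0 : forall r, 0 <= r -> tau N r @[N --> \oo] --> 0.
Hypothesis Mge : forall z, expR (- (C * (1 + nc z) ^+ D)) <= nc (M z).
Hypothesis Mle : forall z, nc (M z) <= expR (C * (1 + nc z) ^+ D).

Let u z := ln (nc (M z)).

Let M_gt0 z : 0 < nc (M z).
Proof. exact: lt_le_trans (expR_gt0 _) (Mge z). Qed.

(** On the disc of radius r a Taylor polynomial of high order has relative error e/4, measured
    against the lower bound for |M|. It therefore has no zeros there, and its logarithm stays within
    e/2 of [u] and within the bound of [u] plus 1. *)
Lemma log_entire_approx r e : 1 <= r -> 0 < e <= 1 ->
  exists a : nat -> R[i], forall z, nc z <= r / 2 ->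
    `|u z - complex.Re (\sum_(k < D.+1) a k * z ^+ k)| <=
    2^-1 * e + 4 * (C * (1 + r) ^+ D + 1) * (nc z / r) ^+ D.+1.
Proof.
move=> r1 /andP[e0 e1]; have r0 : 0 < r by lra.
have r0' := ltW r0.
set b := C * (1 + r) ^+ D.
have bz z : nc z <= r -> C * (1 + nc z) ^+ D <= b.
  move=> zr; rewrite ler_wpM2l// lerXn2r ?nnegrE ?addr_ge0 ?nc_ge0//.
  by rewrite lerD2l.
have [N _ tauN] : \forall N \near \oo, tau N r < 4^-1 * e * expR (- b).
  apply: cvgr_lt; first exact: tau0 r0'.
  by rewrite mulr_gt0 ?expR_gt0// mulr_gt0// invr_gt0.
(* The order is made positive, so that the polynomial contains the constant coefficient [m 0]. *)
pose N' := N.+1; have {}tauN : tau N' r < 4^-1 * e * expR (- b).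
  by apply: tauN => /=; rewrite leqnSn.
pose p : {poly R[i]} := \poly_(k < N') m k.
have pE z : p.[z] = \sum_(k < N') m k * z ^+ k.
  rewrite (@horner_coef_wide _ N') ?size_poly//.
  by apply: eq_bigr => k _; rewrite coef_poly ltn_ord.
have p0 : p.[0] = 1 by rewrite horner_coef0 coef_poly.
have pM z : nc z <= r -> `|nc p.[z] - nc (M z)| <= 4^-1 * e * nc (M z).
  move=> zr; apply: (@le_trans _ _ (nc (M z - p.[z]))).
    rewrite ler_norml; apply/andP; split.
      have := ncD (M z - p.[z]) p.[z]; rewrite subrK; lra.
    have := ncD (p.[z] - M z) (M z); rewrite subrK nc_distC; lra.
  rewrite pE (le_trans (Mm N' zr))// (le_trans (ltW tauN))//.
  apply: ler_wpM2l; first by rewrite mulr_ge0 ?invr_ge0// ltW.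
  rewrite (le_trans _ (Mge z))//.
  by rewrite ler_expR lerN2 bz.
have ln_pM z : nc z <= r -> `|ln (nc p.[z]) - u z| <= 2^-1 * e.
  move=> zr; rewrite (le_trans (ln_dist_le (M_gt0 z) _ (pM z zr)))//; last lra.
  by apply/andP; split; lra.
have u_le z : nc z <= r -> `|u z| <= b.
  move=> /bz zb; rewrite ler_norml; apply/andP; split.
    rewrite -(expRK (- b)) ler_ln ?posrE ?expR_gt0// (le_trans _ (Mge z))//.
    by rewrite ler_expR lerN2.
  rewrite -(expRK b) ler_ln ?posrE ?expR_gt0// (le_trans (Mle z))//.
  by rewrite ler_expR.
have pr z : nc z <= r -> p.[z] != 0.
  move=> zr; apply/eqP => pz0; have := pM z zr.
  rewrite pz0 nc0 sub0r normrN ger0_norm ?nc_ge0//.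
  by have := M_gt0 z; nra.
have [s sr ps] := root_free_factor p0 r0' pr.
have [|a aP] := @log_poly_approx _ s r (b + 1) D r0 sr.
  move=> z zr; rewrite -ps -(subrK (u z) (ln _)) (le_trans (ler_normD _ _))//.
  rewrite addrC lerD ?u_le ?zr//.
  by rewrite (le_trans (ln_pM _ _)) ?zr//; lra.
exists a => z zr.
have zr' : nc z <= r by rewrite (le_trans zr)// ler_pdivrMr// ler_peMr// ler1n.
rewrite -[u z](subrK (ln (nc p.[z]))) -addrA (le_trans (ler_normD _ _))// lerD//.
  by rewrite distrC ln_pM.
by rewrite ps aP.
Qed.

(** The remainder has order D + 1 while the bound on the circle grows like r^D; for fixed rho the
    error is O(1/r). *)
Lemma log_entire_approx_ball rho e : 1 <= rho -> 0 < e <= 1 ->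
  exists a : nat -> R[i], forall z, nc z <= rho ->
    `|u z - complex.Re (\sum_(k < D.+1) a k * z ^+ k)| <= e.
Proof.
move=> rho1 e01; have /andP[e0 e1] := e01.
pose E := C * 2 ^+ D + 1.
have E1 : 1 <= E by rewrite lerDr mulr_ge0// exprn_ge0.
have E0 : 0 <= E by lra.
have rho0 : 0 <= rho by lra.
(* The first summand puts the ball inside the disc of radius r / 2; the second makes 4 E rho^{D+1} /
   r at most e / 2. *)
pose r := 2 * rho + 8 * E * rho ^+ D.+1 / e.
have h0 : 0 <= 8 * E * rho ^+ D.+1 / e.
  by rewrite divr_ge0 ?(ltW e0)// mulr_ge0 ?exprn_ge0 ?mulr_ge0.
have r1 : 1 <= r by rewrite /r; lra.
have r0 : 0 < r by lra.
have [a aP] := log_entire_approx r1 e01.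
exists a => z zrho; rewrite (le_trans (aP z _))//.
  by rewrite ler_pdivlMr// /r; lra.
have bE : C * (1 + r) ^+ D + 1 <= E * r ^+ D.
  rewrite mulrDl mul1r lerD//; last exact: exprn_ege1.
  rewrite -mulrA ler_wpM2l// -exprMn lerXn2r ?nnegrE; lra.
have : 4 * (C * (1 + r) ^+ D + 1) * (nc z / r) ^+ D.+1 <=
    4 * (E * r ^+ D) * (rho / r) ^+ D.+1.
  have b0 : 0 <= C * (1 + r) ^+ D + 1.
    by rewrite addr_ge0// mulr_ge0// exprn_ge0//; lra.
  have r0' := ltW r0.
  rewrite ler_pM ?mulr_ge0 ?exprn_ge0 ?divr_ge0 ?nc_ge0//.
    by rewrite ler_wpM2l.
  rewrite lerXn2r ?nnegrE ?divr_ge0 ?nc_ge0//.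
  by rewrite ler_pM2r ?invr_gt0.
have -> : 4 * (E * r ^+ D) * (rho / r) ^+ D.+1 = 4 * E * rho ^+ D.+1 / r.
  rewrite expr_div_n [r ^+ D.+1]exprSr; field.
  by rewrite expf_neq0 ?gt_eqF.
have : 4 * E * rho ^+ D.+1 / r <= 2^-1 * e.
  rewrite ler_pdivrMr//.
  have : e * (8 * E * rho ^+ D.+1 / e) <= e * r.
    by rewrite ler_wpM2l ?(ltW e0)// /r; lra.
  by rewrite mulrCA divff ?gt_eqF// mulr1; lra.
by lra.
Qed.

(** The approximating coefficients depend on the radius and on e. Candidates independent of both are
    read off from [u] on the unit circle by [coef_extract]; the approximating coefficients must be
    close to them, so they can be replaced and e can tend to 0. *)
Theorem log_entire_poly : exists a : nat -> R[i],
  forall z, u z = complex.Re (\sum_(k < D.+1) a k * z ^+ k).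
Proof.
pose L := D.+1.*2.
pose a' n : R[i] := if n == 0%N then (u 0)%:C else
  L%:R^-1 * \sum_(j < L) (root1 R L ^+ n) ^- j * (2 * u (root1 R L ^+ j))%:C.
have L0 : L%:R != 0 :> R[i] by rewrite pnatr_eq0.
exists a' => z.
pose rho := 1 + nc z; have rho1 : 1 <= rho by rewrite lerDl nc_ge0.
have zrho : nc z <= rho by rewrite lerDr.
(* Sum of the errors in units of e: 1 for the approximation at z, 1 for the constant term,
   2|z|^{k+1} for each further coefficient. *)
pose B := 2 + \sum_(k < D) 2 * nc z ^+ k.+1.
have B0 : 0 < B.
  by rewrite ltr_wpDr// sumr_ge0// => k _; rewrite mulr_ge0 ?exprn_ge0 ?nc_ge0.
suff H e : 0 < e <= 1 ->
    `|u z - complex.Re (\sum_(k < D.+1) a' k * z ^+ k)| <= e * B.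
  apply/eqP; rewrite -subr_eq0 -normr_le0; apply/ler_addgt0Pl => e e0.
  rewrite addr0; pose e' := Num.min 1 (e / B).
  have e'0 : 0 < e' <= 1.
    by rewrite lt_min ltr01 divr_gt0//= ge_min lexx.
  by rewrite (le_trans (H _ e'0))// -ler_pdivlMr// ge_min lexx orbT.
move=> e01; have [a aP] := log_entire_approx_ball rho1 e01.
have /andP[e0 e1] := e01.
(* Only the real part of the constant coefficient is determined by [u], and only it enters. *)
have a0 : `|complex.Re (a' 0%N - a 0%N)| <= e.
  have := aP 0; rewrite nc0 => /(_ (le_trans ler01 rho1)).
  rewrite big_ord_recl big1 ?addr0 ?expr0 ?mulr1 /=; first by rewrite cReD cReN.
  by move=> i _; rewrite exprS mul0r mulr0.
have an k : (k < D)%N -> nc (a' k.+1 - a k.+1) <= 2 * e.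
  move=> kD; have kD' : (0 < k.+1 < D.+1)%N by rewrite ltnS.
  have := coef_extract a 1 kD' (leqnn L); rewrite expr1n mulr1 => E.
  have -> : a' k.+1 - a k.+1 = L%:R^-1 * \sum_(j < L) (root1 R L ^+ k.+1) ^- j *
      (2 * (u (root1 R L ^+ j) -
        complex.Re (\sum_(k < D.+1) a k * (1%:C * root1 R L ^+ j) ^+ k)))%:C.
    rewrite -[a k.+1](mulKf L0) -E /a' /= -mulrBr -sumrB; congr (_ * _).
    by apply: eq_bigr => j _; rewrite mulrBr rmorphB mulrBr.
  rewrite ncM ncV nc_nat ler_pdivrMl ?ltr0n//.
  rewrite (le_trans (nc_sum _ _ _))//.
  apply: (@le_trans _ _ (\sum_(j < L) 2 * e)); last first.
    by rewrite sumr_const card_ord -[leLHS]mulr_natl.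
  apply: ler_sum => j _; rewrite ncM ncV -exprM nc_root1X invr1 mul1r nc_real.
  rewrite normrM ger0_norm// ler_wpM2l// rmorph1 mul1r aP//.
  by rewrite nc_root1X.
have -> : u z - complex.Re (\sum_(k < D.+1) a' k * z ^+ k) =
    (u z - complex.Re (\sum_(k < D.+1) a k * z ^+ k)) -
    complex.Re (\sum_(k < D.+1) (a' k - a k) * z ^+ k).
  have -> : \sum_(k < D.+1) (a' k - a k) * z ^+ k =
      \sum_(k < D.+1) a' k * z ^+ k - \sum_(k < D.+1) a k * z ^+ k.
    by rewrite -sumrB; apply: eq_bigr => k _; rewrite mulrBl.
  by rewrite cReD cReN; ring.
rewrite (le_trans (ler_normB _ _))//.
have -> : e * B = e + (e + \sum_(k < D) 2 * e * nc z ^+ k.+1).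
  rewrite /B mulrDr mulr_sumr addrA; congr (_ + _); first ring.
  by apply: eq_bigr => k _; ring.
rewrite lerD ?aP// big_ord_recl expr0 mulr1 cReD (le_trans (ler_normD _ _))// lerD//.
rewrite (le_trans (normr_Re_le _))// (le_trans (nc_sum _ _ _))//.
by apply: ler_sum => k _; rewrite ncM ncX ler_wpM2r ?exprn_ge0 ?nc_ge0// an.
Qed.

End EntireLog.

(** * Marcinkiewicz's theorem on the degree *)

Section Marcinkiewicz.
Variable R : realType.
Implicit Types (z w v : R[i]) (t x y r : R).

(** A negative coefficient at n would be the leading one and would decide the sign at infinity. *)
Lemma nonneg_poly_coef_ge0 (q : {poly R}) n : (size q <= n.+1)%N ->
  (forall r, 0 <= r -> 0 <= q.[r]) -> 0 <= q`_n.
Proof.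
move=> qn q0; rewrite leNgt; apply/negP => qn0.
have sq : size q = n.+1.
  apply/eqP; rewrite eqn_leq qn ltnNge; apply/negP => /(nth_default 0) e.
  by rewrite e ltxx in qn0.
have lq : 0 < lead_coef (- q) by rewrite lead_coefN lead_coefE sq oppr_gt0.
have [x xP] := polyrcf.poly_pinfty_gt_lc lq.
have := xP (Num.max x 0); rewrite le_max lexx => /(_ isT).
rewrite hornerN => h; have := q0 (Num.max x 0); rewrite le_max lexx orbT => /(_ isT).
by lra.
Qed.

Lemma normr_cos_lt1 x : 0 < x < pi -> `|cos x| < 1.
Proof.
move=> /sin_gt0_pi s0; rewrite -(@ltr_pXn2r _ 2) ?nnegrE// real_normK ?num_real//.
by rewrite expr1n cos2sin2 ltrBlDr ltrDl exprn_gt0.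
Qed.

Lemma expi_pi : expi (pi : R) = -1.
Proof.
by rewrite /expi cospi sinpi; apply/eqP; rewrite eq_complex /= oppr0 !eqxx.
Qed.

Variables (u : R[i] -> R) (a : nat -> R[i]) (D : nat).
Hypothesis uE : forall z, u z = complex.Re (\sum_(k < D) a k * z ^+ k).
Hypothesis u0 : u 0 = 0.
Hypothesis u_Re : forall z, u z <= u (complex.Re z)%:C.

Let g : {poly R} := \poly_(k < D) complex.Re (a k).

Let u_real t : u t%:C = g.[t].
Proof.
rewrite uE (@horner_coef_wide _ D) ?size_poly// cRe_sum.
apply: eq_bigr => k _.
by rewrite coef_poly ltn_ord -rmorphXn [X in complex.Re X]mulrC cRe_mull mulrC.
Qed.

(* The maximum of [u] over a vertical line is attained on the real axis; this
   is averaged over conjugate points. *)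
Let radial_ge0 v r n : nc v = 1 -> 0 <= r -> (size g <= n)%N ->
  0 <= (\poly_(k < n) (g`_k * (complex.Re v ^+ k - complex.Re (v ^+ k)))).[r].
Proof.
move=> v1 r0 gn.
have : u (r%:C * v) + u (r%:C * v^*%C) <= 2 * u (r * complex.Re v)%:C.
  have h1 := u_Re (r%:C * v); have h2 := u_Re (r%:C * v^*%C).
  have e : complex.Re (v^*%C) = complex.Re v by case: (v).
  by rewrite !cRe_mull e in h1 h2; lra.
have -> : u (r%:C * v) + u (r%:C * v^*%C) =
    2 * \sum_(k < n) g`_k * complex.Re (v ^+ k) * r ^+ k.
  have -> : \sum_(k < n) g`_k * complex.Re (v ^+ k) * r ^+ k =
      \sum_(k < D) g`_k * complex.Re (v ^+ k) * r ^+ k.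
    pose F k := g`_k * complex.Re (v ^+ k) * r ^+ k.
    rewrite -(big_mkord xpredT F) -[RHS](big_mkord xpredT F).
    have gS m : (size g <= m)%N -> \sum_(0 <= k < m) F k = \sum_(0 <= k < size g) F k.
      move=> gm; rewrite (big_cat_nat _ gm)//= [X in _ + X]big_nat_cond.
      rewrite [X in _ + X]big1 ?addr0// => k /andP[/andP[gk _] _].
      by rewrite /F nth_default// !mul0r.
    by rewrite !gS// size_poly.
  rewrite !uE -cReD -big_split /= cRe_sum mulr_sumr; apply: eq_bigr => k _.
  rewrite coef_poly ltn_ord -mulrDr !exprMn -mulrDr.
  have -> : v ^+ k + v^*%C ^+ k = (2 * complex.Re (v ^+ k))%:C.
    by rewrite two_Re rmorphXn.
  rewrite -rmorphXn -rmorphM mulrC cRe_mull; ring.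
rewrite ler_pM2l// u_real (@horner_coef_wide _ n)// -subr_ge0 -sumrB.
rewrite (@horner_coef_wide _ n) ?size_poly//.
congr (0 <= _); apply: eq_bigr => k _; rewrite coef_poly ltn_ord exprMn; ring.
Qed.

(** If the degree n were at least 3, the top coefficient of the radial polynomial would give g_n
    (cos^n x - cos(nx)) >= 0 for all x. At x = pi/n this excludes g_n < 0, at x = 2 pi/n it excludes
    g_n > 0: there cos(nx) is -1 and 1, whereas |cos^n x| < 1. The second point needs 2 pi/n < pi,
    that is n >= 3. *)
Let size_g : (size g <= 3)%N.
Proof.
rewrite leqNgt; apply/negP => g3.
pose n := (size g).-1; have gn : size g = n.+1 by rewrite prednK// (ltn_trans _ g3).
have n3 : (2 < n)%N by rewrite -ltnS -gn.
have n0 : 0 < n%:R :> R by rewrite ltr0n (ltn_trans _ n3).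
have pi0 : 0 < pi :> R := pi_gt0 R.
have coef_ge0 x : 0 <= g`_n * (cos x ^+ n - complex.Re (expi x ^+ n)).
  have gn' : (size g <= n.+1)%N by rewrite gn.
  pose q := \poly_(k < n.+1)
    (g`_k * (complex.Re (expi x) ^+ k - complex.Re (expi x ^+ k))).
  have : 0 <= q`_n.
    apply: nonneg_poly_coef_ge0; first exact: size_poly.
    by move=> r r0; apply: radial_ge0 => //; exact: nc_expi.
  by rewrite coef_poly ltnSn.
have cosX_lt1 x : 0 < x < pi -> `|cos x ^+ n| < 1.
  move=> /normr_cos_lt1 c1; rewrite normrX exprn_ilt1//.
  by rewrite -lt0n (ltn_trans _ n3).
have : g`_n != 0.
  by have := lead_coef_eq0 g; rewrite lead_coefE gn /= => ->; rewrite -size_poly_eq0 gn.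
case: ltgtP => // gn0 _.
- have := coef_ge0 (pi / n%:R).
  rewrite expiX divfK ?gt_eqF// expi_pi nmulr_rge0// => h.
  have : `|cos (pi / n%:R : R) ^+ n| < 1.
    apply: cosX_lt1; rewrite divr_gt0//= ltr_pdivrMr// ltr_pMr// ltr1n.
    exact: ltn_trans n3.
  by rewrite ltr_norml => /andP[h1 _]; move: h; rewrite /=; lra.
- have := coef_ge0 (pi *+ 2 / n%:R).
  rewrite expiX divfK ?gt_eqF// expi_pi2 pmulr_rge0// => h.
  have : `|cos (pi *+ 2 / n%:R : R) ^+ n| < 1.
    have p2 : 0 < pi *+ 2 :> R by rewrite mulrn_wgt0.
    apply: cosX_lt1; rewrite divr_gt0//= ltr_pdivrMr//.
    by rewrite -[ltLHS]mulr_natr ltr_pM2l// ltr_nat.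
  by rewrite ltr_norml => /andP[_ h1]; move: h; rewrite /=; lra.
Qed.

Lemma radial_max_quadratic : exists g1 g2 : R, 0 <= g2 /\
  forall t, u t%:C = g1 * t + g2 * t ^+ 2.
Proof.
have g0 : g`_0 = 0 by rewrite -horner_coef0 -u_real.
have gE t : u t%:C = g`_1 * t + g`_2 * t ^+ 2.
  rewrite u_real (@horner_coef_wide _ 3)// !big_ord_recl big_ord0 /= g0; ring.
exists g`_1, g`_2; split => //.
(* At v = i the radial polynomial reduces to g_2 r^2, which gives the sign of g_2. *)
have i1 : nc ('i : R[i]) = 1 by rewrite ncE /= expr0n expr1n add0r sqrtr1.
have := radial_ge0 i1 ler01 size_g.
rewrite (@horner_coef_wide _ 3) ?size_poly// !big_ord_recl big_ord0 !coef_poly /=.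
rewrite /bump /= !addn0 -[(1 + 1)%N]/2%N !expr1n !expr0n /=; lra.
Qed.

End Marcinkiewicz.

(** * Moment generating functions *)

Section ComplexIntegral.
Context d (T : measurableType d) (R : realType) (mu : probability T R).
Implicit Types (f g : T -> R) (F G : T -> R[i]).

Definition cmeasurable F :=
  measurable_fun setT (fun x => complex.Re (F x)) /\
  measurable_fun setT (fun x => complex.Im (F x)).

Lemma le_integrable_real f g : measurable_fun setT f ->
  (forall x, `|f x| <= g x) -> mu.-integrable setT (EFin \o g) ->
  mu.-integrable setT (EFin \o f).
Proof.
move=> mf fg; apply: le_integrable => //; first exact/measurable_EFinP.
by move=> x _; rewrite !abse_EFin lee_fin (le_trans (fg x))// ler_norm.
Qed.

Lemma integrable_Re F g : cmeasurable F -> (forall x, nc (F x) <= g x) ->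
  mu.-integrable setT (EFin \o g) ->
  mu.-integrable setT (EFin \o (fun x => complex.Re (F x))).
Proof.
move=> [mF _] Fg; apply: le_integrable_real => // x.
exact: le_trans (normr_Re_le _) (Fg x).
Qed.

Lemma integrable_Im F g : cmeasurable F -> (forall x, nc (F x) <= g x) ->
  mu.-integrable setT (EFin \o g) ->
  mu.-integrable setT (EFin \o (fun x => complex.Im (F x))).
Proof.
move=> [_ mF] Fg; apply: le_integrable_real => // x.
exact: le_trans (normr_Im_le _) (Fg x).
Qed.

Lemma Rintegral_linear (a b : R) f g :
  mu.-integrable setT (EFin \o f) -> mu.-integrable setT (EFin \o g) ->
  \int[mu]_x (a * f x + b * g x) = a * (\int[mu]_x f x) + b * (\int[mu]_x g x).
Proof.
move=> fi gi; rewrite RintegralD ?RintegralZl//.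
- exact: (@integrableZl _ _ _ mu _ measurableT a _ fi).
- exact: (@integrableZl _ _ _ mu _ measurableT b _ gi).
Qed.

(* Rotate the value of the integral onto the positive half-line. *)
Lemma nc_integralC_le F g : cmeasurable F -> (forall x, nc (F x) <= g x) ->
  mu.-integrable setT (EFin \o g) -> nc (integralC mu F) <= \int[mu]_x g x.
Proof.
move=> mF Fg gi; set I := integralC mu F.
have iRe := integrable_Re mF Fg gi; have iIm := integrable_Im mF Fg gi.
have [I0|I0] := eqVneq I 0.
  rewrite I0 nc0; apply: Rintegral_ge0 => x _.
  exact: le_trans (nc_ge0 _) (Fg x).
have n0 : 0 < nc I by rewrite nc_gt0.
pose w := I^*%C / (nc I)%:C.
have ncJ : nc (I^*%C) = nc I by rewrite !ncE; case: (I) => a b /=; rewrite sqrrN.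
have w1 : nc w = 1.
  by rewrite ncM ncV nc_real ger0_norm ?ltW// ncJ divff// gt_eqF.
have -> : nc I = complex.Re (w * I).
  have -> : w * I = (nc I)%:C.
    rewrite /w mulrAC; apply: (canLR (mulfK _)).
      by rewrite -nc_eq0 nc_real normr_eq0 gt_eqF.
    rewrite -rmorphM -expr2 sqr_nc; case: (I) => a b /=.
    by apply/eqP; rewrite eq_complex /=; apply/andP; split; apply/eqP; ring.
  by [].
have -> : complex.Re (w * I) =
    \int[mu]_x (complex.Re w * complex.Re (F x) + - complex.Im w * complex.Im (F x)).
  by rewrite Rintegral_linear// cReM mulNr.
apply: le_Rintegral => //.
  apply: (@le_integrable_real _ g) => //.
    case: mF => mR mI; apply: measurable_funD; apply: measurable_funM => //.
  move=> x; rewrite mulNr -cReM (le_trans (normr_Re_le _))// ncM w1 mul1r.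
  exact: Fg.
move=> x _; rewrite mulNr -cReM (le_trans (ler_norm _))//.
by rewrite (le_trans (normr_Re_le _))// ncM w1 mul1r Fg.
Qed.

Lemma integralCB F G (f g : T -> R) :
  cmeasurable F -> (forall x, nc (F x) <= f x) -> mu.-integrable setT (EFin \o f) ->
  cmeasurable G -> (forall x, nc (G x) <= g x) -> mu.-integrable setT (EFin \o g) ->
  integralC mu (fun x => F x - G x) = integralC mu F - integralC mu G.
Proof.
move=> mF Ff fi mG Gg gi; rewrite /integralC; apply/eqP; rewrite eq_complex /=.
apply/andP; split; apply/eqP; rewrite -RintegralB//.
- by apply: eq_Rintegral => x _; rewrite cReD cReN.
- exact: integrable_Re Ff fi.
- exact: integrable_Re Gg gi.
- by apply: eq_Rintegral => x _; rewrite cImD cImN.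
- exact: integrable_Im Ff fi.
- exact: integrable_Im Gg gi.
Qed.

Lemma integrable_sum_real N (a : nat -> R) (f : nat -> T -> R) :
  (forall k, (k < N)%N -> mu.-integrable setT (EFin \o f k)) ->
  mu.-integrable setT (EFin \o (fun x => \sum_(k < N) a k * f k x)).
Proof.
move=> fi; have : mu.-integrable setT
    (fun x => \sum_(k < N) ((a k)%:E * (f k x)%:E))%E.
  apply: integrable_sum => // k _.
  exact: (@integrableZl _ _ _ mu _ measurableT (a k) _ (fi k (ltn_ord k))).
apply: eq_integrable => // x _ /=; rewrite -sumEFin.
by apply: eq_bigr => k _; rewrite EFinM.
Qed.

Lemma Rintegral_sum N (a : nat -> R) (f : nat -> T -> R) :
  (forall k, (k < N)%N -> mu.-integrable setT (EFin \o f k)) ->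
  \int[mu]_x (\sum_(k < N) a k * f k x) = \sum_(k < N) a k * \int[mu]_x f k x.
Proof.
elim: N => [|N IH] fi.
  under eq_Rintegral do rewrite big_ord0.
  by rewrite Rintegral_cst// mul0r big_ord0.
under eq_Rintegral do rewrite big_ord_recr/=.
have fi' k : (k < N)%N -> mu.-integrable setT (EFin \o f k).
  by move=> kN; apply: fi; exact: ltnW.
have fN := fi N (leqnn N.+1).
rewrite RintegralD ?big_ord_recr ?(IH fi') ?RintegralZl//=.
- exact: integrable_sum_real.
- exact: (@integrableZl _ _ _ mu _ measurableT (a N) _ fN).
Qed.

Lemma integralC_sum N (w : nat -> R[i]) (f : nat -> T -> R) :
  (forall k, mu.-integrable setT (EFin \o f k)) ->
  integralC mu (fun x => \sum_(k < N) w k * (f k x)%:C) =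
  \sum_(k < N) w k * (\int[mu]_x f k x)%:C.
Proof.
move=> fi; apply/eqP; rewrite eq_complex /= cRe_sum cIm_sum.
apply/andP; split; apply/eqP.
  transitivity (\int[mu]_x \sum_(k < N) complex.Re (w k) * f k x).
    apply: eq_Rintegral => x _; rewrite cRe_sum; apply: eq_bigr => k _.
    by rewrite mulrC cRe_mull mulrC.
  rewrite (Rintegral_sum (fun k => complex.Re (w k)) (fun k _ => fi k)); apply: eq_bigr => k _.
  by rewrite [X in _ = complex.Re X]mulrC cRe_mull mulrC.
transitivity (\int[mu]_x \sum_(k < N) complex.Im (w k) * f k x).
  apply: eq_Rintegral => x _; rewrite cIm_sum; apply: eq_bigr => k _.
  by rewrite mulrC cIm_mull mulrC.
rewrite (Rintegral_sum (fun k => complex.Im (w k)) (fun k _ => fi k)); apply: eq_bigr => k _.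
by rewrite [X in _ = complex.Im X]mulrC cIm_mull mulrC.
Qed.

End ComplexIntegral.

(** * Moment generating functions on the real line and in the complex plane *)

Section MomentGeneratingFunction.
Variable R : realType.
Implicit Types (nu : probability R R) (z w : R[i]) (t x r s : R).

(** Extended real values, so that products and bounds can be handled before finiteness is known. *)
Definition mgf nu t : \bar R := (\int[nu]_x (expR (t * x))%:E)%E.

Definition cmgf nu z : R[i] := integralC nu (fun x => cexp (z * x%:C)).

Definition has_mgf nu := forall t, (mgf nu t < +oo)%E.

Definition mcoef nu k : R := (\int[nu]_x x ^+ k) / k`!%:R.

Lemma measurable_expM t : measurable_fun setT (fun x : R => expR (t * x)).
Proof.
by apply: measurableT_comp; [exact: measurable_expR|exact: measurable_funM].
Qed.

Lemma measurable_cosM t : measurable_fun setT (fun x : R => cos (t * x)).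
Proof.
apply: (@measurableT_comp _ _ _ _ _ _ (@cos R)); last exact: measurable_funM.
by apply: continuous_measurable_fun; exact: continuous_cos.
Qed.

Lemma measurable_sinM t : measurable_fun setT (fun x : R => sin (t * x)).
Proof.
apply: (@measurableT_comp _ _ _ _ _ _ (@sin R)); last exact: measurable_funM.
by apply: continuous_measurable_fun; exact: continuous_sin.
Qed.

Lemma cexp_mulr z x : cexp (z * x%:C) =
  (expR (complex.Re z * x) * cos (complex.Im z * x)) +i*
  (expR (complex.Re z * x) * sin (complex.Im z * x)).
Proof.
by rewrite /cexp [z * _]mulrC cRe_mull cIm_mull ![x * _]mulrC; simpc.
Qed.

Lemma cmeasurable_cexp z : cmeasurable (fun x : R => cexp (z * x%:C)).
Proof.
split; under eq_fun do rewrite cexp_mulr/=; apply: measurable_funM;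
  [exact: measurable_expM|exact: measurable_cosM|exact: measurable_expM|exact: measurable_sinM].
Qed.

Lemma nc_cexpM z x : nc (cexp (z * x%:C)) = expR (complex.Re z * x).
Proof. by rewrite nc_cexp [z * _]mulrC cRe_mull mulrC. Qed.

Section HasMgf.
Variable nu : probability R R.
Hypothesis nu_mgf : has_mgf nu.

Lemma integrable_expR t : nu.-integrable setT (EFin \o (fun x => expR (t * x))).
Proof.
apply/integrableP; split; first by apply/measurable_EFinP; exact: measurable_expM.
by under eq_integral do rewrite /= ger0_norm ?expR_ge0//; exact: nu_mgf.
Qed.

Lemma expR_normr_le r x : 0 <= r -> expR (r * `|x|) <= expR (r * x) + expR (- r * x).
Proof.
move=> r0; have [x0|x0] := leP 0 x.
  by rewrite ger0_norm// lerDl expR_ge0.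
by rewrite ltr0_norm// mulrN mulNr lerDr expR_ge0.
Qed.

Lemma integrable_expR_norm r : 0 <= r ->
  nu.-integrable setT (EFin \o (fun x => expR (r * `|x|))).
Proof.
move=> r0; apply: (@le_integrable_real _ _ _ _ _
  (fun x => expR (r * x) + expR (- r * x))).
- apply: measurableT_comp; first exact: measurable_expR.
  apply: measurable_funM => //; exact: measurableT_comp.
- by move=> x; rewrite ger0_norm ?expR_ge0// expR_normr_le.
exact: (@integrableD _ _ _ _ _ measurableT _ _ (integrable_expR r) (integrable_expR (- r))).
Qed.

Lemma exprn_le_expR x k : `|x ^+ k| <= k`!%:R * expR `|x|.
Proof.
rewrite -ler_pdivrMl ?ltr0n ?fact_gt0// mulrC normrX.
apply: le_trans (etrunc_le_expR k.+1 (normr_ge0 x)).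
rewrite /etrunc big_ord_recr /= lerDr sumr_ge0//.
Qed.

Lemma integrable_exprn k : nu.-integrable setT (EFin \o (fun x => x ^+ k)).
Proof.
apply: (@le_integrable_real _ _ _ _ _ (fun x => k`!%:R * expR (1 * `|x|))).
- by apply: measurable_funX.
- by move=> x; rewrite mul1r exprn_le_expR.
exact: (@integrableZl _ _ _ nu _ measurableT k`!%:R _ (integrable_expR_norm ler01)).
Qed.

Definition mgf_tail N r : R := \int[nu]_x (etail N (r * `|x|)).

Lemma measurable_etail N r : measurable_fun setT (fun x : R => etail N (r * `|x|)).
Proof.
have mx : measurable_fun setT (fun x : R => r * `|x|).
  by apply: measurable_funM => //; exact: measurableT_comp.
apply: measurable_funB; first by apply: measurableT_comp => //; exact: measurable_expR.
apply: measurable_sum => k; apply: measurable_funM => //.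
exact: measurable_funX.
Qed.

Lemma etail_le_expR N r : 0 <= r -> etail N r <= expR r.
Proof.
move=> r0; rewrite lerBlDr lerDl sumr_ge0// => i _.
by rewrite divr_ge0// exprn_ge0.
Qed.

Lemma normr_etail_le N r x : 0 <= r -> `|etail N (r * `|x|)| <= expR (r * `|x|).
Proof.
by move=> r0; rewrite ger0_norm ?etail_ge0 ?etail_le_expR ?mulr_ge0.
Qed.

Lemma integrable_etail N r : 0 <= r ->
  nu.-integrable setT (EFin \o (fun x => etail N (r * `|x|))).
Proof.
move=> r0; apply: le_integrable_real (integrable_expR_norm r0).
  exact: measurable_etail.
by move=> x; exact: normr_etail_le.
Qed.

Lemma cvg_mgf_tail r : 0 <= r -> mgf_tail N r @[N --> \oo] --> 0.
Proof.
move=> r0.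
have [||||//|_ _] := @dominated_convergence _ _ _ nu setT measurableT
  (fun N x => (etail N (r * `|x|))%:E) (cst 0%E) (fun x => (expR (r * `|x|))%:E).
- by move=> N; apply/measurable_EFinP; exact: measurable_etail.
- exact: measurable_cst.
- apply: aeW => x _; apply: cvg_EFin; first exact: nearW.
  exact: cvg_etail.
- exact: integrable_expR_norm.
- by apply: aeW => x N _; rewrite abse_EFin lee_fin normr_etail_le.
rewrite integral0 => /fine_cvgP[_]; exact.
Qed.

(** The pointwise remainder of e^{zx} is at most the real tail at r|x|, and this is integrated. With
    the dominated convergence of [cvg_mgf_tail] it makes [cmgf nu] an entire function in the sense
    required by [log_entire_poly]. *)
Lemma cmgf_series z r N : nc z <= r ->
  nc (cmgf nu z - \sum_(k < N) (mcoef nu k)%:C * z ^+ k) <= mgf_tail N r.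
Proof.
move=> zr; have r0 : 0 <= r by exact: le_trans (nc_ge0 _) zr.
have -> : \sum_(k < N) (mcoef nu k)%:C * z ^+ k =
    integralC nu (fun x => \sum_(k < N) (z ^+ k / k`!%:R) * (x ^+ k)%:C).
  rewrite (@integralC_sum _ _ _ _ N (fun k => z ^+ k / k`!%:R) (fun k x => x ^+ k)).
    apply: eq_bigr => k _; rewrite /mcoef rmorphM fmorphV rmorph_nat; ring.
  by move=> k; exact: integrable_exprn.
have sE x : \sum_(k < N) (z ^+ k / k`!%:R) * (x ^+ k)%:C = etrunc N (z * x%:C).
  by apply: eq_bigr => k _; rewrite exprMn rmorphXn mulrAC.
have msum : cmeasurable (fun x => \sum_(k < N) (z ^+ k / k`!%:R) * (x ^+ k)%:C).
  split.
    under eq_fun do rewrite cRe_sum; apply: measurable_sum => k.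
    under eq_fun do rewrite mulrC cRe_mull.
    by apply: measurable_funM => //; exact: measurable_funX.
  under eq_fun do rewrite cIm_sum; apply: measurable_sum => k.
  under eq_fun do rewrite mulrC cIm_mull.
  by apply: measurable_funM => //; exact: measurable_funX.
have dist x : nc (cexp (z * x%:C) - etrunc N (z * x%:C)) <= etail N (r * `|x|).
  rewrite (le_trans (nc_etrunc_cexp _ _))// etail_le ?nc_ge0// ncM nc_real.
  by rewrite ler_wpM2r.
have nexp x : nc (cexp (z * x%:C)) <= expR (r * `|x|).
  rewrite nc_cexpM ler_expR (le_trans (ler_norm _))// normrM ler_wpM2r//.
  exact: le_trans (normr_Re_le _) zr.
rewrite -(@integralCB _ _ _ nu _ _ (fun x => expR (r * `|x|))
  (fun x => expR (r * `|x|) + etail N (r * `|x|))).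
- apply: nc_integralC_le; last exact: integrable_etail.
    case: msum => mR mI; case: (cmeasurable_cexp z) => mR' mI'; split.
      by under eq_fun do rewrite cReD cReN; exact: measurable_funB.
    by under eq_fun do rewrite cImD cImN; exact: measurable_funB.
  by move=> x; rewrite sE dist.
- exact: cmeasurable_cexp.
- exact: nexp.
- exact: integrable_expR_norm.
- exact: msum.
- move=> x; rewrite sE -[X in nc X](subrK (cexp (z * x%:C))) addrC.
  by rewrite (le_trans (ncD _ _))// lerD// nc_distC.
- exact: (@integrableD _ _ _ _ _ measurableT _ _ (integrable_expR_norm r0) (integrable_etail N r0)).
Qed.

Lemma cvg_cmgf_series z :
  nc (\sum_(k < N) (mcoef nu k)%:C * z ^+ k - cmgf nu z) @[N --> \oo] --> 0.
Proof.
apply: (squeeze_cvgr _ (cvg_cst 0) (cvg_mgf_tail (nc_ge0 z))).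
by apply: nearW => N; rewrite nc_ge0 nc_distC cmgf_series.
Qed.

(** The ridge property, from |e^{zx}| = e^{(Re z) x}; it is the source of u(z) <= u(Re z). *)
Lemma nc_cmgf_le z : nc (cmgf nu z) <= fine (mgf nu (complex.Re z)).
Proof.
apply: (@nc_integralC_le _ _ _ nu _ (fun x => expR (complex.Re z * x))).
- exact: cmeasurable_cexp.
- by move=> x; rewrite nc_cexpM.
- exact: integrable_expR.
Qed.

Lemma cmgf_real t : cmgf nu t%:C = (fine (mgf nu t))%:C.
Proof.
rewrite /cmgf /integralC; congr (_ +i* _).
  by apply: eq_Rintegral => x _; rewrite -rmorphM cexp_real.
rewrite (@eq_Rintegral _ _ _ _ _ (cst 0)); first by rewrite Rintegral_cst// mul0r.
by move=> x _; rewrite -rmorphM cexp_real.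
Qed.

End HasMgf.

Lemma mcoef0 nu : mcoef nu 0 = 1.
Proof.
rewrite /mcoef; under eq_Rintegral do rewrite expr0.
rewrite Rintegral_cst// [X in fine X](_ : _ = 1%E); last exact: probability_setT.
by rewrite mulr1 divff.
Qed.

Lemma mgf_ge0 nu t : (0 <= mgf nu t)%E.
Proof. by apply: integral_ge0 => x _; rewrite lee_fin expR_ge0. Qed.

(** Some interval [-n, n] has mass greater than 1/2, and on it e^{tx} >= e^{-n|t|}. *)
Lemma mgf_lower_bound nu : exists2 c : R, 0 <= c &
  forall t, ((expR (- (c * (1 + `|t|))))%:E <= mgf nu t)%E.
Proof.
pose F (n : nat) := [set x : R | `|x| <= n%:R].
have mF n : measurable (F n).
  rewrite (_ : F n = `[- n%:R, n%:R]%classic)//.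
  by apply/seteqP; split => x; rewrite /F /= in_itv/= ler_norml.
have Fnd : nondecreasing_seq F.
  by move=> n m nm; apply/subsetPset => x xn; apply: (le_trans xn); rewrite ler_nat.
have FT : \bigcup_n F n = setT.
  apply/seteqP; split => // x _; exists (Num.bound `|x|) => //.
  by rewrite /F /= ltW// archi_boundP.
have := nondecreasing_cvg_mu mF (bigcupT_measurable _ mF) Fnd (mu := nu).
rewrite FT [X in _ --> X](_ : _ = 1%E); last exact: probability_setT.
move=> nuF.
have [n _ nP] : \forall n \near \oo, ((2^-1)%:E < nu (F n))%E.
  have /fine_cvgP[_ /cvgr_gt/(_ 2^-1)] := nuF.
  rewrite /= invf_lt1// ltr1n => /(_ isT)[n _ nP]; exists n => // m /nP /= h.
  by rewrite -(fineK (fin_num_measure nu _ (mF m))) lte_fin.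
have {nP} := nP n (leqnn n) => nuFn.
(* The additional 1 absorbs the mass, since e^{-1} <= 1/2. *)
exists n.+1%:R => // t.
apply: (@le_trans _ _ (\int[nu]_(x in F n) (expR (t * x))%:E)%E); last first.
  apply: ge0_subset_integral => //.
  by apply/measurable_EFinP; exact: measurable_expM.
apply: (@le_trans _ _ (\int[nu]_(x in F n) (expR (- (n%:R * `|t|)))%:E)%E); last first.
  apply: ge0_le_integral => //.
  - by apply/measurable_EFinP/measurable_funTS; exact: measurable_expM.
  move=> x /= xn; rewrite lee_fin ler_expR lerNl (le_trans (ler_norm _))//.
  by rewrite normrN normrM mulrC ler_wpM2r.
rewrite integral_cst//.
apply: (@le_trans _ _ ((expR (- (n%:R * `|t|)))%:E * (2^-1)%:E)%E); last first.
  by rewrite lee_wpmul2l ?lee_fin ?expR_ge0// ltW.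
rewrite -EFinM lee_fin -natr1.
have -> : - ((n%:R + 1) * (1 + `|t|)) = - (n%:R * `|t|) + (- 1 - (n%:R + `|t|)) :> R.
  by ring.
rewrite expRD ler_wpM2l ?expR_ge0//.
apply: (@le_trans _ _ (expR (- 1))).
  by rewrite ler_expR gerDl oppr_le0 addr_ge0.
by rewrite expRN lef_pV2 ?posrE ?expR_gt0// -natr1 expR_ge1Dx.
Qed.

End MomentGeneratingFunction.

Definition mk_mfun d d' (T : measurableType d) (T' : measurableType d')
    (f : T -> T') (mf : measurable_fun setT f) : {mfun T >-> T'} :=
  mfun_Sub (mem_set mf).

(** * Sums of independent random variables *)

Section Laws.
Context d (T : measurableType d) (R : realType) (P : probability T R).
Implicit Types (X Y : {mfun T >-> R}) (z : R[i]) (t x r s : R).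

Lemma mgf_distribution X t :
  mgf (distribution P X) t = (\int[P]_w (expR (t * X w))%:E)%E.
Proof.
rewrite /mgf ge0_integral_distribution//.
by apply/measurable_EFinP; exact: measurable_expM.
Qed.

Lemma Rintegral_distribution X (f : R -> R) : measurable_fun setT f ->
  P.-integrable setT (EFin \o (f \o X)) ->
  \int[distribution P X]_x f x = \int[P]_w f (X w).
Proof.
move=> mf fi; rewrite /Rintegral integral_distribution//.
exact/measurable_EFinP.
Qed.

Lemma integrable_distribution X (f : R -> R) : measurable_fun setT f ->
  (distribution P X).-integrable setT (EFin \o f) <->
  P.-integrable setT (EFin \o (f \o X)).
Proof.
move=> mf; have mf' : measurable_fun setT (EFin \o f) by exact/measurable_EFinP.
split => /integrableP[_ fi]; apply/integrableP; split.
- by apply/measurable_EFinP/measurableT_comp.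
- move: fi; rewrite ge0_integral_distribution//; exact: measurableT_comp.
- exact: mf'.
- by rewrite ge0_integral_distribution//; exact: measurableT_comp.
Qed.

Definition indep2 X Y := forall A B, measurable A -> measurable B ->
  P (X @^-1` A `&` Y @^-1` B) = (P (X @^-1` A) * P (Y @^-1` B))%E.

Definition pair_fun X Y (w : T) : R * R := (X w, Y w).

Lemma measurable_pair_fun X Y : measurable_fun setT (pair_fun X Y).
Proof. exact: measurable_fun_pair. Qed.

(** Independence gives the joint law on rectangles, where a product measure is determined. *)
Lemma joint_law X Y : indep2 X Y -> forall E : set (R * R), measurable E ->
  (distribution P X \x distribution P Y)%E E = P (pair_fun X Y @^-1` E).
Proof.
move=> XY E mE.
rewrite (@product_measure_unique _ _ _ _ _ _ _
  (distribution P (mk_mfun (measurable_pair_fun X Y))))//.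
Qed.

Lemma ge0_integral_joint X Y (h : R * R -> \bar R) : indep2 X Y ->
  measurable_fun setT h -> (forall p, (0 <= h p)%E) ->
  (\int[P]_w h (X w, Y w) =
   \int[distribution P X \x distribution P Y]_p h p)%E.
Proof.
move=> XY mh h0.
rewrite (eq_measure_integral (distribution P (mk_mfun (measurable_pair_fun X Y)))).
  by rewrite ge0_integral_distribution.
by move=> A mA _; exact: joint_law.
Qed.

(** Tonelli's theorem: the identity holds in the extended reals, whether or not the integrals are
    finite. *)
Lemma mgf_indep2 X Y t : indep2 X Y ->
  (\int[P]_w (expR (t * (X w + Y w)))%:E =
   mgf (distribution P X) t * mgf (distribution P Y) t)%E.
Proof.
move=> XY; pose h (p : R * R) := ((expR (t * p.1))%:E * (expR (t * p.2))%:E)%E.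
have mh : measurable_fun setT h.
  apply: emeasurable_funM; apply/measurable_EFinP.
    exact: (measurableT_comp (measurable_expM t) measurable_fst).
  exact: (measurableT_comp (measurable_expM t) measurable_snd).
have h0 p : (0 <= h p)%E by rewrite mule_ge0// lee_fin expR_ge0.
transitivity (\int[P]_w h (X w, Y w))%E.
  by apply: eq_integral => w _; rewrite /h /= -EFinM -expRD mulrDr.
rewrite (ge0_integral_joint XY)// fubini_tonelli1//.
rewrite /fubini_F /h /=.
under eq_integral => x _.
  rewrite ge0_integralZl//; last by apply/measurable_EFinP; exact: measurable_expM.
  over.
rewrite ge0_integralZr//.
- by apply/measurable_EFinP; exact: measurable_expM.
- exact: mgf_ge0.
Qed.

Lemma integral_indep2 X Y (f g : R -> R) : indep2 X Y ->
  measurable_fun setT f -> measurable_fun setT g ->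
  (distribution P X).-integrable setT (EFin \o f) ->
  (distribution P Y).-integrable setT (EFin \o g) ->
  P.-integrable setT (EFin \o (fun w => f (X w) * g (Y w))) /\
  \int[P]_w (f (X w) * g (Y w)) =
  (\int[distribution P X]_x f x) * (\int[distribution P Y]_y g y).
Proof.
move=> XY mf mg fi gi; set m1 := distribution P X; set m2 := distribution P Y.
pose h (p : R * R) := (f p.1 * g p.2)%:E.
have mh : measurable_fun setT h.
  apply/measurable_EFinP/measurable_funM.
    exact: (measurableT_comp mf measurable_fst).
  exact: (measurableT_comp mg measurable_snd).
have mf' : measurable_fun setT (EFin \o f) by exact/measurable_EFinP.
have mg' : measurable_fun setT (EFin \o g) by exact/measurable_EFinP.
have ih : (m1 \x m2)%E.-integrable setT h.
  apply/integrable12ltyP => //=.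
  under eq_integral => x _.
    under eq_integral do rewrite /h /= normrM EFinM.
    rewrite ge0_integralZl//; last by apply: measurableT_comp => //; exact: measurableT_comp.
    over.
  rewrite ge0_integralZr//.
  - case/integrableP : fi => _ fi; case/integrableP : gi => _ gi.
    by rewrite lte_mul_pinfty// ?integral_ge0// ge0_fin_numE ?integral_ge0.
  - by apply: measurableT_comp => //; exact: measurableT_comp.
  - by apply: integral_ge0.
have iP : P.-integrable setT (EFin \o (fun w => f (X w) * g (Y w))).
  apply/integrableP; split.
    apply/measurable_EFinP/measurable_funM; exact: measurableT_comp.
  case/integrableP : ih => _.
  rewrite -(ge0_integral_joint XY (h := fun p => `|h p|%E))//.
  exact: measurableT_comp.
split => //.
rewrite /Rintegral.
have -> : (\int[P]_w (f (X w) * g (Y w))%:E = \int[m1 \x m2]_p h p)%E.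
  rewrite [RHS](eq_measure_integral (distribution P (mk_mfun (measurable_pair_fun X Y)))).
    by rewrite integral_distribution.
  by move=> A mA _; exact: joint_law.
rewrite -integral12_prod_meas1// /fubini_F /h /=.
under eq_integral => x _.
  under eq_integral do rewrite EFinM.
  rewrite integralZl//.
  over.
have fin2 : (\int[m2]_y (g y)%:E)%E \is a fin_num by exact: integrable_fin_num.
rewrite -(fineK fin2) integralZr// fineM//.
by apply: integrable_fin_num => //.
Qed.

(** The product e^{zX} e^{zY} is expanded into four products of real functions, each factor being
    dominated by e^{(Re z) x}. *)
Lemma cmgf_indep2 X Y z : indep2 X Y ->
  (mgf (distribution P X) (complex.Re z) < +oo)%E ->
  (mgf (distribution P Y) (complex.Re z) < +oo)%E ->
  integralC P (fun w => cexp (z * (X w + Y w)%:C)) =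
  cmgf (distribution P X) z * cmgf (distribution P Y) z.
Proof.
move=> XY X1 Y1.
have expi nu : (mgf nu (complex.Re z) < +oo)%E ->
    nu.-integrable setT (EFin \o (fun x => expR (complex.Re z * x))).
  move=> h; apply/integrableP; split; first by apply/measurable_EFinP; exact: measurable_expM.
  by under eq_integral do rewrite /= ger0_norm ?expR_ge0//.
have [mR mI] := cmeasurable_cexp z.
have nz x : nc (cexp (z * x%:C)) <= expR (complex.Re z * x) by rewrite nc_cexpM.
have iR nu : (mgf nu (complex.Re z) < +oo)%E ->
    nu.-integrable setT (EFin \o (fun x => complex.Re (cexp (z * x%:C)))).
  by move=> /expi; apply: integrable_Re => //; exact: cmeasurable_cexp.
have iI nu : (mgf nu (complex.Re z) < +oo)%E ->
    nu.-integrable setT (EFin \o (fun x => complex.Im (cexp (z * x%:C)))).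
  by move=> /expi; apply: integrable_Im => //; exact: cmeasurable_cexp.
have [i1 e1] := integral_indep2 XY mR mR (iR _ X1) (iR _ Y1).
have [i2 e2] := integral_indep2 XY mI mI (iI _ X1) (iI _ Y1).
have [i3 e3] := integral_indep2 XY mR mI (iR _ X1) (iI _ Y1).
have [i4 e4] := integral_indep2 XY mI mR (iI _ X1) (iR _ Y1).
have cE w : cexp (z * (X w + Y w)%:C) = cexp (z * (X w)%:C) * cexp (z * (Y w)%:C).
  by rewrite rmorphD mulrDr cexpD.
apply/eqP; rewrite eq_complex /=; apply/andP; split; apply/eqP.
  rewrite -e1 -e2 -RintegralB//; apply: eq_Rintegral => w _.
  by rewrite -cReM -cE.
rewrite -e3 -e4 -RintegralD//; apply: eq_Rintegral => w _.
by rewrite -cImM -cE.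
Qed.

Lemma cmgf_distribution X z : (mgf (distribution P X) (complex.Re z) < +oo)%E ->
  cmgf (distribution P X) z = integralC P (fun w => cexp (z * (X w)%:C)).
Proof.
move=> X1.
have ie : (distribution P X).-integrable setT (EFin \o (fun x => expR (complex.Re z * x))).
  apply/integrableP; split; first by apply/measurable_EFinP; exact: measurable_expM.
  by under eq_integral do rewrite /= ger0_norm ?expR_ge0//.
have nz x : nc (cexp (z * x%:C)) <= expR (complex.Re z * x) by rewrite nc_cexpM.
have mz := cmeasurable_cexp z; have [mR mI] := mz.
rewrite /cmgf /integralC (Rintegral_distribution mR); last first.
  by apply/integrable_distribution => //; exact: integrable_Re ie.
rewrite (Rintegral_distribution mI)//.
by apply/integrable_distribution => //; exact: integrable_Im ie.
Qed.

End Laws.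

Lemma fst_independent d (T : measurableType d) (R : realType)
    (P : probability T R) d1 d2 (T1 : measurableType d1) (T2 : measurableType d2)
    n (xi : 'I_n -> {RV P >-> (T1 * T2)%type}) (X : 'I_n -> {RV P >-> T1}) :
  (forall j w, X j w = (xi j w).1) -> independent_RVs xi -> independent_RVs X.
Proof.
move=> XE indep J A mA.
have preE j : X j @^-1` A j = xi j @^-1` (fst @^-1` A j).
  by apply/seteqP; split => w /=; rewrite XE.
under eq_bigcapr do rewrite preE.
rewrite indep; first by apply: eq_bigr => j _; rewrite preE.
by move=> j; rewrite -[X in measurable X]setTI; exact: measurable_fst.
Qed.

(** * Transforms of sums of several independent variables *)

Section PartialSums.
Context d (T : measurableType d) (R : realType) (P : probability T R).
Variables (n : nat) (X : 'I_n -> {mfun T >-> R}) (s : 'I_n -> R).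
Hypothesis indep : @independent_RVs _ _ T _ R P n X.
Implicit Types (A : set R) (B : 'I_n -> set R).

Definition partial_sum_fun (k : nat) (w : T) : R := \sum_(j < n | (j < k)%N) s j * X j w.

Lemma measurable_partial_sum k : measurable_fun setT (partial_sum_fun k).
Proof.
rewrite (_ : partial_sum_fun k =
    fun w => \sum_(j < n) if (j < k)%N then s j * X j w else 0); last first.
  by apply/funext => w; exact: big_mkcond.
apply: measurable_sum => j; case: (j < k)%N => //.
exact: measurable_funM.
Qed.

Definition partial_sum k : {mfun T >-> R} := mk_mfun (measurable_partial_sum k).

Lemma partial_sumS (k : 'I_n) w :
  partial_sum k.+1 w = partial_sum k w + s k * X k w.
Proof.
rewrite /= /partial_sum_fun (bigD1 k)//= addrC; congr (_ + _).
by apply: eq_bigl => j; rewrite ltnS ltn_neqAle andbC.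
Qed.

Definition tail_set k : {set 'I_n} := [set j : 'I_n | (k <= j)%N]%SET.

Definition tail_event k B : set T := \bigcap_(j in [set` tail_set k]) (X j @^-1` B j).

Let measurable_pre j A : measurable A -> measurable (X j @^-1` A).
Proof. by move=> mA; rewrite -[X in measurable X]setTI; exact: measurable_funP. Qed.

Let measurable_preS k A : measurable A -> measurable (partial_sum k @^-1` A).
Proof. by move=> mA; rewrite -[X in measurable X]setTI; exact: measurable_funP. Qed.

Lemma tail_setS (k : 'I_n) : tail_set k = (k |: tail_set k.+1)%SET.
Proof.
apply/setP => j; rewrite !inE leq_eqVlt eq_sym; congr (_ || _).
Qed.

Lemma tail_eventS (k : 'I_n) B :
  tail_event k B = X k @^-1` B k `&` tail_event k.+1 B.
Proof.
rewrite /tail_event tail_setS; apply/seteqP; split => w.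
  move=> h; split; first by apply: (h k); rewrite /= !inE eqxx.
  by move=> j jk; apply: h; move: jk; rewrite /= !inE => ->; rewrite orbT.
move=> [h1 h2] j /=; rewrite !inE => /orP[/eqP -> //|jk].
by apply: h2; rewrite /= inE.
Qed.

Lemma measurable_tail_event k B : (forall j, measurable (B j)) ->
  measurable (tail_event k B).
Proof.
move=> mB; apply: fin_bigcap_measurable; first exact: finite_finset.
by move=> j _; exact: measurable_pre.
Qed.

Lemma tail_event_prob (k : 'I_n) B : (forall j, measurable (B j)) ->
  P (tail_event k B) = (P (X k @^-1` B k) * P (tail_event k.+1 B))%E.
Proof.
move=> mB; rewrite /tail_event !indep//.
rewrite tail_setS big_setU1//=.
by rewrite inE ltnn.
Qed.

(* Joint independence from the later variables is what the induction on k needs. *)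
Lemma partial_sum_indep_tail k : (k <= n)%N -> forall A B,
  measurable A -> (forall j, measurable (B j)) ->
  P (partial_sum k @^-1` A `&` tail_event k B) =
  (P (partial_sum k @^-1` A) * P (tail_event k B))%E.
Proof.
elim: k => [_|k IH kn] A B mA mB.
  have [A0|A0] := pselect (A 0).
    rewrite (_ : _ @^-1` A = setT) ?setTI ?probability_setT ?mul1e//.
    apply/seteqP; split => // w _.
    by rewrite /= /partial_sum_fun big_pred0.
  rewrite (_ : _ @^-1` A = set0) ?set0I ?measure0 ?mul0e//.
  apply/seteqP; split => // w.
  by rewrite /= /partial_sum_fun big_pred0.
pose k' := Ordinal kn; have {}IH := IH (ltnW kn).
set W := tail_event k.+1 B.
have mW : measurable W by exact: measurable_tail_event.
(* If the later event is null both sides vanish; otherwise P can be conditioned on it. *)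
have [W0|W0] := eqVneq (P W) 0%E.
  rewrite W0 mule0; apply/eqP; rewrite eq_le measure_ge0 andbT -W0.
  apply: le_measure; rewrite ?inE//.
  by apply: measurableI => //; exact: measurable_preS.
have PWfin : P W \is a fin_num by exact: fin_num_measure.
have W_gt0 : 0 < fine (P W).
  rewrite fine_gt0// lt0e W0 measure_ge0/= -ge0_fin_numE//.
have c0 : 0 <= (fine (P W))^-1 by rewrite invr_ge0 ltW.
(* [m] is P conditioned on [W]. By induction the law of the pair (partial sum, X_k) under [m] agrees
   on rectangles with its law under P, hence everywhere, in particular on the set [E] that expresses
   the next partial sum. *)
pose m : {measure set T -> \bar R} := mscale (NngNum c0) (mrestr P mW).
pose f := pair_fun (partial_sum k) (X k').
have mf : measurable_fun setT f by exact: measurable_pair_fun.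
pose m' := measure_function.measure_function_pushforward__canonical__measure_function_Measure m mf.
have m'E E : m' E = ((fine (P W))^-1%:E * P (f @^-1` E `&` W))%E by [].
have WX (B0 : set R) : measurable B0 ->
    P (X k' @^-1` B0 `&` W) = (P (X k' @^-1` B0) * P W)%E.
  move=> mB0; pose B' j := if j == k' then B0 else B j.
  have mB' j : measurable (B' j) by rewrite /B'; case: ifP.
  have := tail_event_prob k' mB'; rewrite tail_eventS.
  have -> : tail_event k'.+1 B' = W.
    apply: eq_bigcapr => j /=; rewrite inE /B' => jk.
    by case: eqP jk => // ->; rewrite ltnn.
  by rewrite /B' eqxx.
have SX : indep2 P (partial_sum k) (X k').
  move=> A0 B0 mA0 mB0; pose B' j := if j == k' then B0 else setT.
  have mB' j : measurable (B' j) by rewrite /B'; case: ifP.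
  have -> : X k' @^-1` B0 = tail_event k B'.
    rewrite (tail_eventS k') [X in _ `&` X](_ : _ = setT) ?setIT ?{1}/B' ?eqxx//.
    apply/seteqP; split => // w _ j /=; rewrite inE /B' => jk.
    by case: eqP jk => // ->; rewrite ltnn.
  exact: IH.
have m'prod E : measurable E ->
    (distribution P (partial_sum k) \x distribution P (X k'))%E E = m' E.
  apply: product_measure_unique => A0 B0 mA0 mB0; rewrite m'E.
  pose B' j := if j == k' then B0 else B j.
  have mB' j : measurable (B' j) by rewrite /B'; case: ifP.
  have -> : f @^-1` (A0 `*` B0) `&` W =
      partial_sum k @^-1` A0 `&` (X k' @^-1` B0 `&` W) by rewrite setIA.
  have -> : X k' @^-1` B0 `&` W = tail_event k B'.
    rewrite (tail_eventS k') {1}/B' eqxx; congr (_ `&` _).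
    apply: eq_bigcapr => j /=; rewrite inE /B' => jk.
    by case: eqP jk => // ->; rewrite ltnn.
  rewrite IH//.
  have -> : P (tail_event k B') = (P (X k' @^-1` B0) * P W)%E.
    rewrite -WX//; congr (P _); rewrite (tail_eventS k') {1}/B' eqxx; congr (_ `&` _).
    apply: eq_bigcapr => j /=; rewrite inE /B' => jk.
    by case: eqP jk => // ->; rewrite ltnn.
  rewrite -(fineK PWfin) [X in (_ * X = _)%E]muleA muleCA -EFinM.
  by rewrite mulVf ?gt_eqF// mule1.
pose E := [set p : R * R | A (p.1 + s k' * p.2)].
have mE : measurable E.
  have mg : measurable_fun setT (fun p : R * R => p.1 + s k' * p.2).
    by apply: measurable_funD; [exact: measurable_fst|
      apply: measurable_funM => //; exact: measurable_snd].
  by rewrite -[E]setTI; exact: mg.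
have preE : partial_sum k.+1 @^-1` A = f @^-1` E.
  by apply/funext => w; exact: (congr1 A (partial_sumS k' w)).
rewrite preE -(joint_law SX mE) m'prod// m'E.
by rewrite -(fineK PWfin) muleAC -EFinM mulVf ?gt_eqF// mul1e.
Qed.

Lemma partial_sum_indep2 (k : 'I_n) : indep2 P (partial_sum k) (X k).
Proof.
move=> A0 B0 mA0 mB0; pose B' j := if j == k then B0 else setT.
have mB' j : measurable (B' j) by rewrite /B'; case: ifP.
have -> : X k @^-1` B0 = tail_event k B'.
  rewrite tail_eventS [X in _ `&` X](_ : _ = setT) ?setIT ?{1}/B' ?eqxx//.
  apply/seteqP; split => // w _ j /=; rewrite inE /B' => jk.
  by case: eqP jk => // ->; rewrite ltnn.
by apply: partial_sum_indep_tail => //; exact: ltnW.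
Qed.

Lemma measurable_scale j : measurable_fun setT (fun w => s j * X j w).
Proof. exact: measurable_funM. Qed.

Definition scale_rv j : {mfun T >-> R} := mk_mfun (measurable_scale j).

Lemma partial_sum_indep_scale (k : 'I_n) : indep2 P (partial_sum k) (scale_rv k).
Proof.
move=> A B mA mB.
have mB' : measurable ((fun x => s k * x) @^-1` B).
  have mg : measurable_fun setT (fun x : R => s k * x) by exact: measurable_funM.
  by rewrite -[X in measurable X]setTI; exact: mg.
exact: (@partial_sum_indep2 k _ _ mA mB').
Qed.

Lemma mgf_scale j t :
  mgf (distribution P (scale_rv j)) t = mgf (distribution P (X j)) (s j * t).
Proof.
rewrite !mgf_distribution; apply: eq_integral => w _ /=.
by rewrite mulrA [t * _]mulrC.
Qed.

Lemma mgf_partial_sum k t : (k <= n)%N ->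
  mgf (distribution P (partial_sum k)) t =
  (\prod_(j < n | (j < k)%N) mgf (distribution P (X j)) (s j * t))%E.
Proof.
elim: k => [_|k IH kn].
  rewrite big_pred0// mgf_distribution.
  under eq_integral do rewrite /= /partial_sum_fun big_pred0// mulr0 expR0.
  by rewrite integral_cst// mul1e; exact: probability_setT.
rewrite (bigD1 (Ordinal kn))//= muleC.
rewrite [in RHS](eq_bigl (fun j : 'I_n => (j < k)%N)); last first.
  by move=> j; rewrite ltnS [RHS]ltn_neqAle andbC.
rewrite -(IH (ltnW kn)) -(mgf_scale (Ordinal kn) t).
rewrite -(@mgf_indep2 _ _ _ _ _ _ t (@partial_sum_indep_scale (Ordinal kn))).
rewrite mgf_distribution; apply: eq_integral => w _.
by rewrite (partial_sumS (Ordinal kn)).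
Qed.

Lemma cmgf_scale j z : (mgf (distribution P (X j)) (s j * complex.Re z) < +oo)%E ->
  cmgf (distribution P (scale_rv j)) z = cmgf (distribution P (X j)) ((s j)%:C * z).
Proof.
move=> h; rewrite !cmgf_distribution ?mgf_scale ?cRe_mull//.
by congr (integralC P _); apply/funext => w /=; rewrite rmorphM mulrCA mulrA.
Qed.

(** Finiteness is asked only at the points s_j Re z. For imaginary z it holds for every law, so the
    lemma then applies to characteristic functions, before any exponential moment is known. *)
Lemma cmgf_partial_sum k z : (k <= n)%N ->
  (forall j, mgf (distribution P (X j)) (s j * complex.Re z) < +oo)%E ->
  (mgf (distribution P (partial_sum k)) (complex.Re z) < +oo)%E /\
  cmgf (distribution P (partial_sum k)) z =
  \prod_(j < n | (j < k)%N) cmgf (distribution P (X j)) ((s j)%:C * z).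
Proof.
move=> + Xfin; have mfin k' : (k' <= n)%N ->
    (mgf (distribution P (partial_sum k')) (complex.Re z) < +oo)%E.
  move=> kn; rewrite mgf_partial_sum//.
  rewrite -ge0_fin_numE; last by apply: prode_ge0 => j _; exact: mgf_ge0.
  by apply: prode_fin_num => j _; rewrite ge0_fin_numE ?mgf_ge0.
move=> kn; split; first exact: mfin.
elim: k kn => [_|k IH kn].
  rewrite [RHS]big_pred0// cmgf_distribution ?mfin//.
  transitivity (integralC P (fun=> 1%:C)).
    congr (integralC P _); apply/funext => w /=.
    by rewrite /partial_sum_fun big_pred0// mulr0 -(rmorph0 (real_complex R)) cexp_real expR0.
  rewrite /integralC /= !Rintegral_cst// mul1r mul0r.
  by rewrite [X in fine X](_ : _ = 1%E)//; exact: probability_setT.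
rewrite (bigD1 (Ordinal kn))//= mulrC.
rewrite [in RHS](eq_bigl (fun j : 'I_n => (j < k)%N)); last first.
  by move=> j; rewrite ltnS [RHS]ltn_neqAle andbC.
rewrite -(IH (ltnW kn)) -(cmgf_scale (Xfin (Ordinal kn))).
rewrite -(@cmgf_indep2 _ _ _ _ _ _ z (@partial_sum_indep_scale (Ordinal kn))).
- rewrite cmgf_distribution ?mfin//; congr (integralC P _); apply/funext => w.
  by rewrite (partial_sumS (Ordinal kn)).
- by apply: mfin; exact: ltnW.
- by rewrite mgf_scale.
Qed.

End PartialSums.

(** * Even moments from the cosine transform *)

Section CosRemainder.
Variable R : realType.
Implicit Types (t x y r s : R).

Definition cos_poly K : {poly R} :=
  \sum_(k < K) ((-1) ^+ k / (k.*2)`!%:R) *: 'X^(k.*2).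

Definition sin_poly K : {poly R} :=
  \sum_(k < K) ((-1) ^+ k / (k.*2.+1)`!%:R) *: 'X^(k.*2.+1).

(** The sign makes the leading term y^{2K} / (2K)! positive. *)
Definition cos_rem K y : R := (-1) ^+ K * (cos y - (cos_poly K).[y]).

Definition sin_rem K y : R := (-1) ^+ K * (sin y - (sin_poly K).[y]).

Lemma fact_divS n : n.+1%:R / (n.+1)`!%:R = (n`!%:R)^-1 :> R.
Proof.
by rewrite factS natrM invfM mulrA divff ?mul1r// pnatr_eq0.
Qed.

Lemma deriv_sin_poly K : (sin_poly K)^`() = cos_poly K.
Proof.
rewrite /sin_poly raddf_sum; apply: eq_bigr => k _ /=.
rewrite derivZ derivXn /= -[X in _ *: X]scaler_nat scalerA; congr (_ *: _).
by rewrite mulrAC -mulrA fact_divS.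
Qed.

Lemma deriv_cos_poly K : (cos_poly K.+1)^`() = - sin_poly K.
Proof.
rewrite /cos_poly raddf_sum big_ord_recl /= derivZ derivXn scaler0 add0r.
rewrite -sumrN; apply: eq_bigr => k _.
rewrite derivZ derivXn /= -[X in _ *: X]scaler_nat scalerA -scaleNr; congr (_ *: _).
by rewrite /bump /= add1n exprS doubleS mulrAC -mulrA fact_divS mulN1r mulNr.
Qed.

Lemma nondecreasing_ge0 (f df : R -> R) : f 0 = 0 ->
  (forall x, is_derive x 1 f (df x)) -> (forall x, 0 <= x -> 0 <= df x) ->
  forall x, 0 <= x -> 0 <= f x.
Proof.
move=> f0 fd df0 x x0.
have fd' y : y \in `]0, x[ -> is_derive y 1 f (df y) by move=> _; exact: fd.
have [|c] := MVT_segment x0 fd'.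
  by apply: derivable_within_continuous => y _; case: (fd y).
rewrite in_itv/= f0 !subr0 => /andP[c0 _] ->.
by rewrite mulr_ge0// df0.
Qed.

Lemma is_derive_cos_rem K x : is_derive x 1 (cos_rem K.+1) (sin_rem K x).
Proof.
have -> : cos_rem K.+1 = (-1) ^+ K.+1 *: (@cos R - horner (cos_poly K.+1)) by [].
apply: is_derive_eq.
rewrite deriv_cos_poly hornerN /sin_rem exprS mulN1r.
rewrite -[_ *: _]/(_ * _); ring.
Qed.

Lemma is_derive_sin_rem K x : is_derive x 1 (sin_rem K) (cos_rem K x).
Proof.
have -> : sin_rem K = (-1) ^+ K *: (@sin R - horner (sin_poly K)) by [].
by apply: is_derive_eq; rewrite deriv_sin_poly.
Qed.

Lemma cos_polyS K y :
  (cos_poly K.+1).[y] = (cos_poly K).[y] + (-1) ^+ K / (K.*2)`!%:R * y ^+ K.*2.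
Proof. by rewrite /cos_poly big_ord_recr /= hornerD hornerZ hornerXn. Qed.

Lemma cos_rem0 K : cos_rem K.+1 0 = 0.
Proof.
rewrite /cos_rem cos0; suff -> : (cos_poly K.+1).[0] = 1 by rewrite subrr mulr0.
elim: K => [|K IH]; last by rewrite cos_polyS IH expr0n/= mulr0 addr0.
by rewrite cos_polyS /cos_poly big_ord0 horner0 !expr0 add0r divff ?mul1r.
Qed.

Lemma sin_rem0 K : sin_rem K 0 = 0.
Proof.
rewrite /sin_rem sin0 sub0r /sin_poly horner_sum big1 ?oppr0 ?mulr0// => k _.
by rewrite hornerZ hornerXn expr0n mulr0.
Qed.

Lemma cos_remN K y : cos_rem K (- y) = cos_rem K y.
Proof.
rewrite /cos_rem cosN; congr (_ * (_ - _)).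
rewrite /cos_poly !horner_sum; apply: eq_bigr => k _.
by rewrite !hornerZ !hornerXn -mul2n !exprM sqrrN.
Qed.

(** Starting from 1 - cos y >= 0, two integrations from 0 lead from one remainder to the next;
    evenness reduces to y >= 0. *)
Lemma cos_rem_ge0 K y : 0 <= cos_rem K.+1 y.
Proof.
have pos : forall x, 0 <= x -> 0 <= cos_rem K.+1 x.
  elim: K => [|K IH] x x0.
    rewrite /cos_rem cos_polyS /cos_poly big_ord0 horner0 !expr0 add0r divff//.
    by rewrite expr1 mulr1 mulN1r opprB subr_ge0 cos_le1.
  apply: (nondecreasing_ge0 (cos_rem0 _) (is_derive_cos_rem K.+1)) => // {x0}x x0.
  exact: (nondecreasing_ge0 (sin_rem0 _) (is_derive_sin_rem K.+1)).
have [y0|y0] := leP 0 y; first exact: pos.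
by rewrite -cos_remN pos// oppr_ge0 ltW.
Qed.

Lemma cos_remS K y : cos_rem K.+1 y = y ^+ K.*2 / (K.*2)`!%:R - cos_rem K y.
Proof.
rewrite /cos_rem cos_polyS exprS mulN1r.
have s1 : (-1) ^+ K * (-1) ^+ K = 1 :> R by rewrite -exprMn mulrNN mulr1 expr1n.
rewrite opprD addrA mulNr mulrBr opprB addrC; congr (_ + _).
by rewrite mulrA mulrA s1 mul1r mulrC.
Qed.

Lemma cos_rem_le K y : cos_rem K y <= y ^+ K.*2 / (K.*2)`!%:R.
Proof. by rewrite -subr_ge0 -cos_remS cos_rem_ge0. Qed.

End CosRemainder.

Section FatouBound.
Context d (T : measurableType d) (R : realType) (mu : {measure set T -> \bar R}).

Lemma fatou_bound (f_ : nat -> T -> R) (f : T -> R) (b : nat -> R) B :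
  (forall N, measurable_fun setT (f_ N)) -> (forall N x, 0 <= f_ N x) ->
  (forall x, f_ N x @[N --> \oo] --> f x) ->
  (forall N, (\int[mu]_x (f_ N x)%:E <= (b N)%:E)%E) -> b @ \oo --> B ->
  (\int[mu]_x (f x)%:E <= B%:E)%E.
Proof.
move=> mf f0 fcv fb bB.
have fE x : limn_einf (fun N => (f_ N x)%:E) = (f x)%:E.
  apply: (cvg_limn_einf_sup _).1.
  by apply: cvg_EFin; [exact: nearW|exact: fcv].
under eq_integral do rewrite -fE.
have mf' N : measurable_fun setT (fun x => (f_ N x)%:E) by exact/measurable_EFinP.
have f0' N x : setT x -> (0 <= (f_ N x)%:E)%E by rewrite lee_fin.
apply: (le_trans (fatou mu measurableT mf' f0')).
set u := fun N => _; rewrite limn_einf_lim.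
have bB' : (fun N => (b N)%:E) @ \oo --> B%:E.
  by apply: cvg_EFin; [exact: nearW|exact: bB].
apply: (lee_cvg_to (@is_cvg_einfs _ u) bB'); apply: nearW => N.
apply: le_trans (fb N); apply: ereal_inf_lbound; by exists N => /=.
Qed.

End FatouBound.

(** On [0, 1] every power beyond the K-th is at most x^K, so the majorant at 1 serves as a constant
    for all x and K. *)
Lemma exp_poly_tail (R : realType) (Q : {poly R}) x K : Q`_0 = 0 -> 0 <= x <= 1 ->
  `|expR Q.[x] - \sum_(k < K) exp_poly_coef Q k * x ^+ k| <=
  x ^+ K * expR (abs_poly Q).[1].
Proof.
move=> Q0 /andP[x0 x1].
have cv : (fun N => `|\sum_(k < N) exp_poly_coef Q k * x ^+ k -
    \sum_(k < K) exp_poly_coef Q k * x ^+ k|) @ \oo -->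
    `|expR Q.[x] - \sum_(k < K) exp_poly_coef Q k * x ^+ k|.
  apply: cvg_norm; apply: cvgB; last exact: cvg_cst.
  exact: cvg_exp_poly_series_real.
apply: (ler_cvg_seq (N := K) cv (cvg_cst _)) => M /subnKC <-.
rewrite big_split_ord /= addrKl (le_trans (ler_norm_sum _ _ _))//.
apply: (@le_trans _ _ (x ^+ K * \sum_(i < M - K) `|exp_poly_coef Q (K + i)|)).
  rewrite mulr_sumr ler_sum// => i _; rewrite normrM mulrC.
  rewrite ler_wpM2r// ger0_norm ?exprn_ge0// exprD ler_piMr ?exprn_ge0//.
  exact: exprn_ile1.
rewrite ler_wpM2l ?exprn_ge0//.
apply: le_trans (sum_abs_exp_poly_coef (K + (M - K)) Q0 ler01).
rewrite big_split_ord /= -[leLHS]add0r lerD ?sumr_ge0//.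
by apply: ler_sum => i _; rewrite expr1n mulr1.
Qed.

Section EvenMoments.
Variables (R : realType) (mu : probability R R) (Q : {poly R}) (del : R).
Hypotheses (Q0 : Q`_0 = 0) (del0 : 0 < del) (del1 : del <= 1).
Hypothesis cosE : forall s, 0 < s <= del ->
  \int[mu]_y cos (s * y) = expR Q.[s ^+ 2].
Implicit Types (s x y t : R).

Let c := exp_poly_coef Q.

Let integrable_cosM s : mu.-integrable setT (EFin \o (fun y => cos (s * y))).
Proof.
apply: (@le_integrable_real _ _ _ _ _ (cst 1)); first exact: measurable_cosM.
  by move=> x; rewrite cos_max.
exact: finite_measure_integrable_cst.
Qed.

Let scaled_rem K s y : R := s ^- K.*2 * cos_rem K (s * y).

Let measurable_scaled_rem K s : measurable_fun setT (scaled_rem K s).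
Proof.
apply: measurable_funM => //; apply: measurable_funM => //.
apply: measurable_funB; first exact: measurable_cosM.
rewrite (_ : (fun y => (cos_poly R K).[s * y]) = (horner (cos_poly R K)) \o (fun y => s * y))//.
apply: measurableT_comp; last exact: measurable_funM.
by apply: continuous_measurable_fun; exact: continuous_horner.
Qed.

Let scaled_remE K s y : scaled_rem K s y = (s ^- K.*2 * (-1) ^+ K) * cos (s * y) +
  - (s ^- K.*2 * (-1) ^+ K) *
    \sum_(k < K) ((-1) ^+ k / (k.*2)`!%:R * s ^+ k.*2) * y ^+ k.*2.
Proof.
rewrite /scaled_rem /cos_rem /cos_poly horner_sum.
have -> : \sum_(i < K) (((-1) ^+ i / (i.*2)`!%:R) *: 'X^(i.*2)).[s * y] =
    \sum_(k < K) ((-1) ^+ k / (k.*2)`!%:R * s ^+ k.*2) * y ^+ k.*2.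
  by apply: eq_bigr => k _; rewrite hornerZ hornerXn exprMn mulrA.
ring.
Qed.

Let scaled_rem_le K s y : 0 < s -> scaled_rem K s y <= y ^+ K.*2 / (K.*2)`!%:R.
Proof.
move=> s0; rewrite /scaled_rem mulrC ler_pdivrMr ?exprn_gt0//.
have -> : y ^+ K.*2 / (K.*2)`!%:R * s ^+ K.*2 = (s * y) ^+ K.*2 / (K.*2)`!%:R.
  by rewrite exprMn; ring.
exact: cos_rem_le.
Qed.

(** The difference is s^2 times the next scaled remainder, which is again bounded by its leading
    term. *)
Let scaled_rem_dist K s y : 0 < s ->
  `|scaled_rem K s y - y ^+ K.*2 / (K.*2)`!%:R| <=
  s ^+ 2 * (y ^+ K.+1.*2 / (K.+1.*2)`!%:R).
Proof.
move=> s0; have sn : s != 0 by rewrite gt_eqF.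
have -> : scaled_rem K s y - y ^+ K.*2 / (K.*2)`!%:R =
    - (s ^+ 2 * scaled_rem K.+1 s y).
  rewrite /scaled_rem cos_remS exprMn doubleS !exprS; field.
  by rewrite expf_neq0// sn/= pnatr_eq0 -lt0n fact_gt0.
rewrite normrN ger0_norm; last first.
  have sV : 0 <= s ^- K.+1.*2 by rewrite invr_ge0 exprn_ge0// ltW.
  by rewrite mulr_ge0 ?sqr_ge0// mulr_ge0// cos_rem_ge0.
by rewrite ler_wpM2l ?sqr_ge0// scaled_rem_le.
Qed.

Let s_ (N : nat) : R := del / N.+1%:R.

Let s_gt0 N : 0 < s_ N.
Proof. by rewrite divr_gt0. Qed.

Let s_le N : s_ N <= del.
Proof. by rewrite ler_pdivrMr// ler_peMr ?(ltW del0)// ler1n. Qed.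

Let cvg_s : s_ N @[N --> \oo] --> 0.
Proof.
rewrite -[X in _ --> X](mulr0 del); apply: cvgM; first exact: cvg_cst.
exact: cvg_harmonic.
Qed.

Let cvg_s2 : s_ N ^+ 2 @[N --> \oo] --> 0.
Proof.
by have h := cvgM cvg_s cvg_s; rewrite mulr0 in h; exact: h.
Qed.

(* Divide [cos_rem K (s * y)], which is nonnegative, by [s ^+ K.*2] and let s tend to 0. *)
Lemma even_moment K :
  (\int[mu]_y (y ^+ K.*2)%:E = ((-1) ^+ K * c K * (K.*2)`!%:R)%:E)%E.
Proof.
have [n] := ubnP K; elim: n K => // n IH [_|K].
  under eq_integral do rewrite expr0.
  rewrite integral_cst// mul1e [LHS](_ : _ = 1%E); last exact: probability_setT.
  rewrite expr0 mul1r mulr1.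
  rewrite /c /exp_poly_coef /exp_poly big_ord_recl big_ord0 addr0 expr0.
  by rewrite coefZ coef1 /= invr1 mulr1.
rewrite ltnS => Kn; set K' := K.+1.
pose a k := (-1) ^+ k * c k * (k.*2)`!%:R.
have momi k : (k < K')%N -> mu.-integrable setT (EFin \o (fun y => y ^+ k.*2)).
  move=> kK; apply/integrableP; split.
    by apply/measurable_EFinP; exact: measurable_funX.
  under eq_integral => y _.
    rewrite /= ger0_norm; last by rewrite -mul2n exprM exprn_ge0// sqr_ge0.
    over.
  by rewrite IH ?ltry// (leq_trans kK).
have momE k : (k < K')%N -> \int[mu]_y y ^+ k.*2 = a k.
  by move=> kK; rewrite /Rintegral IH// (leq_trans kK).
(* The integral of the scaled remainder: the known lower moments remove the first K' Taylor terms of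
   e^{Q(s^2)}. *)
pose b N := s_ N ^- K'.*2 * (-1) ^+ K' *
  (expR Q.[s_ N ^+ 2] - \sum_(k < K') c k * (s_ N ^+ 2) ^+ k).
have remi N : mu.-integrable setT (EFin \o scaled_rem K' (s_ N)).
  have h := @integrableD _ _ _ mu _ measurableT _ _
    (@integrableZl _ _ _ mu _ measurableT (s_ N ^- K'.*2 * (-1) ^+ K') _ (integrable_cosM (s_ N)))
    (@integrableZl _ _ _ mu _ measurableT (- (s_ N ^- K'.*2 * (-1) ^+ K')) _
      (integrable_sum_real (fun k => (-1) ^+ k / (k.*2)`!%:R * s_ N ^+ k.*2) momi)).
  by apply: eq_integrable h => // y _; rewrite /= scaled_remE.
have remE N : (\int[mu]_y (scaled_rem K' (s_ N) y)%:E = (b N)%:E)%E.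
  rewrite -[LHS]fineK; last exact: (@integrable_fin_num _ _ _ mu _ measurableT _ (remi N)).
  congr EFin.
  transitivity (\int[mu]_y ((s_ N ^- K'.*2 * (-1) ^+ K') * cos (s_ N * y) +
      - (s_ N ^- K'.*2 * (-1) ^+ K') *
      \sum_(k < K') ((-1) ^+ k / (k.*2)`!%:R * s_ N ^+ k.*2) * y ^+ k.*2)).
    by apply: eq_Rintegral => y _; exact: scaled_remE.
  rewrite Rintegral_linear; [|exact: integrable_cosM|exact:
    (integrable_sum_real (fun k => (-1) ^+ k / (k.*2)`!%:R * s_ N ^+ k.*2) momi)].
  rewrite cosE ?s_gt0 ?s_le//.
  rewrite (Rintegral_sum (fun k => (-1) ^+ k / (k.*2)`!%:R * s_ N ^+ k.*2) momi).
  rewrite /b mulrBr mulNr; congr (_ - _ * _); apply: eq_bigr => k _.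
  rewrite momE// /a -exprM mul2n.
  have s1 : (-1) ^+ k * (-1) ^+ k = 1 :> R by rewrite -exprMn mulrNN mulr1 expr1n.
  have f0 : (k.*2)`!%:R != 0 :> R by rewrite pnatr_eq0 -lt0n fact_gt0.
  transitivity (((-1) ^+ k * (-1) ^+ k) * c k * s_ N ^+ k.*2); first by field.
  by rewrite s1 mul1r.
(* After division by s^{2K'} the next Taylor term remains, with an error O(s^2); the tail estimate
   applies because s^2 <= 1. *)
have cvg_b : b @ \oo --> (-1) ^+ K' * c K'.
  apply/subr_cvg0/norm_cvg0P.
  have cB : (s_ N ^+ 2 * expR (abs_poly Q).[1]) @[N --> \oo] --> 0 * expR (abs_poly Q).[1].
    by apply: cvgM; [exact: cvg_s2|exact: cvg_cst].
  rewrite mul0r in cB.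
  apply: (squeeze_cvgr _ (cvg_cst 0) cB); apply: nearW => N; rewrite normr_ge0/=.
  have s0 := s_gt0 N; have sn : s_ N != 0 by rewrite gt_eqF.
  have -> : b N - (-1) ^+ K' * c K' = s_ N ^- K'.*2 * (-1) ^+ K' *
      (expR Q.[s_ N ^+ 2] - \sum_(k < K'.+1) c k * (s_ N ^+ 2) ^+ k).
    have -> : \sum_(k < K'.+1) c k * (s_ N ^+ 2) ^+ k =
        \sum_(k < K') c k * (s_ N ^+ 2) ^+ k + c K' * s_ N ^+ K'.*2.
      by rewrite [LHS]big_ord_recr /= -exprM mul2n.
    by rewrite /b; field; rewrite expf_neq0.
  rewrite 2!normrM normrX normrN1 expr1n mulr1 ger0_norm ?invr_ge0 ?exprn_ge0 ?(ltW s0)//.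
  rewrite mulrC ler_pdivrMr ?exprn_gt0//.
  have s01 : 0 <= s_ N ^+ 2 <= 1.
    by rewrite sqr_ge0/= exprn_ile1// ?(ltW s0)// (le_trans (s_le N)).
  rewrite (le_trans (exp_poly_tail K'.+1 Q0 s01))// -exprM mul2n doubleS !exprS.
  rewrite le_eqVlt; apply/orP; left; apply/eqP; ring.
have rem_ge0 N y : 0 <= scaled_rem K' (s_ N) y.
  have sV : 0 <= s_ N ^- K'.*2 by rewrite invr_ge0 exprn_ge0// ltW.
  by rewrite mulr_ge0// cos_rem_ge0.
have f0 : 0 < (K'.*2)`!%:R :> R by rewrite ltr0n fact_gt0.
have mE : (\int[mu]_y (y ^+ K'.*2)%:E =
    (K'.*2)`!%:R%:E * \int[mu]_y (y ^+ K'.*2 / (K'.*2)`!%:R)%:E)%E.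
  rewrite -ge0_integralZl_EFin ?ler0n//.
  - by apply: eq_integral => y _; rewrite -EFinM mulrCA divff ?gt_eqF// mulr1.
  - by move=> y _; rewrite lee_fin divr_ge0// -mul2n exprM exprn_ge0// sqr_ge0.
  - by apply/measurable_EFinP; apply: measurable_funM => //; exact: measurable_funX.
suff h : (\int[mu]_y (y ^+ K'.*2 / (K'.*2)`!%:R)%:E = ((-1) ^+ K' * c K')%:E)%E.
  by rewrite mE h -EFinM mulrC.
have m1 : measurable_fun setT (fun y : R => y ^+ K'.*2 / (K'.*2)`!%:R).
  by apply: measurable_funM => //; exact: measurable_funX.
(* Fatou's lemma gives this direction and with it finiteness; the other one follows since each
   scaled remainder lies below its limit y^{2K'} / (2K')!. *)
have le1 : (\int[mu]_y (y ^+ K'.*2 / (K'.*2)`!%:R)%:E <= ((-1) ^+ K' * c K')%:E)%E.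
  apply: (@fatou_bound _ _ _ mu (fun N => scaled_rem K' (s_ N)) _ b) => //.

  - move=> y; apply/subr_cvg0/norm_cvg0P.
    have cB : (s_ N ^+ 2 * (y ^+ K'.+1.*2 / (K'.+1.*2)`!%:R)) @[N --> \oo] -->
        0 * (y ^+ K'.+1.*2 / (K'.+1.*2)`!%:R).
      by apply: cvgM; [exact: cvg_s2|exact: cvg_cst].
    rewrite mul0r in cB.
    apply: (squeeze_cvgr _ (cvg_cst 0) cB); apply: nearW => N; rewrite normr_ge0/=.
    exact: scaled_rem_dist.
  - by move=> N; rewrite remE.
apply/eqP; rewrite eq_le le1/=.
have fin1 : (\int[mu]_y (y ^+ K'.*2 / (K'.*2)`!%:R)%:E)%E \is a fin_num.
  rewrite ge0_fin_numE; first exact: le_lt_trans le1 (ltry _).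
  apply: integral_ge0 => y _.
  by rewrite lee_fin divr_ge0// -mul2n exprM exprn_ge0// sqr_ge0.
rewrite -(fineK fin1) lee_fin.
apply: (ler_cvg_seq (N := 0%N) cvg_b (cvg_cst _)) => N _.
rewrite -lee_fin -remE fineK//; apply: ge0_le_integral => //.
- by move=> y _; rewrite lee_fin rem_ge0.
- by apply/measurable_EFinP; exact: measurable_scaled_rem.
- by apply/measurable_EFinP.
- by move=> y _; rewrite lee_fin scaled_rem_le.
Qed.

End EvenMoments.

Lemma sum_even_part (F : fieldType) (m : nat -> F) (z : F) N :
  \sum_(k < N.*2) m k * (z ^+ k + (- z) ^+ k) =
  \sum_(k < N) (2 * m k.*2) * z ^+ k.*2.
Proof.
elim: N => [|N IH]; first by rewrite !big_ord0.
rewrite doubleS !big_ord_recr /= IH -addrA; congr (_ + _).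
have e : (-1) ^+ N.*2 = 1 :> F by rewrite -signr_odd odd_double.
rewrite [(- z) ^+ N.*2.+1]exprNn [(- z) ^+ N.*2]exprNn [(-1) ^+ N.*2.+1]exprS e.
ring.
Qed.

Lemma mgf0 (R : realType) (nu : probability R R) : mgf nu 0 = 1%E.
Proof.
rewrite /mgf; under eq_integral do rewrite mul0r expR0.
by rewrite integral_cst// mul1e; exact: probability_setT.
Qed.

Lemma eq_mgf (R : realType) (nu1 nu2 : probability R R) t :
  (forall A, measurable A -> nu1 A = nu2 A) -> mgf nu1 t = mgf nu2 t.
Proof. by move=> e; apply: eq_measure_integral => A mA _; exact: e. Qed.

Lemma eq_cmgf (R : realType) (nu1 nu2 : probability R R) z :
  (forall A, measurable A -> nu1 A = nu2 A) -> cmgf nu1 z = cmgf nu2 z.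
Proof.
move=> e; rewrite /cmgf /integralC /Rintegral.
by congr (fine _ +i* fine _); apply: eq_measure_integral => A mA _; exact: e.
Qed.

(** * Summation of the even moments *)

Section EvenMomentsMgf.
Variables (R : realType) (mu : probability R R) (Q : {poly R}).
Hypothesis Q0 : Q`_0 = 0.
Let c := exp_poly_coef Q.
Hypothesis momE : forall K,
  (\int[mu]_y (y ^+ K.*2)%:E = ((-1) ^+ K * c K * (K.*2)`!%:R)%:E)%E.

Let even_ge0 (y : R) k : 0 <= y ^+ k.*2.
Proof. by rewrite -mul2n exprM exprn_ge0// sqr_ge0. Qed.

Let fact0 k : (k`!%:R : R) != 0.
Proof. by rewrite pnatr_eq0 -lt0n fact_gt0. Qed.

Let momi k : mu.-integrable setT (EFin \o (fun y => y ^+ k.*2)).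
Proof.
apply/integrableP; split; first by apply/measurable_EFinP; exact: measurable_funX.
under eq_integral do rewrite /= ger0_norm ?even_ge0//.
by rewrite momE ltry.
Qed.

(** Odd moments are not under control, so e^{ty} is replaced by 2 cosh(ty), whose truncations
    involve even powers with nonnegative coefficients; Fatou's lemma passes to the limit. *)
Lemma mgf_even_moments t : (mgf mu t <= (2 * expR (abs_poly Q).[t ^+ 2])%:E)%E.
Proof.
pose a k : R := 2 * (k.*2)`!%:R^-1 * t ^+ k.*2.
pose f_ N (y : R) := \sum_(k < N) a k * y ^+ k.*2.
pose B := 2 * expR (abs_poly Q).[t ^+ 2].
have f_E N y : f_ N y = etrunc N.*2 (t * y) + etrunc N.*2 (- (t * y)).
  rewrite /etrunc -big_split /=.
  under [RHS]eq_bigr do rewrite -mulrDl mulrC.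
  rewrite (sum_even_part (fun k => k`!%:R^-1)); apply: eq_bigr => k _.
  by rewrite /a exprMn mulrA.
have f_i N : mu.-integrable setT (EFin \o f_ N).
  exact: (integrable_sum_real a (fun k _ => momi k)).
have mf_ N : measurable_fun setT (f_ N).
  by apply/measurable_EFinP; exact: measurable_int (f_i N).
have f_ge0 N y : 0 <= f_ N y.
  by apply: sumr_ge0 => k _; rewrite /a !mulr_ge0 ?even_ge0// invr_ge0.
have f_int N : (\int[mu]_y (f_ N y)%:E <= B%:E)%E.
  rewrite -[leLHS]fineK; last exact: (@integrable_fin_num _ _ _ mu _ measurableT _ (f_i N)).
  rewrite lee_fin -[leLHS]/(\int[mu]_y f_ N y).
  rewrite (Rintegral_sum a (fun k _ => momi k)).
  apply: (@le_trans _ _ (2 * \sum_(k < N) `|c k| * (t ^+ 2) ^+ k)).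
    rewrite mulr_sumr ler_sum// => k _.
    rewrite /Rintegral momE /= /a -exprM mul2n.
    have -> : 2 * (k.*2)`!%:R^-1 * t ^+ k.*2 * ((-1) ^+ k * c k * (k.*2)`!%:R) =
      2 * (((-1) ^+ k * c k) * t ^+ k.*2) by field; exact: fact0.
    rewrite ler_wpM2l// ler_wpM2r ?even_ge0// (le_trans (ler_norm _))//.
    by rewrite normrM normrX normrN1 expr1n mul1r.
  by rewrite ler_wpM2l// sum_abs_exp_poly_coef ?sqr_ge0.
apply: (@le_trans _ _ (\int[mu]_y (expR (t * y) + expR (- (t * y)))%:E)%E).
  apply: ge0_le_integral => //.
  - by apply/measurable_EFinP; exact: measurable_expM.
  - apply/measurable_EFinP; apply: measurable_funD; first exact: measurable_expM.
    by under eq_fun do rewrite -mulNr; exact: measurable_expM.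
  - by move=> y _; rewrite lee_fin lerDl expR_ge0.
apply: (@fatou_bound _ _ _ mu f_ _ (fun=> B)) => //; last exact: cvg_cst.
move=> y; under eq_fun do rewrite f_E.
have cvg2 x : etrunc N.*2 x @[N --> \oo] --> expR x.
  apply: (@cvg_comp _ _ _ double (fun N => etrunc N x) \oo \oo); last exact: cvg_etrunc.
  by move=> A [N _ NA]; exists N => // n /= Nn; apply: NA => /=; rewrite (leq_trans Nn)// -addnn leq_addl.
by apply: cvgD; exact: cvg2.
Qed.

(** The value at -z cancels the odd moments. The argument -z^2 equals s^2 for z = is, so this
    continues e^{Q(s^2)} to the whole plane. *)
Lemma cmgf_even_moments z :
  cmgf mu z + cmgf mu (- z) = 2 * cexp (Q^:C.[- z ^+ 2]).
Proof.
have mu_mgf : has_mgf mu.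
  by move=> t; exact: le_lt_trans (mgf_even_moments t) (ltry _).
pose u N : R[i] := \sum_(k < N.*2) (mcoef mu k)%:C * (z ^+ k + (- z) ^+ k).
have cvg2 (f : nat -> R) : f N @[N --> \oo] --> 0 -> f N.*2 @[N --> \oo] --> 0.
  move=> f0; apply: (@cvg_comp _ _ _ double f \oo \oo); last exact: f0.
  by move=> A [N _ NA]; exists N => // n /= Nn; apply: NA => /=; rewrite (leq_trans Nn)// -addnn leq_addl.
apply: (@nc_lim_uniq _ u).
  have h : 2 * nc (\sum_(k < N) (c k)%:C * (- z ^+ 2) ^+ k - cexp (Q^:C.[- z ^+ 2]))
      @[N --> \oo] --> (2 * 0 : R).
    by apply: cvgM; [exact: cvg_cst|exact: cvg_exp_poly_series].
  rewrite mulr0 in h; apply: cvg_trans h; apply: near_eq_cvg; apply: nearW => N.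
  rewrite /u (sum_even_part (fun k => (mcoef mu k)%:C)).
  have -> : \sum_(k < N) 2 * (mcoef mu k.*2)%:C * z ^+ k.*2 =
      2 * \sum_(k < N) (c k)%:C * (- z ^+ 2) ^+ k.
    rewrite mulr_sumr; apply: eq_bigr => k _.
    rewrite /mcoef /Rintegral momE /= mulfK ?fact0//.
    rewrite [(- z ^+ 2) ^+ k]exprNn -exprM mul2n rmorphM rmorphXn rmorphN rmorph1; ring.
  by rewrite -mulrBr ncM nc_nat.
have h1 := cvg2 _ (cvg_cmgf_series mu_mgf z).
have h2 := cvg2 _ (cvg_cmgf_series mu_mgf (- z)).
have h : (nc (\sum_(k < N.*2) (mcoef mu k)%:C * z ^+ k - cmgf mu z) +
    nc (\sum_(k < N.*2) (mcoef mu k)%:C * (- z) ^+ k - cmgf mu (- z)))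
    @[N --> \oo] --> (0 + 0 : R) by exact: cvgD.
rewrite addr0 in h; apply: (squeeze_cvgr _ (cvg_cst 0) h); apply: nearW => N; rewrite nc_ge0/=.
rewrite (_ : u N - _ =
  (\sum_(k < N.*2) (mcoef mu k)%:C * z ^+ k - cmgf mu z) +
  (\sum_(k < N.*2) (mcoef mu k)%:C * (- z) ^+ k - cmgf mu (- z))) ?ncD//.
rewrite /u; under eq_bigr do rewrite mulrDr.
rewrite big_split /=; ring.
Qed.

End EvenMomentsMgf.

(** * The law of the difference of two independent copies *)

Section Symmetrization.
Variables (R : realType) (nu : probability R R).
Let PP : probability (R * R)%type R := (nu \x nu)%E.

Let X1 : {mfun (R * R)%type >-> R} := mk_mfun (@measurable_fst _ _ R R).

Let measurable_oppsnd : measurable_fun setT (fun p : R * R => - p.2).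
Proof. by apply: measurableT_comp => //; exact: measurable_snd. Qed.

Let X2 : {mfun (R * R)%type >-> R} := mk_mfun measurable_oppsnd.

Let measurable_diff : measurable_fun setT (fun p : R * R => p.1 - p.2).
Proof. by apply: measurable_funB; [exact: measurable_fst|exact: measurable_snd]. Qed.

Let Y : {mfun (R * R)%type >-> R} := mk_mfun measurable_diff.

Definition symm : probability R R := distribution PP Y.

Let opp_rv : {mfun R >-> R} := mk_mfun (@oppr_measurable R setT).

Let measurable_opp A : measurable A -> measurable ((-%R : R -> R) @^-1` A).
Proof. by move=> mA; rewrite -[X in measurable X]setTI; exact: oppr_measurable. Qed.

Let law1 A : measurable A -> distribution PP X1 A = nu A.
Proof.
move=> mA; rewrite /distribution /pushforward.
rewrite (_ : X1 @^-1` A = A `*` setT); last by apply/seteqP; split => p //= [].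
rewrite [LHS]product_measure1E// [X in (_ * X)%E](_ : _ = 1%E) ?mule1//.
exact: probability_setT.
Qed.

Let law2 A : measurable A -> distribution PP X2 A = distribution nu opp_rv A.
Proof.
move=> mA; rewrite /distribution /pushforward.
rewrite (_ : X2 @^-1` A = setT `*` (-%R @^-1` A)); last by apply/seteqP; split => p //= [].
rewrite [LHS]product_measure1E//; last exact: measurable_opp.
rewrite [X in (X * _)%E](_ : _ = 1%E) ?mul1e//.
exact: probability_setT.
Qed.

Let X12 : indep2 PP X1 X2.
Proof.
move=> A B mA mB.
have e1 : PP (X1 @^-1` A) = nu A by exact: law1.
have e2 : PP (X2 @^-1` B) = nu (-%R @^-1` B) by exact: law2.
rewrite e1 e2 (_ : _ `&` _ = A `*` (-%R @^-1` B)).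
  by rewrite [LHS]product_measure1E//; exact: measurable_opp.
by apply/seteqP; split => p.
Qed.

Let mgf_law2 t : mgf (distribution PP X2) t = mgf nu (- t).
Proof.
rewrite (eq_mgf _ law2) mgf_distribution; apply: eq_integral => x _ /=.
by rewrite mulrN mulNr.
Qed.

Lemma mgf_symm t : mgf symm t = (mgf nu t * mgf nu (- t))%E.
Proof.
rewrite -(eq_mgf t law1) -mgf_law2 -(mgf_indep2 t X12) mgf_distribution.
by [].
Qed.

Lemma cmgf_symm z : (mgf nu (complex.Re z) < +oo)%E ->
  (mgf nu (- complex.Re z) < +oo)%E ->
  cmgf symm z = cmgf nu z * cmgf nu (- z).
Proof.
move=> h1 h2.
have -> : cmgf nu (- z) = cmgf (distribution PP X2) z.
  rewrite (eq_cmgf _ law2) cmgf_distribution.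
    by congr (integralC nu _); apply/funext => x /=; rewrite rmorphN mulrN mulNr.
  by rewrite -(eq_mgf _ law2) mgf_law2.
rewrite -(eq_cmgf z law1) -(cmgf_indep2 X12).
- have sf : (mgf symm (complex.Re z) < +oo)%E.
    by rewrite mgf_symm lte_mul_pinfty ?mgf_ge0// ge0_fin_numE ?mgf_ge0.
  by rewrite (cmgf_distribution sf).
- by rewrite (eq_mgf _ law1).
- by rewrite mgf_law2.
Qed.

Let integrable_trig (f : R -> R) : measurable_fun setT f ->
  (forall x, `|f x| <= 1) -> nu.-integrable setT (EFin \o f).
Proof.
move=> mf f1; apply: (@le_integrable_real _ _ _ _ _ (cst 1)) => //.
exact: finite_measure_integrable_cst.
Qed.

Lemma cmgf_imag (mu : probability R R) s : cmgf mu ('i * s%:C) =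
  (\int[mu]_x cos (s * x)) +i* (\int[mu]_x sin (s * x)).
Proof.
by rewrite /cmgf /integralC; congr (_ +i* _); apply: eq_Rintegral => x _;
  rewrite -mulrA -rmorphM cexp_imag.
Qed.

Lemma cos_symm s : \int[symm]_y cos (s * y) = nc (cmgf nu ('i * s%:C)) ^+ 2.
Proof.
have Re0 x : complex.Re ('i * x%:C : R[i]) = 0 by rewrite /= mul0r mulr0 subr0.
have fin0 : (mgf nu 0 < +oo)%E by rewrite mgf0 ltry.
have -> : \int[symm]_y cos (s * y) = complex.Re (cmgf symm ('i * s%:C)).
  by rewrite cmgf_imag.
rewrite cmgf_symm ?Re0 ?oppr0// -mulrN -rmorphN !cmgf_imag sqr_nc cReM /=.
have -> : \int[nu]_x cos (- s * x) = \int[nu]_x cos (s * x).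
  by apply: eq_Rintegral => x _; rewrite mulNr cosN.
have -> : \int[nu]_x sin (- s * x) = - \int[nu]_x sin (s * x).
  rewrite -[RHS]mulN1r -RintegralZl//.
    by apply: eq_Rintegral => x _; rewrite mulNr sinN mulN1r.
  by apply: integrable_trig; [exact: measurable_sinM|move=> x; exact: sin_max].
by rewrite mulrN opprK !expr2.
Qed.

End Symmetrization.

(** The upper bound is required on the real axis only; the ridge property extends it to the plane.
    The lower bound is required everywhere and excludes zeros. *)
Definition tempered (R : realType) (nu : probability R R) := exists (C : R) (D : nat),
  [/\ 0 <= C, forall t, (mgf nu t <= (expR (C * (1 + `|t|) ^+ D))%:E)%E &
      forall z, expR (- (C * (1 + nc z) ^+ D)) <= nc (cmgf nu z)].

Lemma abs_poly_growth (R : realType) (Q : {poly R}) x : 0 <= x ->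
  (abs_poly Q).[x ^+ 2] <= (abs_poly Q).[1] * (1 + x) ^+ (size Q).*2.
Proof.
move=> x0; rewrite !(@horner_coef_wide _ (size Q)) ?size_poly// mulr_suml ler_sum// => i _.
rewrite coef_abs_poly expr1n mulr1 ler_wpM2l// -exprM mul2n.
apply: (@le_trans _ _ ((1 + x) ^+ i.*2)).
  by rewrite lerXn2r ?nnegrE ?addr_ge0// lerDr.
by rewrite ler_weXn2l ?lerDl// leq_double ltnW.
Qed.

(** The even moments bound E e^{tZ} E e^{-tZ} from above, and division by the universal lower bound
    for the second factor gives the upper bound. Conversely E e^{zZ} E e^{-zZ} = exp Q(-z^2) is
    bounded below, and division by the upper bound for its second factor gives the lower bound. *)
Lemma symm_tempered (R : realType) (nu : probability R R) (Q : {poly R}) del :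
  Q`_0 = 0 -> 0 < del ->
  (forall s, 0 < s <= del -> nc (cmgf nu ('i * s%:C)) ^+ 2 = expR Q.[s ^+ 2]) ->
  tempered nu.
Proof.
(* The interval is shortened to length at most 1, as the moment computation requires. *)
move=> Q0 del0 nuQ; pose del' := Num.min del 1.
have d'0 : 0 < del' by rewrite lt_min del0 ltr01.
have d'1 : del' <= 1 by rewrite ge_min lexx orbT.
have cosE s : 0 < s <= del' -> \int[symm nu]_y cos (s * y) = expR Q.[s ^+ 2].
  move=> /andP[s0 sd]; rewrite cos_symm nuQ// s0/=.
  by rewrite (le_trans sd)// ge_min lexx.
have momE := even_moment Q0 d'0 d'1 cosE.
have [c c0 cP] := mgf_lower_bound nu.
pose A := (abs_poly Q).[1]; have A0 : 0 <= A by rewrite abs_poly_ge0.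
(* Large enough for both the growth of Q at r^2 and the linear exponent of the universal lower
   bound. *)
pose D := (size Q).*2.+1.
(* The summand 1 absorbs the factor 2 of the even moment bound, since 2 <= e. *)
pose C1 := 1 + A + c; pose C := C1 + A.
have C10 : 0 <= C1 by rewrite !addr_ge0.
have pow_le (r : R) : 0 <= r -> [/\ 1 <= (1 + r) ^+ D, 1 + r <= (1 + r) ^+ D &
    (1 + r) ^+ (size Q).*2 <= (1 + r) ^+ D].
  move=> r0; have r1 : 1 <= 1 + r by rewrite lerDl.
  by split; rewrite ?exprn_ege1// ?ler_eXnr// ler_weXn2l.
have Qle (r : R) : 0 <= r -> (abs_poly Q).[r ^+ 2] <= A * (1 + r) ^+ D.
  move=> r0; have [_ _ h] := pow_le r r0.
  by rewrite (le_trans (abs_poly_growth _ r0))// ler_wpM2l.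
have mgf_le t : (mgf nu t <= (expR (C1 * (1 + `|t|) ^+ D))%:E)%E.
  have h1 := mgf_even_moments Q0 momE t; rewrite mgf_symm in h1.
  have h2 := cP (- t); rewrite normrN in h2.
  have h3 : (mgf nu t * (expR (- (c * (1 + `|t|))))%:E <=
      (2 * expR (abs_poly Q).[t ^+ 2])%:E)%E.
    by rewrite (le_trans _ h1)// lee_wpmul2l ?mgf_ge0.
  rewrite -lee_pdivlMr ?expR_gt0// in h3.
  rewrite (le_trans h3)// -EFinM lee_fin -expRN opprK.
  apply: (@le_trans _ _ (expR 1 * expR (abs_poly Q).[t ^+ 2] * expR (c * (1 + `|t|)))).
    rewrite ler_wpM2r ?expR_ge0// ler_wpM2r ?expR_ge0//.
    by have := expR_ge1Dx (1 : R); lra.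
  rewrite -!expRD ler_expR.
  have [p1 p2 _] := pow_le _ (normr_ge0 t).
  have := Qle _ (normr_ge0 t); rewrite real_normK ?num_real//.
  have := ler_wpM2l c0 p2.
  by rewrite /C1 !mulrDl mul1r; lra.
have nu_mgf : has_mgf nu by move=> t; exact: le_lt_trans (mgf_le t) (ltry _).
exists C, D; split.
- by rewrite addr_ge0.
- move=> t; rewrite (le_trans (mgf_le t))// lee_fin ler_expR ler_wpM2r ?exprn_ge0 ?addr_ge0//.
  by rewrite lerDl.
move=> z; have z0 := nc_ge0 z.
have fz w : (mgf nu (complex.Re w) < +oo)%E by exact: nu_mgf.
have symmE : cmgf (symm nu) z = cexp (Q^:C.[- z ^+ 2]).
  have h := cmgf_even_moments Q0 momE z.
  have e : cmgf (symm nu) (- z) = cmgf (symm nu) z.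
    rewrite !cmgf_symm ?opprK 1?mulrC//; exact: nu_mgf.
  have two : (2 : R[i]) != 0 by rewrite pnatr_eq0.
  by apply: (mulfI two); rewrite -h e; ring.
have low : expR (- (A * (1 + nc z) ^+ D)) <= nc (cmgf nu z) * nc (cmgf nu (- z)).
  rewrite -ncM -cmgf_symm; [|exact: nu_mgf|exact: nu_mgf].
  rewrite symmE nc_cexp ler_expR lerNl.
  apply: le_trans (Qle _ z0); rewrite -cReN (le_trans (ler_norm _))//.
  rewrite (le_trans (normr_Re_le _))// ncN (le_trans (nc_horner_le _ _))//.
  by rewrite ncN ncX.
have up : nc (cmgf nu (- z)) <= expR (C1 * (1 + nc z) ^+ D).
  rewrite (le_trans (nc_cmgf_le nu_mgf _))// -lee_fin fineK; last first.
    by rewrite ge0_fin_numE ?mgf_ge0.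
  rewrite (le_trans (mgf_le _))// lee_fin ler_expR ler_wpM2l//.
  rewrite lerXn2r ?nnegrE ?addr_ge0// lerD2l cReN normrN.
  exact: normr_Re_le.
rewrite -(@ler_pM2r _ (expR (C1 * (1 + nc z) ^+ D))) ?expR_gt0// -expRD.
have -> : - (C * (1 + nc z) ^+ D) + C1 * (1 + nc z) ^+ D = - (A * (1 + nc z) ^+ D).
  by rewrite /C; ring.
by rewrite (le_trans low)// ler_wpM2l ?nc_ge0.
Qed.

(** * Gaussian laws *)

Section TemperedQuadratic.
Variables (R : realType) (nu : probability R R).

Lemma tempered_has_mgf : tempered nu -> has_mgf nu.
Proof.
by move=> [C [D [_ h _]]] t; exact: le_lt_trans (h t) (ltry _).
Qed.

Lemma tempered_quadratic : tempered nu -> exists g1 g2 : R, 0 <= g2 /\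
  forall t, mgf nu t = (expR (g1 * t + g2 * t ^+ 2))%:E.
Proof.
move=> tnu; have nu_mgf := tempered_has_mgf tnu.
have [C [D [C0 mgf_le low]]] := tnu.
have fin t : mgf nu t \is a fin_num by rewrite ge0_fin_numE ?mgf_ge0.
have up z : nc (cmgf nu z) <= expR (C * (1 + nc z) ^+ D).
  rewrite (le_trans (nc_cmgf_le nu_mgf z))// -lee_fin fineK//.
  rewrite (le_trans (mgf_le _))// lee_fin ler_expR ler_wpM2l//.
  by rewrite lerXn2r ?nnegrE ?addr_ge0 ?nc_ge0// lerD2l normr_Re_le.
have m0 : (mcoef nu 0)%:C = 1 :> R[i] by rewrite mcoef0.
have [a aE] := log_entire_poly (M := cmgf nu) (m := fun k => (mcoef nu k)%:C)
  (tau := mgf_tail nu) m0 C0 (fun N z r => cmgf_series nu_mgf N)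
  (fun r r0 => cvg_mgf_tail nu_mgf r0) low up.
have pos z : 0 < nc (cmgf nu z) by exact: lt_le_trans (expR_gt0 _) (low z).
have ncr t : nc (cmgf nu t%:C) = fine (mgf nu t).
  by rewrite cmgf_real nc_real ger0_norm// fine_ge0// mgf_ge0.
have u0 : ln (nc (cmgf nu 0)) = 0.
  by rewrite -(rmorph0 (real_complex R)) ncr mgf0 ln1.
have uRe z : ln (nc (cmgf nu z)) <= ln (nc (cmgf nu (complex.Re z)%:C)).
  by rewrite ler_ln ?posrE// ncr nc_cmgf_le.
have [g1 [g2 [g20 gE]]] := radial_max_quadratic aE u0 uRe.
exists g1, g2; split => // t.
rewrite -gE ncr lnK ?fineK// posrE -ncr; exact: pos.
Qed.

End TemperedQuadratic.

(** * Uniqueness from the moment generating function *)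

Section MgfUnique.
Variable R : realType.

(** Once the earlier coefficients vanish, division by t^k isolates [d k]. The coefficients being
    bounded, the remaining terms contribute at most 2 B t for t <= 1/2, and t is arbitrarily
    small. *)
Lemma power_series_unique (d : nat -> R) (B : R) :
  (forall k, `|d k| <= B) ->
  (forall t : R, 0 < t <= 2^-1 -> \sum_(k < N) d k * t ^+ k @[N --> \oo] --> 0) ->
  forall k, d k = 0.
Proof.
move=> dB d0 k; have [n] := ubnP k; elim: n k => // n IH k; rewrite ltnS => kn.
have B0 : 0 <= B by exact: le_trans (normr_ge0 _) (dB 0%N).
apply/eqP; rewrite -normr_le0; apply/ler_addgt0Pl => e e0; rewrite addr0.
pose t : R := Num.min 2^-1 (e / (2 * B + 1)).
have B1 : 0 < 2 * B + 1 by lra.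
have t0 : 0 < t by rewrite lt_min invr_gt0 ltr0n/= divr_gt0.
have t2 : t <= 2^-1 by rewrite ge_min lexx.
have te : t * (2 * B + 1) <= e by rewrite -ler_pdivlMr// ge_min lexx orbT.
have t01 : 0 < t <= 2^-1 by rewrite t0.
apply: le_trans te.
have cv : (`|\sum_(k < N) d k * t ^+ k| / t ^+ k + 2 * B * t) @[N --> \oo] -->
    (0 : R) / t ^+ k + 2 * B * t.
  apply: cvgD; last exact: cvg_cst.
  apply: cvgM; last exact: cvg_cst.
  by apply/norm_cvg0P; exact: d0.
rewrite mul0r add0r in cv.
apply: (@le_trans _ _ (2 * B * t)); last by lra.
apply: (ler_cvg_seq (N := k.+1) (cvg_cst _) cv) => N kN.
rewrite -lerBlDr ler_pdivlMr ?exprn_gt0//.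
have E : \sum_(i < N) d i * t ^+ i = d k * t ^+ k +
    \sum_(i < N - k.+1) d (k.+1 + i)%N * t ^+ (k.+1 + i).
  have [M NE] : exists M, N = (k.+1 + M)%N by exists (N - k.+1)%N; rewrite subnKC.
  rewrite NE addKn big_split_ord /=; congr (_ + _).
  rewrite big_ord_recr /= big1 ?add0r// => i _.
  by rewrite IH ?mul0r// (leq_trans _ kn).
have rest : `|\sum_(i < N - k.+1) d (k.+1 + i)%N * t ^+ (k.+1 + i)| <=
    2 * B * t ^+ k.+1.
  rewrite (le_trans (ler_norm_sum _ _ _))//.
  apply: (@le_trans _ _ (\sum_(i < N - k.+1) B * t ^+ k.+1 * 2^-1 ^+ i)).
    apply: ler_sum => i _; rewrite normrM exprD -mulrA ler_pM//.
    have t0' := ltW t0.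
    rewrite ger0_norm ?mulr_ge0 ?exprn_ge0// ler_wpM2l ?exprn_ge0//.
    by rewrite lerXn2r ?nnegrE.
  rewrite -mulr_sumr.
  have := @subrX1 R 2^-1 (N - k.+1); set S := \sum_(i < _) _ => SE.
  have h : 0 <= 2^-1 ^+ (N - k.+1) :> R by rewrite exprn_ge0.
  have S2 : S <= 2 by lra.
  have Bt : 0 <= B * t ^+ k.+1 by rewrite mulr_ge0// exprn_ge0// ltW.
  by have := ler_wpM2l Bt S2; lra.
have dk : `|d k| * t ^+ k = `|d k * t ^+ k|.
  by rewrite normrM [`|t ^+ k|]ger0_norm// exprn_ge0// ltW.
have -> : (`|d k| - 2 * B * t) * t ^+ k = `|d k * t ^+ k| - 2 * B * t ^+ k.+1.
  by rewrite -dk exprS; ring.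
have -> : d k * t ^+ k = \sum_(i < N) d i * t ^+ i -
    \sum_(i < N - k.+1) d (k.+1 + i)%N * t ^+ (k.+1 + i) by rewrite E addrK.
by have := ler_normB (\sum_(i < N) d i * t ^+ i)
  (\sum_(i < N - k.+1) d (k.+1 + i)%N * t ^+ (k.+1 + i)); lra.
Qed.

(** From |x|^k / k! <= e^{|x|}; the point is uniformity in k. *)
Lemma mcoef_bound (nu : probability R R) k : has_mgf nu ->
  `|mcoef nu k| <= \int[nu]_x expR (1 * `|x|).
Proof.
move=> nu_mgf; rewrite /mcoef normrM [`|_^-1|]ger0_norm ?invr_ge0//.
rewrite ler_pdivrMr ?ltr0n ?fact_gt0//.
rewrite (le_trans (le_normr_Rintegral measurableT (integrable_exprn nu_mgf k)))//.
have ie := integrable_expR_norm nu_mgf ler01.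
rewrite mulrC -RintegralZl//; apply: le_Rintegral => //.
- exact: integrable_norm (integrable_exprn nu_mgf k).
- exact: (@integrableZl _ _ _ nu _ measurableT k`!%:R _ ie).
- by move=> x _; rewrite mul1r; exact: exprn_le_expR.
Qed.

Lemma cvg_mgf_series (nu : probability R R) t : has_mgf nu ->
  \sum_(k < N) mcoef nu k * t ^+ k @[N --> \oo] --> fine (mgf nu t).
Proof.
move=> nu_mgf; apply/subr_cvg0/norm_cvg0P.
have := cvg_cmgf_series nu_mgf t%:C; rewrite cmgf_real.
apply: cvg_trans; apply: near_eq_cvg; apply: nearW => N.
rewrite -nc_real rmorphB rmorph_sum; congr (nc (_ - _)).
by apply: eq_bigr => k _; rewrite -rmorphXn -rmorphM.
Qed.

(** Equality on the real axis determines the Taylor coefficients, and these determine the values on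
    the imaginary axis, where the characteristic function lives. *)
Lemma cmgf_unique (nu1 nu2 : probability R R) : has_mgf nu1 ->
  (forall t, mgf nu1 t = mgf nu2 t) -> forall z, cmgf nu1 z = cmgf nu2 z.
Proof.
move=> h1 e z; have h2 : has_mgf nu2 by move=> t; rewrite -e.
have me k : mcoef nu1 k = mcoef nu2 k.
  apply/eqP; rewrite -subr_eq0; apply/eqP.
  apply: (@power_series_unique (fun k => mcoef nu1 k - mcoef nu2 k)
    (\int[nu1]_x expR (1 * `|x|) + \int[nu2]_x expR (1 * `|x|))) => [j|t _].
    by rewrite (le_trans (ler_normB _ _))// lerD// mcoef_bound.
  rewrite -[X in _ --> X](subrr (fine (mgf nu1 t))) [X in _ - X](congr1 fine (e t)).
  have : (\sum_(k < N) mcoef nu1 k * t ^+ k - \sum_(k < N) mcoef nu2 k * t ^+ k)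
      @[N --> \oo] --> fine (mgf nu1 t) - fine (mgf nu2 t).
    by apply: cvgB; exact: cvg_mgf_series.
  apply: cvg_trans; apply: near_eq_cvg; apply: nearW => N.
  by rewrite /= -sumrB; apply: eq_bigr => i _; rewrite mulrBl.
apply: (nc_lim_uniq _ (cvg_cmgf_series h1 z)).
have := cvg_cmgf_series h2 z; apply: cvg_trans; apply: near_eq_cvg.
apply: nearW => N; congr (nc (_ - _)).
by apply: eq_bigr => i _; rewrite me.
Qed.

End MgfUnique.

Section Density.
Import HBNNSimple.
Context d (T : measurableType d) (R : realType).
Variables (mu kappa : {measure set T -> \bar R}) (p : T -> R).
Hypotheses (mp : measurable_fun setT p) (p0 : forall x, 0 <= p x).
Hypothesis kappaE : forall A, measurable A ->
  kappa A = (\int[mu]_(x in A) (p x)%:E)%E.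

(** Monotone convergence reduces this to simple functions, where it is the hypothesis on sets. *)
Lemma ge0_integral_density (f : T -> \bar R) :
  measurable_fun setT f -> (forall x, (0 <= f x)%E) ->
  (\int[kappa]_x f x = \int[mu]_x (f x * (p x)%:E))%E.
Proof.
move=> mf f0; pose h := nnsfun_approx measurableT mf.
have hf x : EFin (h k x) @[k --> \oo] --> f x by exact: cvg_nnsfun_approx.
have mh k : measurable_fun setT (EFin \o h k) by exact/measurable_EFinP.
have mp' : measurable_fun setT (EFin \o p) by exact/measurable_EFinP.
have hn x j k : (j <= k)%N -> h j x <= h k x.
  by move=> jk; exact/lefP/nd_nnsfun_approx.
have -> : (\int[kappa]_x f x =
    limn (fun k => \int[kappa]_x (EFin \o h k) x))%E.
  under eq_integral => x _ do rewrite -(cvg_lim _ (hf x))//.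
  apply: monotone_convergence => //.
  - by move=> k x _; rewrite lee_fin.
  - by move=> x _ j k jk; rewrite lee_fin hn.
have -> : (\int[mu]_x (f x * (p x)%:E) =
    limn (fun k => \int[mu]_x ((EFin \o h k) x * (p x)%:E)))%E.
  have hp x : (EFin (h k x) * (p x)%:E)%E @[k --> \oo] --> (f x * (p x)%:E)%E.
    by apply: cvgeZr; [|exact: hf].
  under eq_integral => x _ do rewrite -(cvg_lim _ (hp x))//.
  apply: monotone_convergence => //.
  - by move=> k; apply: emeasurable_funM; [exact: mh|exact: mp'].
  - by move=> k x _; rewrite mule_ge0 ?lee_fin.
  - by move=> x _ j k jk; rewrite lee_wpmul2r ?lee_fin ?hn.
congr (limn _); apply/funext => k.
have yE x : ((EFin \o h k) x = \sum_(y \in range (h k))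
    (y * \1_(h k @^-1` [set y]) x)%:E)%E by rewrite /= fimfunE -fsumEFin.
have mi y : measurable_fun setT (fun x => (y * \1_(h k @^-1` [set y]) x)%:E).
  by apply/measurable_EFinP; exact: measurable_funM.
under eq_integral do rewrite yE.
rewrite ge0_integral_fsum//; last by move=> y x _; exact: nnfun_muleindic_ge0.
under [RHS]eq_integral => x _.
  rewrite yE ge0_mule_fsuml => [|y]; last exact: nnfun_muleindic_ge0.
  over.
rewrite ge0_integral_fsum//; last 2 first.
  - by move=> y; exact: emeasurable_funM.
  - by move=> y x _; apply: mule_ge0; [exact: nnfun_muleindic_ge0|rewrite lee_fin].
apply: eq_fsbigr => y; rewrite inE => -[x0 _ yx].
have y0 : 0 <= y by rewrite -yx.
have mA : measurable (h k @^-1` [set y]) by [].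
under eq_integral do rewrite EFinM.
have mi1 : measurable_fun setT (fun x => (\1_(h k @^-1` [set y]) x)%:E : \bar R).
  by apply/measurable_EFinP; exact: measurable_indic.
rewrite ge0_integralZl//.
rewrite integral_indic// setIT kappaE//.
under [RHS]eq_integral do rewrite EFinM -muleA.
rewrite ge0_integralZl//; last 2 first.
  - by apply: emeasurable_funM; [exact: mi1|exact: mp'].
  - by move=> x _; rewrite mule_ge0 ?lee_fin.
congr (_ * _)%E; rewrite integral_mkcond; apply: eq_integral => x _.
by rewrite epatch_indic muleC.
Qed.

End Density.

Section Gaussian.
Variable R : realType.

Lemma mgf_normal (m sigma t : R) : 0 < sigma ->
  (\int[normal_prob m sigma]_x (expR (t * x))%:E =
   (expR (m * t + (sigma * t) ^+ 2 / 2))%:E)%E.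
Proof.
move=> s0; have sN0 : sigma != 0 by rewrite gt_eqF.
have mpdf m' := @measurable_normal_pdf R m' sigma.
have E := @ge0_integral_density _ (measurableTypeR R) R lebesgue_measure
  (normal_prob m sigma) (normal_pdf m sigma) (mpdf m) (fun x => normal_pdf_ge0 m sigma x)
  (fun A _ => erefl) (fun x => (expR (t * x))%:E).
rewrite E; last 2 first.
- by apply/measurable_EFinP; exact: measurable_expM.
- by move=> x; rewrite lee_fin expR_ge0.

clear E. 
(* Completing the square: the exponential factor shifts the mean by sigma^2 t. *)
have cs x : expR (t * x) * normal_pdf m sigma x =
    expR (m * t + (sigma * t) ^+ 2 / 2) * normal_pdf (m + sigma ^+ 2 * t) sigma x.
  rewrite (normal_pdfE m sN0) (normal_pdfE _ sN0). rewrite /normal_fun. rewrite mulrCA [RHS]mulrCA. congr (_ * _).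
  rewrite -!expRD; congr expR; rewrite -[sigma ^+ 2 *+ 2]mulr_natr; by field.
under eq_integral do rewrite -EFinM cs EFinM.

rewrite ge0_integralZl//; last first.

  by move=> x _; rewrite lee_fin normal_pdf_ge0.
  by apply/measurable_EFinP; exact: mpdf.
 
by rewrite integral_normal_pdf mule1.
Qed.

Lemma mgf_dirac (m t : R) : mgf \d_m t = (expR (m * t))%:E.
Proof.
rewrite /mgf integral_dirac//; first by rewrite diracT mul1e mulrC.
by apply/measurable_EFinP; exact: measurable_expM.
Qed.

Lemma gaussian_quadratic_mgf (g1 g2 : R) : 0 <= g2 ->
  exists gamma : probability R R, gaussian gamma /\
    forall t, mgf gamma t = (expR (g1 * t + g2 * t ^+ 2))%:E.
Proof.
rewrite le_eqVlt => /predU1P[<-|g20].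
  exists \d_g1; split; first by left; exists g1.
  by by move=> t; rewrite mul0r addr0; exact: mgf_dirac.
have s0 : 0 < Num.sqrt (2 * g2) by rewrite sqrtr_gt0 mulr_gt0.
(* The normal law lives on [measurableTypeR R]; the identity map transports it to [R]. *)
pose P := normal_prob g1 (Num.sqrt (2 * g2)) : probability (measurableTypeR R) R.
have mid : @measurable_fun _ _ (measurableTypeR R) R setT id.
  exact: (@measurable_id _ (measurableTypeR R) setT).
exists (distribution P (mk_mfun mid)).
split; first by right; exists g1, (Num.sqrt (2 * g2)).
move=> t; rewrite mgf_distribution /= mgf_normal// exprMn sqr_sqrtr ?mulr_ge0 ?(ltW g20)//.
by congr (expR _)%:E; field.
Qed.

Lemma tempered_gaussian (nu : probability R R) : tempered nu ->
  exists gamma : probability R R, gaussian gamma /\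
    forall z, cmgf nu z = cmgf gamma z.
Proof.
move=> tnu; have [g1 [g2 [g20 nuE]]] := tempered_quadratic tnu.
have [gamma [gg gE]] := gaussian_quadratic_mgf g1 g20.
exists gamma; split => //; apply: cmgf_unique (tempered_has_mgf tnu) _ => t.
by rewrite nuE gE.
Qed.

End Gaussian.

(** * The functional equation *)

Section FiniteDifferences.
Variable R : realType.
Implicit Types (f : R -> R) (h s : R) (q : {poly R}) (m : nat).

Fixpoint fdiff m h f s : R :=
  if m is m'.+1 then fdiff m' h f s - fdiff m' h f (s + h) else f s.

Lemma fdiffS m h f s : fdiff m.+1 h f s = fdiff m h (fun x => f x - f (x + h)) s.
Proof. by elim: m s => // m IH s; rewrite [RHS]/= -!IH. Qed.

Lemma eq_fdiff m h f1 f2 s : f1 =1 f2 -> fdiff m h f1 s = fdiff m h f2 s.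
Proof. by move=> e; elim: m s => [|m IH] s //=; rewrite !IH. Qed.

Lemma fdiffB m h f1 f2 s :
  fdiff m h (fun x => f1 x - f2 x) s = fdiff m h f1 s - fdiff m h f2 s.
Proof. by elim: m s => [|m IH] s //=; rewrite !IH; ring. Qed.

(** Each difference lowers the degree, because the leading terms of q and q(X + h) cancel. *)
Lemma fdiff_poly m h q s : (size q <= m)%N -> fdiff m h (horner q) s = 0.
Proof.
elim: m q s => [|m IH] q s; first by rewrite leqn0 size_poly_eq0 => /eqP ->; rewrite /= horner0.
move=> sq; rewrite fdiffS.
rewrite (@eq_fdiff _ _ _ (horner (q - (q \Po ('X + h%:P))))); last first.
  by move=> x; rewrite hornerD hornerN horner_comp !hornerE.
apply: IH; apply/leq_sizeP => j mj; rewrite coefB.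
have sX : size ('X + h%:P) = 2 by rewrite -[h]opprK polyCN size_XsubC.
have [jq|jq] := leqP (size q) j.
  by rewrite !nth_default ?subr0// size_comp_poly2.
have jE : j = (size q).-1.
  by apply/eqP; rewrite eqn_leq -ltnS (ltn_predK jq) jq -ltnS (ltn_predK jq) (leq_trans sq).
rewrite jE -lead_coefE -(size_comp_poly2 q sX) -lead_coefE lead_coef_comp ?sX//.
by rewrite -[h]opprK polyCN lead_coefXsubC expr1n mulr1 subrr.
Qed.

(** A vanishing difference thus propagates zeros along a grid from m consecutive points to the next
    one. *)
Lemma fdiff_last m h f s : (forall k, (k < m)%N -> f (s + k%:R * h) = 0) ->
  fdiff m h f s = (-1) ^+ m * f (s + m%:R * h).
Proof.
elim: m s => [|m IH] s f0; first by rewrite expr0 mul1r mul0r addr0.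
rewrite /= !IH; first last.
- by move=> k km; rewrite f0// ltnS ltnW.
- move=> k km; have -> : s + h + k%:R * h = s + k.+1%:R * h by rewrite -natr1; ring.
  by rewrite f0.
rewrite f0// mulr0 sub0r exprS mulN1r mulNr; congr (- (_ * f _)).
by rewrite -natr1; ring.
Qed.

(** Newton's form: a multiple of the product of the X - x_k corrects the value at one new point. *)
Lemma interpolation (x : nat -> R) f m : injective x ->
  exists2 q : {poly R}, (size q <= m)%N & forall k, (k < m)%N -> q.[x k] = f (x k).
Proof.
move=> xI; elim: m => [|m [q sq qE]]; first by exists 0; rewrite ?size_poly0.
pose w := \prod_(k < m) ('X - (x k)%:P).
have wE k : w.[x k] = \prod_(j < m) (x k - x j).
  by rewrite horner_prod; apply: eq_bigr => j _; rewrite hornerXsubC.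
have w0 : w.[x m] != 0.
  rewrite wE; apply/prodf_neq0 => j _; rewrite subr_eq0.
  by apply/eqP => /xI mj; have := ltn_ord j; rewrite -mj ltnn.
exists (q + ((f (x m) - q.[x m]) / w.[x m]) *: w).
  rewrite (leq_trans (size_polyD _ _))// geq_max (leq_trans sq)//=.
  by rewrite (leq_trans (size_scale_leq _ _))// size_prod_XsubC /index_enum -enumT size_enum_ord.
move=> k; rewrite ltnS leq_eqVlt => /predU1P[->|km]; rewrite hornerD hornerZ.
  by rewrite divfK// addrC subrK.
by rewrite qE// [w.[x k]]wE (bigD1 (Ordinal km))//= subrr mul0r mulr0 addr0.
Qed.

Lemma poly_eq_points (x : nat -> R) (q1 q2 : {poly R}) m : injective x ->
  (size q1 <= m)%N -> (size q2 <= m)%N ->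
  (forall k, (k < m)%N -> q1.[x k] = q2.[x k]) -> q1 = q2.
Proof.
move=> xI s1 s2 e; apply/eqP; rewrite -subr_eq0; apply/eqP.
apply: (@roots_geq_poly_eq0 _ _ (map x (iota 0 m))).
- apply/allP => y /mapP[k]; rewrite mem_iota => /andP[_ km] ->.
  by rewrite rootE hornerD hornerN e ?subrr.
- by rewrite map_inj_uniq// iota_uniq.
- rewrite size_map size_iota (leq_trans (size_polyD _ _))// size_polyN.
  by rewrite geq_max s1.
Qed.

(* On each grid of mesh 2r/(m(N+1)) the first m values determine all others, hence
   f coincides there with an interpolation polynomial, which is the same for all N
   because the grids share m points. *)
Lemma frechet_polynomial f m (r : R) : 0 < r -> (0 < m)%N ->
  (forall s, `|s| <= r -> {for s, continuous f}) ->
  (forall s h, `|s| <= r -> `|h| <= 2 * r -> fdiff m h f s = 0) ->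
  exists q : {poly R}, forall s, `|s| <= r -> f s = q.[s].
Proof.
move=> r0 m0 fc fd.
pose st N : R := 2 * r / (m * N.+1)%:R.
pose x N k : R := - r + k%:R * st N.
have mN0 N : 0 < (m * N.+1)%:R :> R by rewrite ltr0n muln_gt0 m0.
have st0 N : 0 < st N by rewrite divr_gt0 ?mulr_gt0.
have st_le N : `|st N| <= 2 * r.
  rewrite gtr0_norm// ler_pdivrMr// ler_peMr ?mulr_ge0 ?(ltW r0)//.
  by rewrite ler1n muln_gt0 m0.
have xI N : injective (x N).
  move=> j k /addrI /(mulIf (lt0r_neq0 (st0 N))) /eqP.
  by rewrite eqr_nat => /eqP.
have xr N k : (k <= m * N.+1)%N -> `|x N k| <= r.
  move=> kN; have h1 : 0 <= k%:R * st N by rewrite mulr_ge0// ltW.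
  have h2 : k%:R * st N <= 2 * r.
    rewrite /st mulrCA ler_piMr ?mulr_ge0 ?(ltW r0)//.
    by rewrite ler_pdivrMr// mul1r ler_nat.
  by rewrite ler_norml /x; lra.
have grid N : exists2 q : {poly R}, (size q <= m)%N &
    forall k, (k <= m * N.+1)%N -> f (x N k) = q.[x N k].
  have [q sq qE] := interpolation f m (xI N).
  exists q => // k; elim/ltn_ind: k => k IH kN.
  have [km|mk] := ltnP k m; first by rewrite qE.
  pose g y := f y - q.[y].
  have xE j : (j <= m)%N -> x N (k - m)%N + j%:R * st N = x N (k - m + j)%N.
    by move=> _; rewrite /x natrD; ring.
  have g0 : fdiff m (st N) g (x N (k - m)%N) = 0.
    rewrite fdiffB fdiff_poly// fd ?subr0// xr// (leq_trans (leq_subr _ _))//.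
  move: g0; rewrite fdiff_last.
    move/eqP; rewrite mulrI_eq0; last first.
      by apply/lregP; rewrite signr_eq0.
    by rewrite xE// subnK// subr_eq0 => /eqP.
  move=> j jm; rewrite xE ?(ltnW jm)// /g IH ?subrr//.
    by rewrite -[X in (_ < X)%N](subnK mk) ltn_add2l.
  by rewrite (leq_trans _ kN)// -[X in (_ <= X)%N](subnK mk) leq_add2l ltnW.
have [q sq qE] := grid 0%N.
have gridq N k : (k <= m * N.+1)%N -> f (x N k) = q.[x N k].
  have [q' sq' qE'] := grid N; suff -> : q = q' by exact: qE'.
  apply: (poly_eq_points (xI 0%N)) sq sq' _ => j jm.
  (* The N-th grid refines the grid of index 0, whose point j has index j(N + 1) in it. *)
  have xj : x 0%N j = x N (j * N.+1)%N.
    rewrite /x /st muln1 !natrM; congr (_ + _); field.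
    by rewrite nat1r !pnatr_eq0 -!lt0n m0.
  by rewrite -qE ?muln1 ?(ltnW jm)// xj qE'// leq_mul2r (ltnW jm) orbT.
exists q => s sr; apply/eqP; rewrite -subr_eq0 -normr_le0.
apply/ler_addgt0Pl => e e0; rewrite addr0.
have cg : {for s, continuous (fun y => f y - q.[y])}.
  by apply: cvgB; [exact: fc|exact: continuous_horner].
have /cvgrPdist_le /(_ e e0)/nbhs_ballP[d /= d0 dP] := cg.
(* The mesh is made smaller than the modulus of continuity at s; [k] below is the last grid point
   not exceeding s. *)
pose N := Num.truncn (2 * r / d).
have stN : st N < d.
  rewrite /st ltr_pdivrMr//.
  have : 2 * r / d < N.+1%:R by rewrite truncnS_gt.
  rewrite ltr_pdivrMr// => h; apply: (lt_le_trans h).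
  by rewrite mulrC ler_wpM2l ?(ltW d0)// ler_nat leq_pmull.
pose k := Num.truncn ((s + r) / st N).
have sr0 : 0 <= s + r by move: sr; rewrite ler_norml => /andP[]; lra.
have k1 : k%:R <= (s + r) / st N by rewrite truncn_le divr_ge0// ltW.
have k2 : (s + r) / st N < k%:R + 1 by rewrite natr1 truncnS_gt.
rewrite ler_pdivlMr// in k1; rewrite ltr_pdivrMr// mulrDl mul1r in k2.
have kN : (k <= m * N.+1)%N.
  rewrite -(ler_nat R) -(ler_pM2r (st0 N)) (le_trans k1)// /st mulrC divfK ?gt_eqF//.
  by move: sr; rewrite ler_norml => /andP[]; lra.
have := dP (x N k); rewrite gridq// subrr subr0; apply.
rewrite /ball /= ltr_norml /x; lra.
Qed.

End FiniteDifferences.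

(** * Difference operators in the plane *)

Section PlaneDifferences.
Variable R : realType.
Implicit Types (h : R) (p w : R * R) (ws : seq (R * R)) (G : R * R -> R).

Definition shift h w p : R * R := (p.1 + h * w.1, p.2 + h * w.2).

Definition linform (x y : R) p : R := x * p.1 + y * p.2.

Fixpoint pdiff h ws G p : R :=
  if ws is w :: ws' then pdiff h ws' G p - pdiff h ws' G (shift h w p) else G p.

Lemma pdiffB h ws G1 G2 p :
  pdiff h ws (fun x => G1 x - G2 x) p = pdiff h ws G1 p - pdiff h ws G2 p.
Proof. by elim: ws p => [|w ws IH] p //=; rewrite !IH; ring. Qed.

Lemma pdiff_sum h ws n (P : pred 'I_n) (G : 'I_n -> R * R -> R) p :
  pdiff h ws (fun x => \sum_(j | P j) G j x) p = \sum_(j | P j) pdiff h ws (G j) p.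
Proof. by elim: ws p => [|w ws IH] p //=; rewrite !IH -sumrB. Qed.

Lemma pdiff_invariant h w ws G p : (forall x, G (shift h w x) = G x) ->
  pdiff h ws G (shift h w p) = pdiff h ws G p.
Proof.
move=> Gw; elim: ws p => [|v ws IH] p //=; rewrite IH; congr (_ - _).
rewrite -[RHS]IH; congr (pdiff h ws G _).
by rewrite /shift /=; congr (_, _); ring.
Qed.

(** Differences in several directions commute, so invariance along one of them is enough. *)
Lemma pdiff_kill h w ws G p : w \in ws -> (forall x, G (shift h w x) = G x) ->
  pdiff h ws G p = 0.
Proof.
move=> + Gw; elim: ws p => // v ws IH p; rewrite inE => /predU1P[<-|wws] /=.
  by rewrite pdiff_invariant// subrr.
by rewrite !IH// subrr.
Qed.

(** Normalized directions all move the value of the form by the same step h, and the plane operator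
    becomes an iterated difference on the line. *)
Lemma pdiff_linform h ws (f : R -> R) x y p :
  (forall w, w \in ws -> linform x y w = 1) ->
  pdiff h ws (f \o linform x y) p = fdiff (size ws) h f (linform x y p).
Proof.
elim: ws p => [|w ws IH] p w1 //=; rewrite !IH; first last.
- by move=> v vws; rewrite w1// in_cons vws orbT.
- by move=> v vws; rewrite w1// in_cons vws orbT.
congr (_ - fdiff _ _ _ _); have := w1 w (mem_head _ _).
rewrite /linform /shift /= => e; rewrite -[h in RHS]mulr1 -e; ring.
Qed.

(** The operator sees only points within a controlled distance of p; the logarithmic identity holds
    only in a box around 0. *)
Lemma pdiff_local h ws G1 G2 p (r : R) :
  (forall x, `|x.1| <= r -> `|x.2| <= r -> G1 x = G2 x) ->
  `|p.1| + `|h| * \sum_(w <- ws) (`|w.1| + `|w.2|) <= r ->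
  `|p.2| + `|h| * \sum_(w <- ws) (`|w.1| + `|w.2|) <= r ->
  pdiff h ws G1 p = pdiff h ws G2 p.
Proof.
move=> G12; elim: ws p => [|w ws IH] p /=.
  by rewrite big_nil mulr0 !addr0; exact: G12.
rewrite !big_cons; set S := \sum_(_ <- _) _ => p1 p2.
have w1 : 0 <= `|h| * `|w.1| by exact: mulr_ge0.
have w2 : 0 <= `|h| * `|w.2| by exact: mulr_ge0.
rewrite !mulrDr in p1 p2.
rewrite !IH//=; rewrite -/S; try lra.
  by have := ler_normD p.1 (h * w.1); rewrite normrM; lra.
by have := ler_normD p.2 (h * w.2); rewrite normrM; lra.
Qed.

End PlaneDifferences.

(** * From the product identity to an even polynomial *)

Section FunctionalEquation.
Variable R : realType.
Variables (n : nat) (al be ga de : 'I_n -> R) (g : 'I_n -> R -> R) (i : 'I_n).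
Hypotheses (gc : forall j, continuous (g j)) (g0 : forall j, g j 0 = 1).
Hypothesis geven : forall j s, g j (- s) = g j s.
Hypothesis gE : forall u v, \prod_j g j (al j * u + be j * v) =
  \prod_j g j (ga j * u + de j * v).
Hypothesis idet : forall j, al i * de j - be i * ga j != 0.

Definition proportional j := al i * be j == al j * be i.

(** The inner product with the i-th form divided by the square of its length. Forms that are not
    proportional receive 0 and drop out of the product of the g_j(r_j s), because g_j(0) = 1. *)
Definition ratio j : R := if proportional j
  then (al j * al i + be j * be i) / (al i ^+ 2 + be i ^+ 2) else 0.

Let sq0 : 0 < al i ^+ 2 + be i ^+ 2.
Proof.
rewrite lt_def addr_ge0 ?sqr_ge0// andbT paddr_eq0 ?sqr_ge0// !sqrf_eq0.
apply/negP => /andP[/eqP a0 /eqP b0].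
by have := idet i; rewrite a0 b0 !mul0r subrr eqxx.
Qed.

Lemma ratio_i : ratio i = 1.
Proof. by rewrite /ratio /proportional eqxx -!expr2 divff// gt_eqF. Qed.

Lemma ratio_linform j p : proportional j ->
  ratio j * linform (al i) (be i) p = linform (al j) (be j) p.
Proof.
move=> /[dup] pj /eqP e; rewrite /ratio pj /linform mulrAC.
apply: (mulIf (lt0r_neq0 sq0)); rewrite divfK ?gt_eqF//.
have -> : (al j * al i + be j * be i) * (al i * p.1 + be i * p.2) =
  al j * al i ^+ 2 * p.1 + be i * (al i * be j) * p.1 +
  (al i * (al j * be i) * p.2 + be j * be i ^+ 2 * p.2) by ring.
rewrite {1}e -{2}e; ring.
Qed.

Let psi s := \sum_j ln (g j (ratio j * s)).

(** The i-th form takes the value 1 here, so s is the value at s [p0]. *)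
Let p0 : R * R := (al i / (al i ^+ 2 + be i ^+ 2), be i / (al i ^+ 2 + be i ^+ 2)).

(* Directions in the kernel of the j-th form, normalized by the i-th form. *)
Let dir1 j : R * R := if proportional j then p0 else
  (- be j / (al j * be i - al i * be j), al j / (al j * be i - al i * be j)).

Let dir2 j : R * R :=
  (- de j / (ga j * be i - al i * de j), ga j / (ga j * be i - al i * de j)).

Let dirs := map dir1 (enum 'I_n) ++ map dir2 (enum 'I_n).

Let det1 j : ~~ proportional j -> al j * be i - al i * be j != 0.
Proof. by rewrite subr_eq0 eq_sym. Qed.

Let det2 j : ga j * be i - al i * de j != 0.
Proof. by rewrite -opprB oppr_eq0 [ga j * _]mulrC idet. Qed.

Let dirs1 w : w \in dirs -> linform (al i) (be i) w = 1.
Proof.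
have p01 : linform (al i) (be i) p0 = 1.
  by rewrite /linform /= !mulrA -mulrDl -!expr2 divff// gt_eqF.
rewrite mem_cat => /orP[] /mapP[j _ ->].
  rewrite /dir1; case: ifPn => // /det1 d0; rewrite /linform /=.
  by rewrite !mulrA -mulrDl mulrN [be i * _]mulrC addrC divff.
by rewrite /linform /= !mulrA -mulrDl mulrN [be i * _]mulrC addrC divff.
Qed.

Let dirs_kill h (f : R -> R) j p : ~~ proportional j ->
  pdiff h dirs (f \o linform (al j) (be j)) p = 0.
Proof.
move=> pj; apply: (@pdiff_kill _ _ (dir1 j)).
  by rewrite mem_cat map_f// mem_enum.
move=> x; rewrite /= /dir1 (negbTE pj) /linform /shift /=; congr f.
by field; exact: det1.
Qed.

Let dirs_kill2 h (f : R -> R) j p :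
  pdiff h dirs (f \o linform (ga j) (de j)) p = 0.
Proof.
apply: (@pdiff_kill _ _ (dir2 j)).
  by rewrite mem_cat (map_f dir2)// ?mem_enum// orbT.
move=> x; rewrite /= /linform /shift /=; congr f.
by field; exact: det2.
Qed.

Let e_pos : exists2 e : R, 0 < e & forall j s, `|s| <= e -> 0 < g j s.
Proof.
have h j : nbhs (0 : R) [set s | 0 < g j s].
  have /cvgrPdist_lt/(_ 1 ltr01) := @gc j 0.
  apply: filterS => s; rewrite g0 /= ltr_norml => /andP[_]; lra.
have : nbhs (0 : R) [set s | forall j, 0 < g j s].
  exact: (@filter_forall _ _ (fun j => [set s | 0 < g j s]) _ _ h).
move=> /nbhs_ballP[e /= e0 eP]; exists (e / 2); first by rewrite divr_gt0.
move=> j s se; apply: eP; rewrite /ball /= sub0r normrN (le_lt_trans se)//.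
by rewrite ltr_pdivrMr// ltr_pMr// ltr1n.
Qed.

Lemma functional_equation : exists (Q : {poly R}) (del : R),
  [/\ Q`_0 = 0, 0 < del &
      forall s, 0 < s <= del -> \prod_j g j (ratio j * s) = expR Q.[s ^+ 2]].
Proof.
have [e e0 gpos] := e_pos.
(* [M] bounds all coefficients and ratios, so every form maps the box of radius rho = e / M into
   [-e, e], where the g_j are positive. *)
pose M := 1 + \sum_j (`|al j| + `|be j| + `|ga j| + `|de j| + `|ratio j|).
have jM j : `|al j| + `|be j| + `|ga j| + `|de j| + `|ratio j| <= M.
  rewrite /M (bigD1 j)//= addrCA lerDl addr_ge0//.
  by apply: sumr_ge0 => k _; rewrite !addr_ge0.
have M0 : 0 < M.
  by rewrite ltr_wpDr// sumr_ge0// => k _; rewrite !addr_ge0.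
pose rho := e / M.
have rho0 : 0 < rho by rewrite divr_gt0.
have eE : e = M * rho by rewrite mulrC divfK ?gt_eqF.
have box x y p : `|x| + `|y| <= M -> `|p.1| <= rho -> `|p.2| <= rho ->
    `|linform x y p| <= e.
  move=> xyM p1 p2; rewrite (le_trans (ler_normD _ _))// !normrM.
  apply: (@le_trans _ _ ((`|x| + `|y|) * rho)).
    by rewrite mulrDl lerD// ler_wpM2l.
  by rewrite eE ler_wpM2r// ltW.
pose G p := \sum_j ln (g j (linform (ga j) (de j) p)) -
  \sum_(j | ~~ proportional j) ln (g j (linform (al j) (be j) p)).
have psiG p : `|p.1| <= rho -> `|p.2| <= rho -> psi (linform (al i) (be i) p) = G p.
  move=> p1 p2.
  have b1 j : 0 < g j (linform (al j) (be j) p).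
    apply/gpos/box => //; apply: le_trans (jM j).
    by rewrite -!addrA lerD2l lerDl !addr_ge0.
  have b2 j : 0 < g j (linform (ga j) (de j) p).
    apply/gpos/box => //; apply: le_trans (jM j).
    have := normr_ge0 (al j); have := normr_ge0 (be j).
    by have := normr_ge0 (ratio j); lra.
  have lnE (f : 'I_n -> R) : (forall j, 0 < f j) -> \sum_j ln (f j) = ln (\prod_j f j).
    move=> f0; apply: expR_inj; rewrite expR_sum lnK ?posrE ?prodr_gt0//.
    by apply: eq_bigr => j _; rewrite lnK ?posrE.
  have -> : psi (linform (al i) (be i) p) =
      \sum_(j | proportional j) ln (g j (linform (al j) (be j) p)).
    rewrite /psi (bigID proportional)/= [X in _ + X]big1 ?addr0; last first.
      by move=> j /negbTE pj; rewrite /ratio pj mul0r g0 ln1.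
    by apply: eq_bigr => j pj; rewrite ratio_linform.
  rewrite /G lnE// -gE -(lnE (fun j => g j (linform (al j) (be j) p)))//.
  by rewrite [in RHS](bigID proportional)/= addrK.
have G0 h p : pdiff h dirs G p = 0.
  rewrite /G pdiffB !pdiff_sum !big1 ?subrr// => j pj.
    exact: (@dirs_kill h (@ln R \o g j) j p pj).
  exact: (@dirs_kill2 h (@ln R \o g j) j p).
pose W := \sum_(w <- dirs) (`|w.1| + `|w.2|).
have W0 : 0 <= W by apply: sumr_ge0 => w _; exact: addr_ge0.
pose K := `|p0.1| + `|p0.2| + W + 1.
have K0 : 0 < K by rewrite /K; have := normr_ge0 p0.1; have := normr_ge0 p0.2; lra.
(* For |s| <= r and |h| <= 2r all points reached from s [p0] stay in the box of radius [rho]; r <=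
   rho also keeps the arguments r_j s inside [-e, e]. *)
pose r := Num.min (rho / (2 * K)) rho.
have r0 : 0 < r by rewrite lt_min rho0 andbT divr_gt0// mulr_gt0.
have rK : r * (2 * K) <= rho by rewrite -ler_pdivlMr ?mulr_gt0// ge_min lexx.
have r_rho : r <= rho by rewrite ge_min lexx orbT.
have sE s : `|s| <= r -> forall j, 0 < g j (ratio j * s).
  move=> sr j; apply: gpos; rewrite normrM eE ler_pM//; last exact: le_trans r_rho.
  by apply: le_trans (jM j); rewrite lerDr !addr_ge0.
have psi_fd s h : `|s| <= r -> `|h| <= 2 * r -> fdiff (size dirs) h psi s = 0.
  move=> sr hr.
  have -> : s = linform (al i) (be i) (s * p0.1, s * p0.2).
    have p01 : linform (al i) (be i) p0 = 1.
      by rewrite /linform /= !mulrA -mulrDl -!expr2 divff// gt_eqF.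
    by rewrite -[LHS]mulr1 -p01 /linform /=; ring.
  rewrite -(pdiff_linform _ _ _ dirs1) (@pdiff_local _ _ _ _ G _ rho) ?G0//=.
  - rewrite normrM -/W; apply: le_trans rK.
    have := ler_pM (normr_ge0 h) W0 hr (lexx W).
    have := ler_wpM2r (normr_ge0 p0.1) sr.
    have := mulr_ge0 (ltW r0) (normr_ge0 p0.1).
    have := mulr_ge0 (ltW r0) (normr_ge0 p0.2).
    by rewrite /K; lra.
  - rewrite normrM -/W; apply: le_trans rK.
    have := ler_pM (normr_ge0 h) W0 hr (lexx W).
    have := ler_wpM2r (normr_ge0 p0.2) sr.
    have := mulr_ge0 (ltW r0) (normr_ge0 p0.1).
    have := mulr_ge0 (ltW r0) (normr_ge0 p0.2).
    by rewrite /K; lra.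
have psic s : `|s| <= r -> {for s, continuous psi}.
  move=> sr; apply: (cvg_big (op := +%R)) => [|j _]; first exact: add_continuous.
  have gs : {for s, continuous (fun s => g j (ratio j * s))}.
    apply: (@continuous_comp _ _ _ (fun s => ratio j * s) (g j)).
      by apply: cvgM; [exact: cvg_cst|exact: cvg_id].
    exact: gc.
  by apply: (continuous_comp gs); apply: continuous_ln; exact: sE.
have d0 : (0 < size dirs)%N.
  by rewrite size_cat size_map size_enum_ord ltn_addr// (leq_ltn_trans _ (ltn_ord i)).
have [q qE] := frechet_polynomial r0 d0 psic psi_fd.
(* The sum of logarithms is even and equals q, so the odd part of q contributes nothing; it vanishes
   at 0, hence so does the constant coefficient. *)
exists (even_poly q), r; split => //.
  rewrite coef_even_poly -horner_coef0 -qE ?normr0 ?(ltW r0)//.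
  by rewrite /psi big1// => j _; rewrite mulr0 g0 ln1.
move=> s /andP[s0 sr].
have sr' : `|s| <= r by rewrite gtr0_norm.
have psiE : psi s = (even_poly q).[s ^+ 2].
  have psiN : psi (- s) = psi s.
    by apply: eq_bigr => j _; rewrite mulrN geven.
  have := qE (- s); rewrite normrN psiN qE// => /(_ sr').
  have qEO y : q.[y] = (even_poly q).[y ^+ 2] + (odd_poly q).[y ^+ 2] * y.
    rewrite -[q in LHS]poly_even_odd.
    by rewrite !(hornerD, hornerM, horner_comp, hornerXn, hornerX).
  by rewrite !qEO sqrrN; lra.
rewrite -psiE /psi expR_sum; apply: eq_bigr => j _.
by rewrite lnK// posrE sE.
Qed.

End FunctionalEquation.

(** * Characterization by identically distributed linear forms *)

Section CosTransform.
Variables (R : realType) (mu : probability R R).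

Let integrable_bounded (f : R -> R) : measurable_fun setT f ->
  (forall x, `|f x| <= 1) -> mu.-integrable setT (EFin \o f).
Proof.
move=> mf f1; apply: (@le_integrable_real _ _ _ _ _ (cst 1)) => //.
exact: finite_measure_integrable_cst.
Qed.

Lemma continuous_cos_transform : continuous (fun s : R => \int[mu]_y cos (s * y)).
Proof.
move=> s; apply: (@continuity_under_integral R _ _ mu (fun s y => cos (s * y)) setT
  measurableT (s - 1) (s + 1) _ _ (cst 1)).
- by move=> x _; apply: integrable_bounded => [|y]; [exact: measurable_cosM|exact: cos_max].
- apply: aeW => y _ x _; apply: (@continuous_comp _ _ _ (fun x : R => x * y) (@cos R)).
    by apply: cvgM; [exact: cvg_id|exact: cvg_cst].
  exact: continuous_cos.
- exact: finite_measure_integrable_cst.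
- by move=> x _; apply: aeW => y _; exact: cos_max.
- by rewrite inE /= in_itv /= ltrBlDr ltrDl ltr01.
Qed.

Lemma cos_transform0 : \int[mu]_y cos (0 * y) = 1.
Proof.
under eq_Rintegral do rewrite mul0r cos0.
by rewrite Rintegral_cst// [X in fine X](_ : _ = 1%E) ?mulr1//; exact: probability_setT.
Qed.

Lemma cos_transformN s : \int[mu]_y cos (- s * y) = \int[mu]_y cos (s * y).
Proof. by apply: eq_Rintegral => y _; rewrite mulNr cosN. Qed.

End CosTransform.

(** * Passage to an independent summand *)

Section TemperedFactor.
Variables (R : realType) (n : nat) (nu : 'I_n -> probability R R).
Variable nuZ : probability R R.
Hypothesis mgfZ : forall t, mgf nuZ t = (\prod_j mgf (nu j) t)%E.
Hypothesis cmgfZ : forall z, (forall j, mgf (nu j) (complex.Re z) < +oo)%E ->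
  cmgf nuZ z = \prod_j cmgf (nu j) z.

(** The upper bound for one factor comes from dividing by the universal lower bounds of the others
    on the real axis. These upper bounds, now valid for all factors, are divided out to give the
    lower bound in the plane. *)
Lemma tempered_factor : tempered nuZ -> forall i, tempered (nu i).
Proof.
move=> [C [D [C0 mgf_le low]]] i.
have /choice[c cP] : forall j, exists c : R, 0 <= c /\
    forall t, ((expR (- (c * (1 + `|t|))))%:E <= mgf (nu j) t)%E.
  by move=> j; have [c c0 ?] := mgf_lower_bound (nu j); exists c.
pose c' := \sum_j c j.
have c'0 : 0 <= c' by apply: sumr_ge0 => j _; exact: (cP j).1.
have lowmgf k t : ((expR (- (c' * (1 + `|t|))))%:E <= \prod_(j | j != k) mgf (nu j) t)%E.
  apply: (@le_trans _ _ (\prod_(j | j != k) (expR (- (c j * (1 + `|t|))))%:E)%E).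
    rewrite prodEFin -expR_sum lee_fin ler_expR sumrN -mulr_suml lerN2.
    rewrite ler_wpM2r ?addr_ge0// /c' [leRHS](bigD1 k)//= lerDr.
    exact: (cP k).1.
  suff /andP[] : (0 <= \prod_(j | j != k) (expR (- (c j * (1 + `|t|))))%:E <=
      \prod_(j | j != k) mgf (nu j) t)%E by [].
  apply: (big_ind2 (fun x y : \bar R => (0 <= x <= y)%E)).
  - by rewrite lexx lee_fin ler01.
  - by move=> x y v w /andP[x0 xy] /andP[v0 vw]; rewrite mule_ge0//= lee_pmul.
  - by move=> j _; rewrite lee_fin expR_ge0/=; exact: (cP j).2.
pose B := C + c'; have B0 : 0 <= B by exact: addr_ge0.
have up k t : (mgf (nu k) t <= (expR (B * (1 + `|t|) ^+ D.+1))%:E)%E.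
  have e0 : 0 < expR (- (c' * (1 + `|t|))) by exact: expR_gt0.
  have h : (mgf (nu k) t * (expR (- (c' * (1 + `|t|))))%:E <=
      (expR (C * (1 + `|t|) ^+ D))%:E)%E.
    apply: le_trans (mgf_le t); rewrite mgfZ (bigD1 k)//= lee_wpmul2l ?mgf_ge0//.
  move: h; rewrite -lee_pdivlMr// => /le_trans; apply.
  rewrite -EFinM lee_fin -expRN opprK -expRD ler_expR /B mulrDl.
  have t1 : 1 <= 1 + `|t| by rewrite lerDl.
  rewrite lerD// ler_wpM2l//.
    by rewrite ler_weXn2l.
  by rewrite -[leLHS]expr1 ler_weXn2l.
have nu_mgf k : has_mgf (nu k) by move=> t; exact: le_lt_trans (up k t) (ltry _).
have upc k z : nc (cmgf (nu k) z) <= expR (B * (1 + nc z) ^+ D.+1).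
  have fin : mgf (nu k) (complex.Re z) \is a fin_num.
    by rewrite ge0_fin_numE ?mgf_ge0//; exact: nu_mgf.
  rewrite (le_trans (nc_cmgf_le (nu_mgf k) z))// -lee_fin fineK//.
  rewrite (le_trans (up k _))// lee_fin ler_expR ler_wpM2l//.
  by rewrite lerXn2r ?nnegrE ?addr_ge0 ?nc_ge0// lerD2l normr_Re_le.
(* The other factors, fewer than n + 1 in number, cost at most n B in the lower bound; one more B
   covers the upper bound. *)
exists (C + n.+1%:R * B), D.+1; split.
- by rewrite addr_ge0// mulr_ge0.
- move=> t; apply: (le_trans (up i t)); rewrite lee_fin ler_expR ler_wpM2r ?exprn_ge0 ?addr_ge0//.
  by rewrite -nat1r mulrDl mul1r addrCA lerDl addr_ge0// mulr_ge0.
move=> z; have := low z; rewrite cmgfZ ?nc_prod//; last by move=> j; exact: nu_mgf.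
rewrite (bigD1 i)//= => h.
pose E := expR (n%:R * B * (1 + nc z) ^+ D.+1).
have rest : \prod_(j | j != i) nc (cmgf (nu j) z) <= E.
  apply: (@le_trans _ _ (\prod_(j | j != i) expR (B * (1 + nc z) ^+ D.+1))).
    by apply: ler_prod => j _; rewrite nc_ge0 upc.
  rewrite -expR_sum ler_expR sumr_const -[leLHS]mulr_natl -[leRHS]mulrA ler_wpM2r//.
    by rewrite mulr_ge0// exprn_ge0// addr_ge0// nc_ge0.
  by rewrite ler_nat (leq_trans (max_card _))// card_ord.
have h2 : expR (- (C * (1 + nc z) ^+ D)) <= nc (cmgf (nu i) z) * E.
  by rewrite (le_trans h)// ler_wpM2l ?nc_ge0.
rewrite -ler_pdivrMr ?expR_gt0// in h2; apply: le_trans h2.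
rewrite -expRN -expRD ler_expR.
have z1 : 1 <= 1 + nc z by rewrite lerDl nc_ge0.
have zD : (1 + nc z) ^+ D <= (1 + nc z) ^+ D.+1 by rewrite ler_weXn2l.
have := ler_wpM2l C0 zD.
have : 0 <= B * (1 + nc z) ^+ D.+1 by rewrite mulr_ge0// exprn_ge0// addr_ge0// nc_ge0.
rewrite -natr1; lra.
Qed.

End TemperedFactor.

(** For l = 0 the sign in the pairing is trivial and the Z(2)-component disappears. *)
Lemma char_fun_cmgf (R : realType) (mu : probability (RxZ2 R) R) (s : R) :
  char_fun mu (s, false) =
  cmgf (distribution mu (mk_mfun (@measurable_fst _ _ R bool))) ('i * s%:C).
Proof.
rewrite cmgf_distribution; last by rewrite /= mul0r mulr0 subr0 mgf0 ltry.
congr (integralC mu _); apply/funext => x.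
by rewrite /pairing andbF expr0 mulr1 -mulrA -[s%:C * _]rmorphM cexp_imag mulrC.
Qed.

Lemma char_funR_cmgf (R : realType) (gamma : probability R R) (s : R) :
  char_funR gamma s = cmgf gamma ('i * s%:C).
Proof.
congr (integralC gamma _); apply/funext => x.
by rewrite -mulrA -[s%:C * _]rmorphM cexp_imag mulrC.
Qed.

(** * Linear forms with values in R x Z(2) *)

Section LinearForms.
Variables (R : realType) (disp : measure_display) (Omega : measurableType disp).
Variables (P : probability Omega R) (n : nat) (xi : 'I_n -> {RV P >-> RxZ2 R}).
Variables (a b c d : 'I_n -> {additive RxZ2 R -> RxZ2 R}).
Hypotheses (indep : independent_RVs xi) (ac : forall j, continuous (a j))
  (bc : forall j, continuous (b j)) (cc : forall j, continuous (c j))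
  (dc : forall j, continuous (d j)).
Hypothesis ident : identically_distributed P
  (fun w => (\sum_(j < n) a j (xi j w), \sum_(j < n) b j (xi j w)))
  (fun w => (\sum_(j < n) c j (xi j w), \sum_(j < n) d j (xi j w))).

Definition real_part j : {mfun Omega >-> R} :=
  mk_mfun (measurableT_comp (@measurable_fst _ _ R bool) (measurable_funPT (xi j))).

Let real_indep : @independent_RVs _ _ Omega _ R P n real_part.
Proof. by apply: (fst_independent _ indep). Qed.

Let nu j : probability R R := distribution P (real_part j).

Lemma fst_linear_form (e : 'I_n -> {additive RxZ2 R -> RxZ2 R}) w :
  (forall j, continuous (e j)) ->
  (\sum_(j < n) e j (xi j w)).1 = \sum_(j < n) real_coef (e j) * real_part j w.
Proof.
move=> ec; rewrite (raddf_sum (@fst R bool)); apply: eq_bigr => j _.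
by rewrite (endoE (ec j)).
Qed.

(** For the real components L_1', L_2' the variable u L_1' + v L_2' is the sum of the (a_j' u + b_j'
    v) X_j. By independence the squared modulus of its characteristic function at 1 is the left-hand
    side, and its law depends only on that of (L_1, L_2). *)
Lemma cos_functional_equation u v :
  \prod_j \int[symm (nu j)]_y cos ((real_coef (a j) * u + real_coef (b j) * v) * y) =
  \prod_j \int[symm (nu j)]_y cos ((real_coef (c j) * u + real_coef (d j) * v) * y).
Proof.
pose Z (e f : 'I_n -> {additive RxZ2 R -> RxZ2 R}) :=
  distribution P (partial_sum real_part (fun j => real_coef (e j) * u + real_coef (f j) * v) n).
have ZE e f : nc (cmgf (Z e f) ('i * 1%:C)) ^+ 2 =
    \prod_j \int[symm (nu j)]_y cos ((real_coef (e j) * u + real_coef (f j) * v) * y).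
  rewrite (cmgf_partial_sum real_indep (leqnn n) _).2; last first.
    by move=> j; rewrite /= mul0r mulr0 subr0 mulr0 mgf0 ltry.
  rewrite nc_prod -prodrXl; apply: eq_big => [j|j _]; first by rewrite ltn_ord.
  by rewrite cos_symm rmorph1 mulr1 mulrC.
rewrite -!ZE (eq_cmgf _ (nu2 := Z c d))// => A mA.
(* The event u L_1' + v L_2' in A, as a set of values of the pair, to which the equality of laws
   applies. *)
pose E := [set x : RxZ2 R * RxZ2 R | A (u * x.1.1 + v * x.2.1)].
have mE : measurable E.
  rewrite -[E]setTI; apply: (_ : measurable_fun setT
    (fun x : RxZ2 R * RxZ2 R => u * x.1.1 + v * x.2.1)) => //.
  apply: measurable_funD; apply: measurable_funM => //.
    by apply: (measurableT_comp measurable_fst measurable_fst).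
  by apply: (measurableT_comp measurable_fst measurable_snd).
have preE (e f : 'I_n -> {additive RxZ2 R -> RxZ2 R}) :
    (forall j, continuous (e j)) -> (forall j, continuous (f j)) ->
    Z e f A = pushforward P
      (fun w => (\sum_(j < n) e j (xi j w), \sum_(j < n) f j (xi j w))) E.
  move=> ec fc; congr (P _); apply/funext => w; congr A.
  rewrite /= !fst_linear_form// !mulr_sumr -big_split /= /partial_sum_fun.
  by apply: eq_big => [j|j _]; [rewrite ltn_ord|rewrite mulrDl mulrCA -!mulrA; ring].
exact: etrans (preE a b ac bc) (etrans (ident mE) (esym (preE c d cc dc))).
Qed.

(** The sum of the r_j X_j is taken over all j, those with r_j = 0 being harmless; its i-th summand
    is X_i itself, because r_i = 1. *)
Lemma real_part_gaussian i :
  (forall j, real_coef (a i) * real_coef (d j) - real_coef (b i) * real_coef (c j) != 0) ->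
  exists gamma : probability R R, gaussian gamma /\
    forall s, cmgf (nu i) ('i * s%:C) = cmgf gamma ('i * s%:C).
Proof.
move=> idet; pose r := ratio (fun j => real_coef (a j)) (fun j => real_coef (b j)) i.
have [Q [del [Q0 del0 QE]]] := functional_equation
  (fun j => @continuous_cos_transform _ (symm (nu j)))
  (fun j => cos_transform0 (symm (nu j)))
  (fun j => cos_transformN (symm (nu j))) cos_functional_equation idet.
have tZ : tempered (distribution P (partial_sum real_part r n)).
  apply: (symm_tempered Q0 del0) => s sdel; rewrite -QE//.
  rewrite (cmgf_partial_sum real_indep (leqnn n) _).2; last first.
    by move=> j; rewrite /= mul0r mulr0 subr0 mulr0 mgf0 ltry.
  rewrite nc_prod -prodrXl; apply: eq_big => [j|j _]; first by rewrite ltn_ord.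
  by rewrite cos_symm mulrCA -rmorphM.
have [||gamma [gg gE]] := tempered_gaussian (@tempered_factor _ _
  (fun j => distribution P (scale_rv real_part r j)) _ _ _ tZ i).
- move=> t; rewrite (mgf_partial_sum r real_indep)//.
  by apply: eq_big => [j|j _]; [rewrite ltn_ord|rewrite mgf_scale].
- move=> z fin.
  rewrite (cmgf_partial_sum real_indep (leqnn n) _).2; last first.
    by move=> j; rewrite -mgf_scale.
  by apply: eq_big => [j|j _]; [rewrite ltn_ord|rewrite cmgf_scale// -mgf_scale].
exists gamma; split => // s; rewrite -gE cmgf_scale.
  by rewrite [r i](ratio_i idet) rmorph1 mul1r.
by rewrite /= mul0r mulr0 subr0 mulr0 mgf0 ltry.
Qed.

End LinearForms.

Theorem theorem2 (R : realType) (disp : measure_display)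
  (Omega : measurableType disp) (P : probability Omega R) (n : nat)
  (xi : 'I_n -> {RV P >-> RxZ2 R})
  (a b c d : 'I_n -> {additive RxZ2 R -> RxZ2 R}) :
  independent_RVs xi ->
  (forall j, continuous (a j)) -> (forall j, continuous (b j)) ->
  (forall j, continuous (c j)) -> (forall j, continuous (d j)) ->
  identically_distributed P
    (fun w => (\sum_(j < n) a j (xi j w), \sum_(j < n) b j (xi j w)))
    (fun w => (\sum_(j < n) c j (xi j w), \sum_(j < n) d j (xi j w))) ->
  forall i : 'I_n,
    (forall j : 'I_n,
       real_coef (a i) * real_coef (d j) - real_coef (b i) * real_coef (c j) != 0) ->
    Lambda (distribution P (xi i)).
Proof.
move=> indep ac bc cc dc ident i idet.
have [gamma [gg gE]] := real_part_gaussian indep ac bc cc dc ident idet.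
exists gamma; split => // s.
by rewrite char_fun_cmgf char_funR_cmgf -gE; exact: eq_cmgf.
Qed.
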